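(* Let $A\in\mathbb{R}^{m\times n}$ be an arbitrary matrix and let $k\ge 1$ be an integer, with $U_k,\overline{U}_k,\Sigma_k,\overline{\Sigma}_k$ given by the partitioned singular value decomposition of $A$ described in the context. Let $D\in\mathbb{R}^{m\times r}$ satisfy $\operatorname{rank}(D^{T}U_k)=k$, and let $Z=DG\in\mathbb{R}^{m\times \ell}$, where $G\in\mathbb{R}^{r\times \ell}$ is a random matrix whose columns are independent $r$-variate standard Gaussian vectors and $\ell\le\min\{\operatorname{rank}(A),\operatorname{rank}(D)\}\le r$. Define $$\tau_k=\frac{\|\tan(U_k,\,DD^{T}U_k)\,\Sigma_k\|_F}{\|\overline{\Sigma}_k\|_F},\qquad \rho_k=\frac{\|[I_r-\Pi(D^{T}U_k)]D^{T}\|_F\;\|\Sigma_k(U_k^{T}DD^{T}U_k)^{-1/2}\|_F}{\|\overline{\Sigma}_k\|_F}.$$ Then, if $\ell\ge k+2$, $$\mathbb{E}\big[\|[I_m-\Pi(Z)]A\|_F\big]\le\Big(1+\tau_k^2+\frac{\rho_k^2}{\ell-k-1}\Big)^{1/2}\|\overline{\Sigma}_k\|_F .$$ Moreover, if $\ell\ge k+4$, then for all real $u,t\ge 1$, the inequality $$\|[I_m-\Pi(Z)]A\|_F\le\Big(1+\tau_k+\sqrt{3}\,ut\cdot\frac{\rho_k}{\sqrt{\ell-k+1}}\Big)\|\overline{\Sigma}_k\|_F$$ holds with probability at least $1-e^{-u^2/2}-t^{-(\ell-k)}$.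
   Context: Partitioned SVD: $A=U\Sigma V^{T}$ with $U\in\mathbb{R}^{m\times m}$, $V\in\mathbb{R}^{n\times n}$ orthogonal and $\Sigma\in\mathbb{R}^{m\times n}$ (rectangular) diagonal with diagonal entries the singular values $\sigma_1\ge\dots\ge\sigma_{\min\{m,n\}}\ge 0$. For $k\le\min\{m,n\}$ write $U=[U_k\ \overline{U}_k]$, $V=[V_k\ \overline{V}_k]$ with $U_k\in\mathbb{R}^{m\times k}$, $\overline{U}_k\in\mathbb{R}^{m\times(m-k)}$, $V_k\in\mathbb{R}^{n\times k}$, $\overline{V}_k\in\mathbb{R}^{n\times(n-k)}$, and $\Sigma=\begin{bmatrix}\Sigma_k&\\&\overline{\Sigma}_k\end{bmatrix}$ with $\Sigma_k\in\mathbb{R}^{k\times k}$, $\overline{\Sigma}_k\in\mathbb{R}^{(m-k)\times(n-k)}$. $\|\cdot\|_F$ is the Frobenius norm. $M^{\dagger}$ is the Moore-Penrose inverse and $\Pi(M)=MM^{\dagger}$ is the orthogonal projection onto the column space of $M$. $I_p$ is the $p\times p$ identity. Tangent matrix: if $[M\ \overline{M}]$ is a $p\times p$ orthogonal matrix with $M\in\mathbb{R}^{p\times k}$ and $N\in\mathbb{R}^{p\times k}$ has full column rank, then $\tan(M,N)=\overline{M}^{T}N(M^{T}N)^{\dagger}\in\mathbb{R}^{(p-k)\times k}$. Here $\tan(U_k,\cdot)$ is formed with complement $\overline{U}_k$. *)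

(* Defs.v *)
From mathcomp Require Export all_boot all_order all_algebra.
From mathcomp Require Export all_classical all_reals all_analysis.
Export numFieldNormedType.Exports.
Import Order.TTheory GRing.Theory Num.Theory.

Set Implicit Arguments.
Unset Strict Implicit.
Unset Printing Implicit Defensive.

Local Open Scope classical_set_scope.
Local Open Scope ring_scope.

Definition frob (R : realType) (p q : nat) (M : 'M[R]_(p, q)) : R :=
  Num.sqrt (\sum_i \sum_j M i j ^+ 2).

(* The four Penrose equations. *)
Definition is_mpinv (R : realType) (p q : nat)
    (M : 'M[R]_(p, q)) (X : 'M[R]_(q, p)) : Prop :=
  [/\ M *m X *m M = M, X *m M *m X = X,
      (M *m X)^T = M *m X & (X *m M)^T = X *m M].

(* The default value 0 is never used: see mpinvP and mpinv_eq. *)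
Definition mpinv (R : realType) (p q : nat) (M : 'M[R]_(p, q)) : 'M[R]_(q, p) :=
  xget 0 [set X | is_mpinv M X].

Definition colproj (R : realType) (p q : nat) (M : 'M[R]_(p, q)) : 'M[R]_p :=
  M *m mpinv M.

Definition orthomx (R : realType) (p : nat) (U : 'M[R]_p) : Prop :=
  U^T *m U = 1%:M /\ U *m U^T = 1%:M.

(* On rectangular matrices is_diag_mx only asks for M i j = 0 when i and j
   differ as natural numbers. *)
Definition is_svd (R : realType) (m n : nat) (A : 'M[R]_(m, n))
    (U : 'M[R]_m) (S : 'M[R]_(m, n)) (V : 'M[R]_n) : Prop :=
  [/\ orthomx U, orthomx V, A = U *m S *m V^T, is_diag_mx S &
      (forall (i : 'I_m) (j : 'I_n), i = j :> nat -> 0 <= S i j) /\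
      (forall (i i' : 'I_m) (j j' : 'I_n), i = j :> nat -> i' = j' :> nat ->
        (i <= i')%N -> S i' j' <= S i j)].

Definition hd_ord (p k : nat) (kp : (k <= p)%N) : 'I_k -> 'I_p :=
  widen_ord kp.

(* i : 'I_(p - k) is sent to k + i : 'I_p. *)
Definition tl_ord (p k : nat) (kp : (k <= p)%N) (i : 'I_(p - k)) : 'I_p :=
  cast_ord (subnKC kp) (rshift k i).

Definition hd_cols (R : realType) (q p k : nat) (kp : (k <= p)%N)
    (M : 'M[R]_(q, p)) : 'M[R]_(q, k) := colsub (hd_ord kp) M.

Definition tl_cols (R : realType) (q p k : nat) (kp : (k <= p)%N)
    (M : 'M[R]_(q, p)) : 'M[R]_(q, p - k) := colsub (@tl_ord p k kp) M.

Definition hd_block (R : realType) (m n k : nat) (km : (k <= m)%N)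
    (kn : (k <= n)%N) (S : 'M[R]_(m, n)) : 'M[R]_k :=
  mxsub (hd_ord km) (hd_ord kn) S.

Definition tl_block (R : realType) (m n k : nat) (km : (k <= m)%N)
    (kn : (k <= n)%N) (S : 'M[R]_(m, n)) : 'M[R]_(m - k, n - k) :=
  mxsub (@tl_ord m k km) (@tl_ord n k kn) S.

(* tan(M, N), where the columns of Mb complete those of M to an orthonormal
   basis. *)
Definition mxtan (R : realType) (p k : nat) (M : 'M[R]_(p, k))
    (Mb : 'M[R]_(p, p - k)) (N : 'M[R]_(p, k)) : 'M[R]_(p - k, k) :=
  Mb^T *m N *m mpinv (M^T *m N).

Definition psdmx (R : realType) (p : nat) (M : 'M[R]_p) : Prop :=
  M^T = M /\ forall x : 'rV[R]_p, 0 <= (x *m M *m x^T) 0 0.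

(* The symmetric positive semidefinite square root; meaningful for psdmx M. *)
Definition sqrtmx (R : realType) (p : nat) (M : 'M[R]_p) : 'M[R]_p :=
  xget 0 [set X | psdmx X /\ X *m X = M].

Definition invsqrtmx (R : realType) (p : nat) (M : 'M[R]_p) : 'M[R]_p :=
  invmx (sqrtmx M).

Definition mutually_independent (R : realType) (d d' : measure_display)
    (T : measurableType d) (T' : measurableType d') (P : probability T R)
    (I : finType) (X : I -> T -> T') : Prop :=
  forall (J : {set I}) (B : I -> set T'),
    (forall i, i \in J -> measurable (B i)) ->
    P (\bigcap_(i in [set` J]) (X i @^-1` B i)) =
    (\prod_(i in J) P (X i @^-1` B i))%E.

(* Independent coordinates, each with law N(0, 1). *)
Definition std_gaussian_vec (R : realType) (d : measure_display)
    (T : measurableType d) (P : probability T R) (r : nat)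
    (X : T -> r.-tuple R) : Prop :=
  [/\ forall i, measurable_fun [set: T] (fun w => tnth (X w) i),
      forall i (B : set R), measurable B ->
        P ((fun w => tnth (X w) i) @^-1` B) = normal_prob 0 1 B &
      mutually_independent P (fun i w => tnth (X w) i)].

Definition rv_col (R : realType) (T : Type) (r l : nat)
    (G : T -> 'M[R]_(r, l)) (j : 'I_l) (w : T) : r.-tuple R :=
  [tuple G w i j | i < r].

(* Independence of the columns is with respect to the product Borel
   sigma-algebra of r.-tuple R. *)
Definition std_gaussian_mx (R : realType) (d : measure_display)
    (T : measurableType d) (P : probability T R) (r l : nat)
    (G : T -> 'M[R]_(r, l)) : Prop :=
  (forall j, std_gaussian_vec P (rv_col G j)) /\
  mutually_independent P (rv_col G).

Lemma gram_unit (R : realType) (p q : nat) (C : 'M[R]_(p, q)) :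
  row_free C -> C *m C^T \in unitmx.
Proof.
move=> Cfree; rewrite -row_free_unit -kermx_eq0; apply/eqP/row_matrixP => i.
rewrite row0; set v := row i _.
have : v *m (C *m C^T) = 0.
  by apply/sub_kermxP; rewrite row_sub.
move=> /(congr1 (mulmx^~ v^T)); rewrite mul0mx mulmxA -mulmxA -trmx_mul.
move=> /matrixP/(_ 0 0); rewrite !mxE => h.
have vC0 : v *m C = 0.
  have : \sum_j (v *m C) 0 j ^+ 2 = 0.
    by rewrite -[RHS]h; apply: eq_bigr => j _; rewrite [_^T _ _]mxE -expr2.
  move=> /eqP; rewrite psumr_eq0; last by move=> j _; exact: sqr_ge0.
  move=> /allP h0; apply/rowP => j; rewrite [RHS]mxE; apply/eqP.
  by have := h0 j (mem_index_enum j); rewrite /= sqrf_eq0.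
by apply: (row_free_inj Cfree); rewrite vC0 mul0mx.
Qed.

Lemma mpinv_exists (R : realType) (p q : nat) (M : 'M[R]_(p, q)) :
  exists X, is_mpinv M X.
Proof.
have [t [B [C [MBC Bfull Cfree]]]] : exists t (B : 'M[R]_(p, t))
    (C : 'M[R]_(t, q)), [/\ M = B *m C, row_full B & row_free C].
  exists (\rank M), (col_base M), (row_base M).
  by split; [rewrite mulmx_base|exact: col_base_full|exact: row_base_free].
have uC : C *m C^T \in unitmx by exact: gram_unit.
have uB : B^T *m B \in unitmx.
  rewrite -[X in _ *m X]trmxK; apply/gram_unit.
  by rewrite /row_free mxrank_tr.
have symB : (invmx (B^T *m B))^T = invmx (B^T *m B).
  by rewrite trmx_inv trmx_mul trmxK.
have symC : (invmx (C *m C^T))^T = invmx (C *m C^T).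
  by rewrite trmx_inv trmx_mul trmxK.
pose X := C^T *m invmx (C *m C^T) *m invmx (B^T *m B) *m B^T.
have MX : M *m X = B *m invmx (B^T *m B) *m B^T.
  rewrite MBC /X !mulmxA -(mulmxA B C) -(mulmxA B) mulmxV// mulmx1.
  by [].
have XM : X *m M = C^T *m invmx (C *m C^T) *m C.
  rewrite MBC /X !mulmxA -(mulmxA _ B^T) -(mulmxA _ (invmx (B^T *m B))).
  by rewrite mulVmx// mulmx1.
exists X; split.
- rewrite MX [in LHS]MBC !mulmxA -(mulmxA _ B^T) -(mulmxA B (invmx _)).
  by rewrite mulVmx// mulmx1 -MBC.
- rewrite XM {1}/X !mulmxA -(mulmxA _ C) -(mulmxA _ (invmx (C *m C^T)) (C *m _)).
  by rewrite mulVmx// mulmx1.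
- by rewrite MX !trmx_mul trmxK symB mulmxA.
- by rewrite XM !trmx_mul trmxK symC mulmxA.
Qed.

Lemma mpinvP (R : realType) (p q : nat) (M : 'M[R]_(p, q)) :
  is_mpinv M (mpinv M).
Proof. by have := xgetPex 0 (mpinv_exists M). Qed.

Lemma mpinv_eq (R : realType) (p q : nat) (M : 'M[R]_(p, q)) X :
  is_mpinv M X -> mpinv M = X.
Proof.
have [y1 y2 y3 y4] := mpinvP M; move: y1 y2 y3 y4.
move: (mpinv M) => Y y1 y2 y3 y4 [x1 x2 x3 x4].
have MXY : M *m Y = M *m X.
  by rewrite -y3 -[in LHS]x1 -(mulmxA (M *m X)) trmx_mul x3 y3 mulmxA y1.
have YXM : Y *m M = X *m M.
  by rewrite -y4 -[in LHS]x1 -(mulmxA M) mulmxA trmx_mul y4 x4 -mulmxA (mulmxA M) y1.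
by rewrite -y2 -mulmxA MXY mulmxA YXM x2.
Qed.

(* Main.v *)
Require Import Defs.
From mathcomp Require Import all_boot all_order all_algebra.
From mathcomp Require Import all_classical all_reals all_analysis.
From mathcomp Require Import complex measurable_realfun ring lra zify.
Import Order.TTheory GRing.Theory Num.Theory.
Import HBNNSimple.

(** Write C = D^T Uk = Q X with Q^T Q = 1 and X = (C^T C)^(1/2), complete Q by
    N^T to an orthogonal matrix, and put G1 = Q^T G, G2 = N G, K = G1 G1^T,
    M = X^-1 Sk and T = G1^T K^-1 M.  Then Uk^T Z T = Sk, and comparing the
    projection residual with A - Z T Vk^T gives
      |(1 - Pi(Z)) A|^2 <= |Sbk|^2 + |tan(..) Sk + (Ubk^T D N^T) G2 T|^2.
    By rotation invariance (G1, G2) is again Gaussian, so G2 is independent of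
    T, and given T the last product is Gaussian with total variance
    |Ubk^T D N^T|^2 |T|^2.  Now |T|^2 is a combination of numbers u K^-1 u^T
    with u a unit vector; rotating u to the first basis vector and projecting
    the first row of G1 on the complement of the other ones, 1 / (u K^-1 u^T)
    dominates a chi-square variable with l - k + 1 degrees of freedom
    independent of the other rows.  Negative moments of a chi-square come from
    its Laplace transform (1 + z^2)^(-j/2) and Tonelli's theorem.

    For the deviation bound put x = u^2 and p = l - k.  If x <= 104/27, Markov's
    inequality for the second moment suffices, since 5/(9x) <= exp(-x/2).
    Otherwise |T|^2 is controlled by its moment of order p/2, up to probability
    t^-p, and, given T, the quadratic form by a Gaussian tail bound averaged
    over its entries; the two thresholds multiply to 3 = (26/9)(27/26). *)

Set Implicit Arguments.
Unset Strict Implicit.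
Unset Printing Implicit Defensive.

Local Open Scope classical_set_scope.
Local Open Scope ring_scope.

(** * The standard normal law and its rotations *)

(** No conditional expectation occurs: an integral over a Gaussian array is rewritten as a double
    integral in which the entries conditioned on come from one sample and the others from a second,
    so each conditional estimate concerns a matrix with a frozen part. Rotation invariance uses no
    density in several variables: only a rotation of the plane is integrated. Quantities built on
    K^-1 are set to 0 where K is singular, which keeps them Borel; that event is shown to be null.

    Origin of the constants: Markov's inequality for the second moment is worst at p = 4, where it
    gives 5/(9x). The moment of order p at p = 4 needs a constant whose square is at least 25/3, and
    26/9 lies just above that root. The tail at level y >= 4 is at most exp(-13y/27); y = 27x/26
    turns this into exp(-x/2), and y = 4 is x = 104/27.

    In the mean the tangent term stays inside the square, the cross term having mean zero; in the
    deviation bound it is split off by the triangle inequality. *)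

Lemma ge0_integral_normal_prob (R : realType) (h : R -> \bar R) :
  measurable_fun setT h -> (forall x, 0 <= h x)%E ->
  (\int[normal_prob 0 1]_x h x =
   \int[lebesgue_measure]_x (h x * (normal_pdf 0 1 x)%:E))%E.
Proof.
move=> mh h0.
have mpdf : measurable_fun [set: measurableTypeR R] (EFin \o normal_pdf (0 : R) 1).
  by apply/measurable_EFinP; exact: measurable_normal_pdf.
pose f_ := @nnsfun_approx _ (measurableTypeR R) _ _ measurableT _ mh.
have mf n : measurable_fun setT (EFin \o f_ n).
  by apply/measurable_EFinP; exact: measurable_funPT.
have ndf x : {homo (fun n => (f_ n x)%:E) : m n / (m <= n)%N >-> (m <= n)%E}.
  by move=> m n mn; rewrite lee_fin; exact/lefP/nd_nnsfun_approx.
have limf x : limn (fun n => (f_ n x)%:E) = h x.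
  by apply/cvg_lim => //; apply: cvg_nnsfun_approx => // *; exact: h0.
transitivity (limn (fun n => \int[normal_prob 0 1]_x (f_ n x)%:E))%E.
  rewrite -monotone_convergence//.
  - by apply: eq_integral => x _; rewrite limf.
  - by move=> n y _; rewrite lee_fin.
transitivity (limn (fun n =>
    \int[lebesgue_measure]_x ((f_ n x)%:E * (normal_pdf 0 1 x)%:E)))%E; last first.
  rewrite -monotone_convergence//.
  - apply: eq_integral => x _; apply/cvg_lim => //.
    apply: cvgeZr => //.
    by rewrite -limf; apply: ereal_nondecreasing_is_cvgn; exact: (ndf x).
  - by move=> n; apply: emeasurable_funM => //; apply/measurable_EFinP; exact: measurable_funPT.
  - by move=> n y _; rewrite mule_ge0// lee_fin// normal_pdf_ge0.
  - move=> x _ m n mn; apply: lee_wpmul2r; first by rewrite lee_fin normal_pdf_ge0.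
    exact: (ndf x).
congr (limn _); apply/funext => n.
transitivity (\sum_(k \in range (f_ n))
    \int[normal_prob 0 1]_x (k * \1_(f_ n @^-1` [set k]) x)%:E)%E.
  under eq_integral do rewrite fimfunE -fsumEFin//.
  rewrite ge0_integral_fsum//.
  - by move=> y; exact/measurable_EFinP/measurable_funM.
  - by move=> y x _; rewrite nnfun_muleindic_ge0.
transitivity (\sum_(k \in range (f_ n))
    \int[lebesgue_measure]_x ((k * \1_(f_ n @^-1` [set k]) x)%:E *
      (normal_pdf 0 1 x)%:E))%E; last first.
  rewrite -ge0_integral_fsum//.
  - by apply: eq_integral => x _; rewrite fimfunE -fsumEFin// ge0_mule_fsuml// => r;
    rewrite nnfun_muleindic_ge0.
  - by move=> r; apply: emeasurable_funM => //; exact/measurable_EFinP/measurable_funM.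
  - by move=> r x _; rewrite mule_ge0 ?nnfun_muleindic_ge0// lee_fin normal_pdf_ge0.
apply: eq_fsbigr => r _.
have [r0|r0] := ltP r 0.
  rewrite preimage_nnfun0//.
  by rewrite !integral0_eq// => x _; rewrite indic0 /= mulr0// mul0e.
rewrite integralZl_indic_nnsfun// integral_indic//= setIT.
under [RHS]eq_integral do rewrite EFinM -muleA.
rewrite ge0_integralZl//; last 2 first.
- by apply: emeasurable_funM => //; exact/measurable_EFinP/measurable_indic.
- by move=> x _; rewrite mule_ge0// lee_fin ?normal_pdf_ge0.
congr (_ * _)%E; rewrite /normal_prob [LHS]integral_mkcond/=.
apply: eq_integral => x _; rewrite patchE indicE.
by case: ifP => _; rewrite ?mul1e ?mul0e.
Qed.


(** Uniqueness of Lebesgue measure reduces this to half-open intervals. For negative [s] the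
    preimage is closed at the other end, which does not change its length. *)
Lemma lebesgue_measure_affine (R : realType) (a s : R) (A : set R) : s != 0 ->
  measurable A ->
  (`|s|%:E * lebesgue_measure ((fun x => (a + s * x)%R) @^-1` A) =
   lebesgue_measure A)%E.
Proof.
move=> s0 mA; have s_gt0 : 0 < `|s| by rewrite normr_gt0.
pose f := (fun x => a + s * x) : measurableTypeR R -> measurableTypeR R.
have mf : measurable_fun setT f.
  by apply: measurable_funD => //; exact: measurable_funM.
pose k : {nonneg R} := NngNum (normr_ge0 s).
pose m0 : {measure set (measurableTypeR R) -> \bar R} :=
  mscale k (pushforward lebesgue_measure f).
pose m' := m0 mf.
rewrite -[LHS]/(m' A); apply/esym/lebesgue_measure_unique => //= _ [[b c]] _ <-.
change (lebesgue_measure (`]b, c] : set R) = (`|s|%:E * lebesgue_measure ((fun x : R => (a +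
  s * x)%R) @^-1` (`]b, c] : set R)))%E).
apply/esym.
have [sp|sn|/eqP] := ltgtP s 0; last by rewrite (negbTE s0).
- have -> : (fun x => a + s * x) @^-1` `]b, c] = `[(c - a) / s, (b - a) / s[%classic.
    apply/seteqP; split => x /=; rewrite !in_itv/= => /andP[h1 h2]; apply/andP; split.
    + by rewrite ler_ndivrMr//; lra.
    + by rewrite ltr_ndivlMr//; lra.
    + by move: h2; rewrite ltr_ndivlMr//; lra.
    + by move: h1; rewrite ler_ndivrMr//; lra.
  rewrite !lebesgue_measure_itv/= !lte_fin ltr_nM2r ?invr_lt0// ltrD2r.
  case: ifPn => _; last by rewrite mule0.
  by rewrite !EFinN -!EFinB -EFinM ltr0_norm//; congr EFin; field.
- have -> : (fun x => a + s * x) @^-1` `]b, c] = `](b - a) / s, (c - a) / s]%classic.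
    apply/seteqP; split => x /=; rewrite !in_itv/= => /andP[h1 h2]; apply/andP; split.
    + by rewrite ltr_pdivrMr//; lra.
    + by rewrite ler_pdivlMr//; lra.
    + by move: h1; rewrite ltr_pdivrMr//; lra.
    + by move: h2; rewrite ler_pdivlMr//; lra.
  rewrite !lebesgue_measure_itv/= !lte_fin ltr_pM2r ?invr_gt0// ltrD2r.
  case: ifPn => _; last by rewrite mule0.
  by rewrite -!EFinB -EFinM gtr0_norm//; congr EFin; field.
Qed.

Lemma ge0_integral_affine (R : realType) (a s : R) (h : R -> \bar R) : s != 0 ->
  measurable_fun setT h -> (forall x, 0 <= h x)%E ->
  (`|s|%:E * \int[lebesgue_measure]_x h (a + s * x)%R =
   \int[lebesgue_measure]_x h x)%E.
Proof.
move=> s0 mh h0.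
pose f := (fun x => a + s * x) : measurableTypeR R -> measurableTypeR R.
have mf : measurable_fun setT f.
  by apply: measurable_funD => //; exact: measurable_funM.
pose k : {nonneg R} := NngNum (normr_ge0 s).
pose m0 : {measure set (measurableTypeR R) -> \bar R} :=
  mscale k (pushforward lebesgue_measure f).
pose m' := m0 mf.
transitivity (\int[m']_x h x)%E.
  by rewrite ge0_integral_mscale// ge0_integral_pushforward// preimage_setT.
apply: eq_measure_integral => A mA _.
exact: (lebesgue_measure_affine a s0 mA).
Qed.

Lemma normal_pdf01E (R : realType) (x : R) :
  normal_pdf 0 1 x = (Num.sqrt (pi *+ 2))^-1 * expR (- (x ^+ 2 / 2)).
Proof.
rewrite normal_pdfE ?oner_eq0// /normal_peak /normal_fun subr0 expr1n mul1r.
by rewrite mulNr.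
Qed.


(* Substituting [v = c x + s y] in the inner integral and then
   [z = (c v - x) / s] in the other one turns the rotated integrand into a product. *)
Lemma normal_prob_rot (R : realType) (c s : R) (B1 B2 : set R) : s != 0 ->
  c ^+ 2 + s ^+ 2 = 1 -> measurable B1 -> measurable B2 ->
  ((normal_prob 0 1 \x normal_prob 0 1)
     [set z : R * R | B1 (c * z.1 + s * z.2)%R /\ B2 (c * z.2 - s * z.1)%R] =
   normal_prob 0 1 B1 * normal_prob 0 1 B2)%E.
Proof.
move=> s0 cs mB1 mB2; pose phi := normal_pdf (0 : R) 1.
have mphi : measurable_fun [set: R] phi by exact: measurable_normal_pdf.
have phi0 x : 0 <= phi x by exact: normal_pdf_ge0.
have mb1 : measurable_fun [set: R] (\1_B1 : R -> R) by exact: measurable_indic.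
have mb2 : measurable_fun [set: R] (\1_B2 : R -> R) by exact: measurable_indic.
have b10 x : 0 <= (\1_B1 x : R) by [].
have b20 x : 0 <= (\1_B2 x : R) by [].
(* The integrand in the variables x and v = c x + s y; the factor [|s|^-1] is the Jacobian of the
   first substitution. *)
pose H (x v : R) : R := \1_B1 v * \1_B2 ((c * v - x) / s) *
  phi ((v - c * x) / s) * phi x * `|s|^-1.
have H0 x v : 0 <= H x v by rewrite /H !mulr_ge0// invr_ge0.
have mH : measurable_fun [set: R * R] (fun z => H z.1 z.2).
  rewrite /H; apply: measurable_funM => //; apply: measurable_funM; last exact: measurableT_comp.
  apply: measurable_funM; first apply: measurable_funM.
  - exact: measurableT_comp.
  - apply: measurableT_comp => //; apply: measurable_funM => //.
    by apply: measurable_funB => //; exact: measurable_funM.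
  - apply: measurableT_comp => //; apply: measurable_funM => //.
    by apply: measurable_funB => //; exact: measurable_funM.

have mA : measurable [set z : R * R | B1 (c * z.1 + s * z.2) /\ B2 (c * z.2 - s * z.1)].
  apply: measurableI.
  - rewrite -[X in measurable X]setTI; apply: (measurable_funD _ _ measurableT mB1).
    + by apply: measurable_funM.
    + by apply: measurable_funM.
  - rewrite -[X in measurable X]setTI; apply: (measurable_funB _ _ measurableT mB2).
    + by apply: measurable_funM.
    + by apply: measurable_funM.
transitivity (\int[lebesgue_measure]_x \int[lebesgue_measure]_v (H x v)%:E)%E.
  rewrite /product_measure1 /= ge0_integral_normal_prob//=; last first.
    exact: (@measurable_fun_xsection _ _ _ _ _ (normal_prob 0 1) _ mA).
  apply: eq_integral => x _.
  pose h (y : R) : \bar R := (\1_B1 (c * x + s * y) * \1_B2 (c * y - s * x) * phi y)%:E.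
  have mh : measurable_fun [set: R] h.
    apply/measurable_EFinP; apply: measurable_funM => //; apply: measurable_funM.
    - apply: measurableT_comp => //; apply: measurable_funD => //; exact: measurable_funM.
    - apply: measurableT_comp => //; apply: measurable_funB => //; exact: measurable_funM.
  have h0 y : (0 <= h y)%E by rewrite lee_fin !mulr_ge0.
  transitivity ((\int[lebesgue_measure]_y h y) * (phi x)%:E)%E.
    congr (_ * _)%E; rewrite /normal_prob integral_mkcond.
    apply: eq_integral => y _; rewrite patchE /h !indicE.
    have -> : (y \in xsection [set z : R * R | B1 (c * z.1 + s * z.2) /\ B2
      (c * z.2 - s * z.1)] x) =
        (c * x + s * y \in B1) && (c * y - s * x \in B2).
      by rewrite mem_xsection; apply/idP/andP; rewrite !inE.
    by case: ifP => [/andP[-> ->]|/negbT]; [rewrite !mul1r|rewrite negb_and => /orP[]/negbTE->;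
      rewrite ?mul0r ?mulr0 ?mul0r].
  have s1 : s^-1 != 0 by rewrite invr_eq0.
  rewrite -(ge0_integral_affine (- (c * x) / s) s1 mh h0).
  have mh' : measurable_fun [set: R] (fun v => h (- (c * x) / s + s^-1 * v)).
    by apply: measurableT_comp => //; apply: measurable_funD => //; exact: measurable_funM.
  rewrite muleAC -EFinM -ge0_integralZl//; last by rewrite lee_fin mulr_ge0.
  apply: eq_integral => v _; rewrite /h /H -!EFinM; congr EFin.
  have -> : c * x + s * (- (c * x) / s + s^-1 * v) = v by field.
  have -> : c * (- (c * x) / s + s^-1 * v) - s * x = (c * v - x) / s.
    apply/eqP; rewrite -subr_eq0; apply/eqP.
    transitivity ((1 - (c ^+ 2 + s ^+ 2)) * x / s); last by rewrite cs subrr !mul0r.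
    by field.
  have -> : - (c * x) / s + s^-1 * v = (v - c * x) / s by field.
  rewrite normfV mulrC [in LHS](mulrC _^-1) !mulrA.
  by [].
have mHE : measurable_fun [set: R * R] (fun z => (H z.1 z.2)%:E) by exact/measurable_EFinP.
have HE0 (z : R * R) : (0 <= (H z.1 z.2)%:E)%E by rewrite lee_fin.
rewrite [LHS](@fubini_tonelli _ _ _ _ R lebesgue_measure lebesgue_measure _ mHE HE0) /=.

pose g (x : R) : \bar R := (\1_B2 x * phi x)%:E.
have mg : measurable_fun [set: R] g by apply/measurable_EFinP; exact: measurable_funM.
have g0 x : (0 <= g x)%E by rewrite lee_fin mulr_ge0.
pose g1 (x : R) : \bar R := (\1_B1 x * phi x)%:E.
have mg1 : measurable_fun [set: R] g1 by apply/measurable_EFinP; exact: measurable_funM.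
have g10 x : (0 <= g1 x)%E by rewrite lee_fin mulr_ge0.
have probE (B : set R) : (normal_prob 0 1 B = \int[lebesgue_measure]_x (\1_B x * phi x)%:E)%E.
  rewrite /normal_prob integral_mkcond; apply: eq_integral => x _.
  by rewrite patchE indicE; case: ifP; rewrite ?mul1r ?mul0r.
transitivity (\int[lebesgue_measure]_v (g1 v * \int[lebesgue_measure]_x g x))%E.
  apply: eq_integral => v _.
  have ms0 : - s != 0 by rewrite oppr_eq0.
  have mHv : measurable_fun [set: R] (fun x => (H x v)%:E).
    exact: (measurableT_comp mHE (measurable_pair2 v)).
  have Hv0 x : (0 <= (H x v)%:E)%E by rewrite lee_fin.
  have mHv' : measurable_fun [set: R] (fun x => (H (c * v + - s * x) v)%:E).
    by apply: (measurableT_comp mHv); apply: measurable_funD => //; exact: measurable_funM.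
  rewrite -(@ge0_integral_affine _ (c * v) (- s) _ ms0 mHv Hv0).
  rewrite -ge0_integralZl// -ge0_integralZl//.
  apply: eq_integral => x _; rewrite -!EFinM; congr EFin.
  rewrite /H normrN.
  have -> : (c * v - (c * v + - s * x)) / s = x by field.
  (* The arguments are s v + c x and c v - s x, whose squares add up to v^2 + x^2. *)
  have hphi : phi ((v - c * (c * v + - s * x)) / s) * phi (c * v + - s * x) = phi v * phi x.
    rewrite /phi !normal_pdf01E.
    have -> : (v - c * (c * v + - s * x)) / s = s * v + c * x.
      by apply/eqP; rewrite -subr_eq0; apply/eqP;
        transitivity ((1 - (c ^+ 2 + s ^+ 2)) * v / s); [field|rewrite cs subrr !mul0r].
    rewrite [LHS]mulrACA [RHS]mulrACA -!expRD; congr (_ * expR _).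
    have -> : - ((s * v + c * x) ^+ 2 / 2) - (c * v + - s * x) ^+ 2 / 2 =
      - ((c ^+ 2 + s ^+ 2) * (v ^+ 2 + x ^+ 2) / 2) by field.
    by rewrite cs; field.
  have s_gt0 : `|s| != 0 by rewrite normr_eq0.
  by rewrite mulrC divfK// -mulrA hphi mulrACA.
rewrite ge0_integralZr//; last exact: integral_ge0.
by rewrite !probE.
Qed.

(** Here [c] is 1 or -1. This covers the degenerate rotations with [s = 0], out of reach of the
    substitution that divides by [s]. *)
Lemma normal_probN (R : realType) (c : R) (B : set R) : c ^+ 2 = 1 -> measurable B ->
  normal_prob 0 1 [set x | B (c * x)] = normal_prob 0 1 B.
Proof.
move=> c1 mB.
have probE (D : set R) :
    (normal_prob 0 1 D = \int[lebesgue_measure]_x (\1_D x * normal_pdf 0 1 x)%:E)%E.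
  rewrite /normal_prob integral_mkcond; apply: eq_integral => x _.
  by rewrite patchE indicE; case: ifP; rewrite ?mul1r ?mul0r.
have c0 : c != 0 by apply/eqP => c0; move/eqP: c1; rewrite c0 expr0n/= eq_sym oner_eq0.
pose g (x : R) : \bar R := (\1_B x * normal_pdf 0 1 x)%:E.
have mg : measurable_fun [set: R] g.
  by apply/measurable_EFinP; apply: measurable_funM => //; exact: measurable_normal_pdf.
have g0 x : (0 <= g x)%E by rewrite lee_fin mulr_ge0// normal_pdf_ge0.
rewrite !probE -(ge0_integral_affine 0 c0 mg g0).
have -> : `|c| = 1 by apply/eqP; rewrite -sqrp_eq1// real_normK ?num_real// c1.
rewrite mul1e; apply: eq_integral => x _; rewrite /g add0r; congr (_ * _)%:E.
by rewrite !normal_pdf01E exprMn c1 mul1r.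
Qed.

Lemma normal_prob_rotation (R : realType) (c s : R) (B1 B2 : set R) :
  c ^+ 2 + s ^+ 2 = 1 -> measurable B1 -> measurable B2 ->
  ((normal_prob 0 1 \x normal_prob 0 1)
     [set z : R * R | B1 (c * z.1 + s * z.2)%R /\ B2 (c * z.2 - s * z.1)%R] =
   normal_prob 0 1 B1 * normal_prob 0 1 B2)%E.
Proof.
move=> cs mB1 mB2; have [s0|s0] := eqVneq s 0; last exact: normal_prob_rot.
move: cs; rewrite s0 expr0n addr0 => c1.
have mc B : measurable B -> measurable [set x : R | B (c * x)].
  by move=> mB; rewrite -[X in measurable X]setTI; apply: (@measurable_funM _ _ _ _ (cst c) id).
rewrite -(normal_probN c1 mB1) -(normal_probN c1 mB2).
rewrite -product_measure1E; [|exact: mc|exact: mc].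
congr (product_measure1 _ _ _); apply/seteqP; split => z /=;
  by rewrite !mul0r subr0 addr0.
Qed.

(** * Arrays of independent standard normal variables *)

(** Law and independence in one formula on boxes. An arbitrary finite index type lets vectors,
    matrices and single rows share one theory. *)
Definition gauss_array (R : realType) (d : measure_display) (T : measurableType d)
    (P : probability T R) (I : finType) (X : I -> T -> R) : Prop :=
  (forall i, measurable_fun [set: T] (X i)) /\
  forall B : I -> set R, (forall i, measurable (B i)) ->
    P [set w | forall i, B i (X i w)] = (\prod_i normal_prob 0 1 (B i))%E.

Lemma measurable_forall (d : measure_display) (T : measurableType d) (I : finType)
    (A : I -> set T) :
  (forall i, measurable (A i)) -> measurable [set w | forall i, A i w].
Proof.
move=> mA.
have -> : [set w | forall i, A i w] = \bigcap_(i in [set: I]) A i.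
  by apply/seteqP; split => w /= h => [i _|i]; exact: h.
by apply: fin_bigcap_measurable => //; exact: finite_finset.
Qed.

Section gauss_array_theory.
Context (R : realType) (d : measure_display) (T : measurableType d) (P : probability T R).

Lemma measurable_gauss_event (I : finType) (X : I -> T -> R) (B : I -> set R) :
  (forall i, measurable_fun [set: T] (X i)) -> (forall i, measurable (B i)) ->
  measurable [set w | forall i, B i (X i w)].
Proof.
move=> mX mB; apply: (@measurable_forall _ _ _ (fun i => [set w | B i (X i w)])) => i.
by rewrite -[X in measurable X]setTI; exact: mX.
Qed.

Lemma gauss_array_inj (I J : finType) (X : I -> T -> R) (f : J -> I) :
  injective f -> gauss_array P X -> gauss_array P (fun j => X (f j)).
Proof.
move=> fI [mX hX]; split=> [j|B mB]; first exact: mX.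
(* Indices outside the image of [f] receive the whole line, of probability one. *)
pose B' i := if [pick j | f j == i] is Some j then B j else setT.
have B'f j : B' (f j) = B j.
  by rewrite /B'; case: pickP => [k /eqP/fI ->//|/(_ j)]; rewrite eqxx.
have mB' i : measurable (B' i) by rewrite /B'; case: pickP.
transitivity (P [set w | forall i, B' i (X i w)]).
  congr (P _); apply/seteqP; split => w /= h i; last by rewrite -B'f.
  by rewrite /B'; case: pickP => // j /eqP <-.
rewrite hX// (bigID (mem (imset f (mem predT))))/= [X in (_ * X)%E]big1 ?mule1; last first.
  move=> i /negP fi; rewrite /B'; case: pickP => [j /eqP fj|_]; last exact: probability_setT.
  by case: fi; rewrite -fj imset_f.
rewrite (big_imset _ (in2W fI))/=.
by apply: eq_bigr => j _; rewrite B'f.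
Qed.

Lemma gauss_array_law (I : finType) (X : I -> T -> R) (i : I) (B : set R) :
  gauss_array P X -> measurable B -> P (X i @^-1` B) = normal_prob 0 1 B.
Proof.
move=> [mX hX] mB; have := hX (fun j => if j == i then B else setT).
rewrite (bigD1 i)//= eqxx big1 ?mule1 => [<-|j /negbTE ->]; last 2 first.
- by move=> j; case: ifP.
- exact: probability_setT.
congr (P _); apply/seteqP; split => w /= h; last by have := h i; rewrite eqxx.
by move=> j; case: eqP => [->|].
Qed.

End gauss_array_theory.

(** * Invariance of Gaussian arrays under orthogonal maps *)

Lemma finite_measure_prod_unique (R : realType) (d1 d2 : measure_display)
    (T1 : measurableType d1) (T2 : measurableType d2)
    (m1 m2 : {measure set (T1 * T2) -> \bar R}) :
  (m1 setT < +oo)%E ->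
  (forall A B, measurable A -> measurable B -> m1 (A `*` B) = m2 (A `*` B)) ->
  forall C, measurable C -> m1 C = m2 C.
Proof.
move=> m1oo m12 C mC.
pose G := [set A `*` B | A in @measurable d1 T1 & B in @measurable d2 T2].
apply: (@measure_unique _ R _ G (fun=> setT)) => //.
- exact: measurable_prod_measurableType.
- move=> _ _ [A1 mA1 [B1 mB1 <-]] [A2 mA2 [B2 mB2 <-]]; rewrite -setXI.
  by exists (A1 `&` A2); [exact: measurableI|exists (B1 `&` B2) => //; exact: measurableI].
- by move=> _; exists setT => //; exists setT => //; rewrite setXTT.
- by apply/seteqP; split=> // x _; exists 0%N.
- by move=> _ [A mA [B mB <-]]; exact: m12.
Qed.

Section gauss_rotation.
Context (R : realType) (d : measure_display) (T : measurableType d) (P : probability T R).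

(** A rotated rectangle is not a rectangle, so the joint law of two coordinates is required on all
    Borel sets of the plane. Both sides are finite measures in [C], the left one a pushforward of
    [P] restricted to the event on the other coordinates, and they agree on rectangles. *)
Lemma gauss_array_pair (I : finType) (X : I -> T -> R) (i j : I) (B : I -> set R)
    (C : set (R * R)) :
  i != j -> gauss_array P X -> (forall k, measurable (B k)) -> measurable C ->
  (P ([set w | C (X i w, X j w)] `&`
      [set w | forall k, k != i -> k != j -> B k (X k w)]) =
   (normal_prob 0 1 \x normal_prob 0 1) C *
   \prod_(k | (k != i) && (k != j)) normal_prob 0 1 (B k))%E.
Proof.
move=> ij [mX hX] mB mC.
pose E := [set w | forall k, k != i -> k != j -> B k (X k w)].
have mE : measurable E.
  apply: (@measurable_forall _ _ _ (fun k => [set w | k != i -> k != j -> B k (X k w)])) => k.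
  case: (k != i); last by rewrite (_ : [set w | _] = setT)//; apply/seteqP; split.
  case: (k != j); last by rewrite (_ : [set w | _] = setT)//; apply/seteqP; split.
  rewrite (_ : [set w | _] = X k @^-1` B k); last by apply/seteqP; split => w //= /(_ isT isT).
  by rewrite -[X in measurable X]setTI; exact: mX.
pose q := (\prod_(k | (k != i) && (k != j)) normal_prob 0 1 (B k))%E.
have q0 : (0 <= q)%E by apply: prode_ge0 => k _; exact: measure_ge0.
have rect A1 A2 : measurable A1 -> measurable A2 ->
    (P ([set w | (A1 `*` A2) (X i w, X j w)] `&` E) =
     normal_prob 0 1 A1 * normal_prob 0 1 A2 * q)%E.
  move=> mA1 mA2.
  pose B' k := if k == i then A1 else if k == j then A2 else B k.
  have mB' k : measurable (B' k) by rewrite /B'; case: ifP => // _; case: ifP.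
  have B'i : B' i = A1 by rewrite /B' eqxx.
  have B'j : B' j = A2 by rewrite /B' eq_sym (negbTE ij) eqxx.
  have := hX B' mB'; rewrite (bigD1 i)//= (bigD1 j)/=; last by rewrite eq_sym.
  rewrite B'i B'j muleA.
  rewrite (eq_bigr (fun k => normal_prob 0 1 (B k))); last first.
    by move=> k /andP[/negbTE ki /negbTE kj]; rewrite /B' ki kj.
  move=> <-; congr (P _); apply/seteqP; split => w /=.
  - move=> [[h1 h2] h] k; rewrite /B'; case: (eqVneq k i) => [->//|ki].
    by case: (eqVneq k j) => [->//|kj]; exact: h.
  - move=> h; split; [split|].
    + by have := h i; rewrite /B' eqxx.
    + by have := h j; rewrite /B' eq_sym (negbTE ij) eqxx.
    + by move=> k ki kj; have := h k; rewrite /B' (negbTE ki) (negbTE kj).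
have qfin : q \is a fin_num.
  rewrite ge0_fin_numE//; have := rect _ _ measurableT measurableT.
  rewrite !probability_setT !mul1e => <-.
  rewrite (_ : [set w | _] = setT) ?setTI; last by apply/seteqP; split.
  by rewrite ltey_eq fin_num_measure.
pose R2 : measurableType _ := (measurableTypeR R * measurableTypeR R)%type.
pose XY : T -> R2 := fun w => (X i w, X j w).
have mXY : measurable_fun [set: T] XY by exact: (measurable_fun_pair (mX i) (mX j)).
pose m1 : {measure set R2 -> \bar R} := pushforward (mrestr P mE) XY.
pose k : {nonneg R} := NngNum (fine_ge0 q0).
pose m0 : {measure set R2 -> \bar R} := (normal_prob 0 1 \x normal_prob 0 1)%E.
pose m2 : {measure set R2 -> \bar R} := mscale k m0.
transitivity (m1 mXY C) => //.
rewrite (@finite_measure_prod_unique R _ _ _ _ (m1 mXY) m2)//.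
- by rewrite /m2/= /mscale/= fineK// muleC.
- rewrite -setXTT [m1 mXY _](_ : _ = P ([set w | (setT `*` setT) (X i w, X j w)] `&` E))//.
  by rewrite rect// !probability_setT !mul1e ltey_eq qfin.
- move=> A B0 mA mB0; rewrite [m1 mXY _]rect// /m2/= /mscale/= fineK//.
  by rewrite product_measure1E// muleC.
Qed.

Definition rot2 (I : finType) (i j : I) (c s : R) (X : I -> T -> R) : I -> T -> R :=
  fun k w => if k == i then c * X i w + s * X j w
             else if k == j then c * X j w - s * X i w else X k w.

Lemma gauss_array_rot2 (I : finType) (X : I -> T -> R) (i j : I) (c s : R) :
  i != j -> c ^+ 2 + s ^+ 2 = 1 -> gauss_array P X -> gauss_array P (rot2 i j c s X).
Proof.
move=> ij cs gX; have [mX hX] := gX; split => [k|B mB].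
  rewrite /rot2; case: (k == i); last case: (k == j) => //.
  - by apply: measurable_funD; exact: measurable_funM.
  - by apply: measurable_funB; exact: measurable_funM.
pose C := [set z : R * R | B i (c * z.1 + s * z.2) /\ B j (c * z.2 - s * z.1)].
have mC : measurable C.
  apply: measurableI.
  - rewrite -[X in measurable X]setTI; apply: (measurable_funD _ _ measurableT (mB i));
      by apply: measurable_funM.
  - rewrite -[X in measurable X]setTI; apply: (measurable_funB _ _ measurableT (mB j));
      by apply: measurable_funM.
have := gauss_array_pair ij gX mB mC.
rewrite normal_prob_rotation// => h.
rewrite (bigD1 i)//= (bigD1 j)/=; last by rewrite eq_sym.
rewrite muleA -h; congr (P _); apply/seteqP; split => w /=.
- move=> H; split; first split.
  + by have := H i; rewrite /rot2 eqxx.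
  + by have := H j; rewrite /rot2 eq_sym (negbTE ij) eqxx.
  + by move=> k ki kj; have := H k; rewrite /rot2 (negbTE ki) (negbTE kj).
- move=> [[H1 H2] H] k; rewrite /rot2; case: (eqVneq k i) => [->//|ki].
  by case: (eqVneq k j) => [->//|kj]; exact: H.
Qed.

Lemma gauss_array_opp (I : finType) (X : I -> T -> R) (i : I) :
  gauss_array P X -> gauss_array P (fun k w => if k == i then - X k w else X k w).
Proof.
move=> [mX hX]; split => [k|B mB].
  by case: (k == i) => //; exact: measurableT_comp.
pose B' k := if k == i then [set x | B k (-1 * x)] else B k.
have mB' k : measurable (B' k).
  rewrite /B'; case: ifP => // _; rewrite -[X in measurable X]setTI.
  by apply: (@measurable_funM _ _ _ _ (cst (-1)) id).
transitivity (P [set w | forall k, B' k (X k w)]).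
  congr (P _); apply/seteqP; split => w /= h k; have := h k; rewrite /B';
    by case: ifP => //= _; rewrite mulN1r.
rewrite hX//; apply: eq_bigr => k _; rewrite /B'; case: ifP => // _.
by rewrite normal_probN// sqrrN expr1n.
Qed.


Definition lin_array (I : finType) (o : I -> I -> R) (X : I -> T -> R) : I -> T -> R :=
  fun i w => \sum_k o i k * X k w.

Definition orth_array (I : finType) (o : I -> I -> R) : Prop :=
  forall i j, \sum_k o i k * o j k = (i == j)%:R.

Let sum2 (I : finType) (i j : I) (F : I -> R) : i != j ->
  \sum_k F k = F i + F j + \sum_(k | (k != i) && (k != j)) F k.
Proof. by move=> ij; rewrite (bigD1 i)//= (bigD1 j) 1?eq_sym//= addrA. Qed.

(** Row [a] being a basis vector, [o b a] is the inner product of rows [b] and [a]. *)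
Let fixed_col (I : finType) (o : I -> I -> R) (a : I) : orth_array o ->
  (forall k, o a k = (a == k)%:R) -> forall b, o b a = (b == a)%:R.
Proof.
move=> oo oa b; rewrite -(oo b a) (bigD1 a)//= oa eqxx mulr1 big1 ?addr0// => k ka.
by rewrite oa eq_sym (negbTE ka) mulr0.
Qed.

(* One row is reduced to a basis vector by rotations that kill its off-diagonal
   entries one at a time. *)
Let reduce_row (I : finType) (F : pred I) (i : I) m (o : I -> I -> R) (X : I -> T -> R) :
  orth_array o -> (forall a, a \in F -> forall k, o a k = (a == k)%:R) -> i \notin F ->
  (#|[pred k | (k != i) && (o i k != 0%R)]| <= m)%N -> gauss_array P X ->
  exists p X', [/\ orth_array p,
    forall a, a \in [predU1 i & F] -> forall k, p a k = (a == k)%:R,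
    gauss_array P X' & lin_array o X = lin_array p X'].
Proof.
elim: m o X => [|m IH] o X oo oF iF.
  rewrite leqn0 => /eqP/card0_eq m0 gX.
  have oik k : k != i -> o i k = 0.
    by move=> ki; have := m0 k; rewrite !inE ki => /negbT; rewrite negbK => /eqP.
  have oii : o i i ^+ 2 = 1.
    have := oo i i; rewrite eqxx (bigD1 i)//= big1 ?addr0; first by rewrite expr2.
    by move=> k ki; rewrite oik// mul0r.
  have [oi1|oiN] := eqVneq (o i i) 1.
    exists o, X; split=> // a; rewrite !inE => /orP[/eqP ->|/oF//] k.
    have [<-//|ik] := eqVneq i k.
    by rewrite oik// eq_sym.
  have {}oiN : o i i = -1.
    by move/eqP: oii; rewrite sqrf_eq1 (negbTE oiN) => /eqP.
  (* A remaining diagonal entry -1 is absorbed by changing the sign of column [i] of the matrix and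
     of coordinate [i] of the array. *)
  exists (fun a k => if k == i then - o a k else o a k).
  exists (fun k w => if k == i then - X k w else X k w); split.
  - by move=> a b; rewrite -(oo a b); apply: eq_bigr => k _; case: ifP; rewrite ?mulrNN.
  - move=> a; rewrite !inE => /orP[/eqP ->|aF] k.
      case: (eqVneq k i) => [->|ki]; first by rewrite oiN opprK.
      by rewrite oik.
    case: (eqVneq k i) => [ki|_]; last exact: oF.
    rewrite oF//; have -> : (a == k) = false by apply/eqP => ak; move: iF; rewrite -ki -ak aF.
    by rewrite oppr0.
  - exact: gauss_array_opp.
  - by apply/funext => a; apply/funext => w; apply: eq_bigr => k _; case: ifP; rewrite ?mulrNN.
move=> hm gX.
have [j|m0] := pickP [pred k | (k != i) && (o i k != 0%R)]; last first.
  by apply: (IH o X) => //; rewrite (_ : #|_| = 0%N)//; apply: eq_card0 => k; rewrite inE;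
    exact: m0.
move=> /= /andP[ji oij0].
(* If row [j] were already reduced, column [j] would be a basis vector and [o i j] would vanish.
   Hence the rotation in the plane of [i] and [j] leaves the reduced rows intact. *)
have jF : j \notin F.
  apply/negP => jF; move: oij0; rewrite (fixed_col oo (oF j jF)) [i == j]eq_sym (negbTE ji).
  by rewrite eqxx.
(* The rotation carries the pair (o i i, o i j) to (r, 0), so row [i] loses one more off-diagonal
   entry. *)
pose r := Num.sqrt (o i i ^+ 2 + o i j ^+ 2).
have r2 : r ^+ 2 = o i i ^+ 2 + o i j ^+ 2 by rewrite sqr_sqrtr// addr_ge0// sqr_ge0.
have r0 : r != 0.
  rewrite gt_eqF// sqrtr_gt0 ltr_wpDl ?sqr_ge0//.
  by rewrite lt_neqAle eq_sym sqrf_eq0 oij0 sqr_ge0.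
pose c := o i i / r; pose s := o i j / r.
have cs : c ^+ 2 + s ^+ 2 = 1.
  by rewrite /c /s !expr_div_n -mulrDl -r2 mulfV// expf_neq0.
have ij : i != j by rewrite eq_sym.
pose p a k := if k == i then c * o a i + s * o a j
               else if k == j then c * o a j - s * o a i else o a k.
have pi a : p a i = c * o a i + s * o a j by rewrite /p eqxx.
have pj a : p a j = c * o a j - s * o a i by rewrite /p (negbTE ji) eqxx.
have pk a k : (k != i) && (k != j) -> p a k = o a k.
  by move=> /andP[/negbTE ki /negbTE kj]; rewrite /p ki kj.
have [||||o1 [X1 [oo1 oF1 gX1 E1]]] := IH p (rot2 i j c s X) _ _ iF.
- move=> a b; rewrite -(oo a b) !(sum2 _ ij); congr (_ + _); last first.
    by apply: eq_bigr => k h; rewrite !pk.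
  rewrite !pi !pj.
  transitivity ((c ^+ 2 + s ^+ 2) * (o a i * o b i + o a j * o b j)); first by ring.
  by rewrite cs mul1r.
- move=> a aF k.
  have ai : (a == i) = false by apply/eqP => ai; move: iF; rewrite -ai aF.
  have aj : (a == j) = false by apply/eqP => aj; move: jF; rewrite -aj aF.
  rewrite /p; case: (eqVneq k i) => [->|ki]; first by rewrite !oF// ai aj !mulr0 addr0.
  case: (eqVneq k j) => [->|kj]; first by rewrite !oF// ai aj !mulr0 subr0.
  exact: oF.
- rewrite -ltnS; apply: (leq_trans _ hm); apply: proper_card; apply/properP; split.
    apply/fintype.subsetP => k; rewrite !inE => /andP[ki]; rewrite ki /p (negbTE ki).
    by case: (eqVneq k j) => [->|kj].
  exists j; rewrite !inE ji// pj /c /s.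
  by rewrite mulrAC (mulrAC (o i j)) (mulrC (o i j)) subrr eqxx.
- exact: gauss_array_rot2.
exists o1, X1; split => //; rewrite -E1.
apply/funext => a; apply/funext => w; rewrite /lin_array !(sum2 _ ij); congr (_ + _).
  rewrite pi pj /rot2 eqxx (negbTE ji) eqxx.
  transitivity ((c ^+ 2 + s ^+ 2) * (o a i * X i w + o a j * X j w)); last by ring.
  by rewrite cs mul1r.
apply: eq_bigr => k /[dup] h /andP[/negbTE ki /negbTE kj].
by rewrite pk// /rot2 ki kj.
Qed.

(** An orthogonal matrix is a product of plane rotations and sign changes. [F] collects the rows
    already reduced to basis vectors, and the induction is on the number of remaining rows. *)
Lemma gauss_array_lin (I : finType) (o : I -> I -> R) (X : I -> T -> R) :
  orth_array o -> gauss_array P X -> gauss_array P (lin_array o X).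
Proof.
have : forall a, a \in (pred0 : pred I) -> forall k, o a k = (a == k)%:R.
  by move=> a; rewrite inE.
move: {2}#|_| (leqnn #|[predC (pred0 : pred I)]|) => n.
move: (pred0) => F.
elim: n F o X => [|n IH] F o X hn oF oo gX.
  have FT a : a \in F.
    by apply/negPn/negP => aF; move: hn; rewrite leqn0 => /eqP/card0_eq/(_ a); rewrite !inE aF.
  rewrite (_ : lin_array o X = X)//; apply/funext => a; apply/funext => w.
  rewrite /lin_array (bigD1 a)//= oF// eqxx mul1r big1 ?addr0// => k ka.
  by rewrite oF// eq_sym (negbTE ka) mul0r.
have [i iF|FT] := pickP [pred i | i \notin F]; last first.
  apply: (IH F) => //; rewrite (_ : #|_| = 0%N)//; apply: eq_card0 => a.
  by rewrite !inE; exact: FT.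
have [p [X' [op oF' gX' ->]]] := reduce_row oo oF iF (leqnn _) gX.
apply: (IH ([predU1 i & F])) => //.
rewrite -ltnS; apply: (leq_trans _ hn); apply: proper_card; apply/properP; split.
  by apply/fintype.subsetP => a; rewrite !inE negb_or => /andP[].
by exists i; rewrite !inE ?eqxx.
Qed.

End gauss_rotation.

(** * Laws of finite arrays, determined by boxes *)

Section tuple_law.
Context (R : realType) (n : nat).
Local Notation nR := (n.-tuple R : measurableType _).

Let box (B : 'I_n -> set R) : set nR := [set t | forall i, B i (tnth t i)].

Let boxes : set (set nR) := [set A | exists2 B : 'I_n -> set R,
  forall i, measurable (B i) & A = box B].

Let measurable_boxes : @measurable _ nR = <<s boxes >>.
Proof.
apply/seteqP; split; last first.
  apply: smallest_sub; first exact: sigma_algebra_measurable.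
  move=> _ [B mB ->]; apply: (@measurable_forall _ _ _ (fun i => [set t : nR | B i
    (tnth t i)])) => i.
  by rewrite -[X in measurable X]setTI; exact: measurable_tnth.
apply: smallest_sub; first exact: smallest_sigma_algebra.
rewrite -bigcup_seq => A [i _ [C mC <-]]; rewrite setTI.
apply: sub_sigma_algebra; exists (fun j => if j == i then C else setT).
  by move=> j; case: ifP.
apply/seteqP; split => t /= h; last by have := h i; rewrite eqxx.
by move=> j; case: eqP => [->|].
Qed.

Lemma tuple_measure_unique (m1 m2 : {measure set nR -> \bar R}) :
  (m1 setT < +oo)%E ->
  (forall B : 'I_n -> set R, (forall i, measurable (B i)) -> m1 (box B) = m2 (box B)) ->
  forall A, measurable A -> m1 A = m2 A.
Proof.
move=> m1oo m12 A mA; apply: (@measure_unique _ R _ boxes (fun=> setT)) => //.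
- move=> _ _ [B mB ->] [C mC ->]; exists (fun i => B i `&` C i).
    by move=> i; exact: measurableI.
  by apply/seteqP; split => t /=; [move=> [h1 h2] i; split|move=> h; split=> i; have [] := h i].
- by move=> _; exists (fun=> setT) => //; apply/seteqP; split.
- by apply/seteqP; split=> // x _; exists 0%N.
- by move=> _ [B mB ->]; exact: m12.
Qed.

End tuple_law.

(* Borel measurability of H on R^I, phrased through composition so that no
   sigma-algebra on I -> R is needed. *)
Definition borel_array (R : realType) (I : finType) (H : (I -> R) -> \bar R) : Prop :=
  forall (d : measure_display) (T : measurableType d) (X : I -> T -> R),
    (forall i, measurable_fun [set: T] (X i)) ->
    measurable_fun [set: T] (fun w => H (X ^~ w)).

(** Enumerating [I] turns an array into a tuple, whose law is fixed by its values on boxes. The two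
    arrays may live on different spaces, as is required to compare an array with one assembled from
    two independent copies. *)
Lemma gauss_array_same_law (R : realType) (I : finType)
    (d : measure_display) (T : measurableType d) (P : probability T R) (X : I -> T -> R)
    (d' : measure_display) (T' : measurableType d') (P' : probability T' R) (X' : I -> T' -> R)
    (H : (I -> R) -> \bar R) :
  gauss_array P X -> gauss_array P' X' -> borel_array H -> (forall x, 0 <= H x)%E ->
  (\int[P]_w H (X ^~ w) = \int[P']_w H (X' ^~ w))%E.
Proof.
move=> gX gX' bH H0.
pose n := #|I|; pose nR := (n.-tuple R : measurableType _).
pose h (t : nR) := H (fun i => tnth t (enum_rank i)).
have mh : measurable_fun [set: nR] h.
  by apply: (bH _ _ (fun i (t : nR) => tnth t (enum_rank i))) => i; exact: measurable_tnth.
pose tup (d1 : measure_display) (T1 : measurableType d1) (Y : I -> T1 -> R) (w : T1) : nR :=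
  [tuple Y (enum_val i) w | i < n].
have mtup d1 (T1 : measurableType d1) (Y : I -> T1 -> R) :
    (forall i, measurable_fun [set: T1] (Y i)) -> measurable_fun [set: T1] (tup d1 T1 Y).
  move=> mY; apply/measurable_fun_tnthP => i.
  rewrite (_ : _ \o _ = Y (enum_val i)); first exact: mY.
  by apply/funext => w /=; rewrite tnth_mktuple.
have Hh d1 (T1 : measurableType d1) (Y : I -> T1 -> R) w : H (Y ^~ w) = h (tup d1 T1 Y w).
  by rewrite /h; congr H; apply/funext => i; rewrite tnth_mktuple enum_rankK.
have E d1 (T1 : measurableType d1) (Q : probability T1 R) (Y : I -> T1 -> R) :
    (forall i, measurable_fun [set: T1] (Y i)) ->
    (\int[Q]_w H (Y ^~ w) = \int[pushforward Q (tup d1 T1 Y)]_t h t)%E.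
  move=> mY; rewrite ge0_integral_pushforward//=; first by apply: eq_integral => w _; rewrite Hh.
  - exact: mtup.
  - by move=> t _; exact: H0.
rewrite !E; [|exact: (proj1 gX')|exact: (proj1 gX)].
pose m1 : {measure set nR -> \bar R} := pushforward P (tup d T X).
pose m2 : {measure set nR -> \bar R} := pushforward P' (tup d' T' X').
apply: (@eq_measure_integral _ _ _ _ (m2 (mtup _ _ _ (proj1 gX'))) (m1 (mtup _ _ _
  (proj1 gX)))) => A mA _.
apply: tuple_measure_unique => //.
  rewrite /m1/= /pushforward preimage_setT probability_setT; exact: ltry.
move=> B mB; rewrite /m1 /m2 /= /pushforward /=.
have F d1 (T1 : measurableType d1) (Q : probability T1 R) (Y : I -> T1 -> R) :
    gauss_array Q Y -> Q (tup d1 T1 Y @^-1` [set t | forall i, B i (tnth t i)]) =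
      (\prod_i normal_prob 0 1 (B (enum_rank i)))%E.
  move=> [mY <-]; last by move=> i; exact: mB.
  congr (Q _); apply/seteqP; split => w /= h0 i.
  - by have := h0 (enum_rank i); rewrite tnth_mktuple enum_rankK.
  - by rewrite tnth_mktuple; have := h0 (enum_val i); rewrite enum_valK.
by rewrite !F.
Qed.

(** * Decoupling of independent coordinates *)

Section gauss_decoupling.
Context (R : realType) (d : measure_display) (T : measurableType d) (P : probability T R).
Context (I : finType) (X : I -> T -> R) (gX : gauss_array P X).

Lemma gauss_array_prod (J : pred I) :
  gauss_array (P \x P)%E (fun i (z : T * T) => if J i then X i z.1 else X i z.2).
Proof.
have [mX hX] := gX; split => [i|B mB].
  by case: (J i); apply: measurableT_comp.
pose B1 i := if J i then B i else setT.
pose B2 i := if J i then setT else B i.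
have mB1 i : measurable (B1 i) by rewrite /B1; case: ifP.
have mB2 i : measurable (B2 i) by rewrite /B2; case: ifP.
have -> : [set z : T * T | forall i, B i (if J i then X i z.1 else X i z.2)] =
    [set w | forall i, B1 i (X i w)] `*` [set w | forall i, B2 i (X i w)].
  apply/seteqP; split => z /=.
  - by move=> h; split=> i; have := h i; rewrite /B1 /B2; case: ifP.
  - by move=> [h1 h2] i; have := h1 i; have := h2 i; rewrite /B1 /B2; case: ifP.
transitivity (P [set w | forall i, B1 i (X i w)] * P [set w | forall i, B2 i (X i w)])%E.
  by apply: product_measure1E; exact: measurable_gauss_event.
rewrite !hX// -big_split/=; apply: eq_bigr => i _.
by rewrite /B1 /B2; case: ifP => _; rewrite probability_setT ?mul1e ?mule1.
Qed.

(** This takes the place of conditioning on the coordinates in [J]. The array mixed from two samples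
    is Gaussian on the product space, hence has the law of [X], and Tonelli's theorem separates the
    samples. *)
Lemma gauss_array_decouple (J : pred I) (H : (I -> R) -> \bar R) :
  borel_array H -> (forall x, 0 <= H x)%E ->
  (\int[P]_w H (X ^~ w) =
   \int[P]_w \int[P]_w' H (fun i => if J i then X i w else X i w'))%E.
Proof.
move=> bH H0.
rewrite (gauss_array_same_law gX (gauss_array_prod J) bH H0).
rewrite fubini_tonelli1//; last first.
  by apply: (bH _ _ (fun i (z : T * T) => if J i then X i z.1 else X i z.2));
    have [] := gauss_array_prod J.
Qed.

Lemma gauss_array_expect (i : I) (h : R -> \bar R) :
  measurable_fun [set: R] h -> (forall x, 0 <= h x)%E ->
  (\int[P]_w h (X i w) = \int[normal_prob 0 1]_x h x)%E.
Proof.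
move=> mh h0; have [mX hX] := gX.
pose Xi : T -> measurableTypeR R := X i.
have mXi : measurable_fun [set: T] Xi by exact: mX.
pose m1 : {measure set (measurableTypeR R) -> \bar R} := pushforward P Xi.
transitivity (\int[m1 mXi]_x h x)%E; first by rewrite ge0_integral_pushforward// preimage_setT.
by apply: eq_measure_integral => A mA _; exact: gauss_array_law.
Qed.

Lemma gauss_array_expect_prod (s : seq I) (g : R -> R) (c : R) :
  uniq s -> measurable_fun [set: R] g -> (forall x, 0 <= g x) ->
  (\int[normal_prob 0 1]_x (g x)%:E = c%:E)%E ->
  (\int[P]_w (\prod_(i <- s) g (X i w))%:E = (c ^+ size s)%:E)%E.
Proof.
move=> us mg g0 gc; have [mX hX] := gX.
have mgE : measurable_fun [set: R] (EFin \o g) by exact/measurable_EFinP.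
have c0 : 0 <= c by rewrite -lee_fin -gc; apply: integral_ge0 => x _; rewrite lee_fin.
have mprod d1 (T1 : measurableType d1) (Y : I -> T1 -> R) (t : seq I) :
    (forall i, measurable_fun [set: T1] (Y i)) ->
    measurable_fun [set: T1] (fun w => (\prod_(i <- t) g (Y i w))%:E).
  by move=> mY; apply/measurable_EFinP; apply: measurable_prod => i _; exact: measurableT_comp.
elim: s us => [_|i s IH /= /andP[nis us]].
  under eq_integral do rewrite big_nil.
  by rewrite integral_cst//= probability_setT mul1e.
rewrite (@gauss_array_decouple (pred1 i) (fun x => (\prod_(k <- i :: s) g (x k))%:E));
  last 2 first.
- by move=> d1 T1 Y mY; exact: mprod.
- by move=> x; rewrite lee_fin prodr_ge0.
transitivity (\int[P]_w ((g (X i w))%:E * (c ^+ size s)%:E))%E.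
  apply: eq_integral => w _; rewrite -IH// -ge0_integralZl//=; last 3 first.
  - exact: mprod.
  - by move=> w' _; rewrite lee_fin prodr_ge0.
  - by rewrite lee_fin.
  apply: eq_integral => w' _; rewrite big_cons/= eqxx EFinM; congr (_ * _%:E)%E.
  rewrite !big_seq; apply: eq_bigr => k ks.
  by case: eqP => // ki; move: nis; rewrite -ki ks.
rewrite ge0_integralZr//=; last 3 first.
- by apply/measurable_EFinP; exact: measurableT_comp.
- by move=> w _; rewrite lee_fin.
- by rewrite lee_fin exprn_ge0.
by rewrite (gauss_array_expect i mgE)//= gc -EFinM exprS.
Qed.

End gauss_decoupling.

(** * Improper integrals and chi-square moments *)

Section improper_integrals.
Context (R : realType).
Local Notation mu := (@lebesgue_measure R).
Implicit Types (f g F : R -> R) (x b : R).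

Lemma is_derive_continuous F x d : is_derive x 1 F d -> {for x, continuous F}.
Proof.
move=> dF; apply: differentiable_continuous; apply/derivable1_diffP.
exact: (@ex_derive _ _ _ _ _ _ _ dF).
Qed.

Lemma is_derive_expn (m : nat) x :
  is_derive x 1 (fun z : R => z ^+ m) (m%:R * x ^+ m.-1).
Proof.
have H := @is_deriveX R R^o id m x 1 1 (is_derive_id _ _).
rewrite (_ : (fun z : R => z ^+ m) = (id : R -> R) ^+ m); last by rewrite exprfctE.
by apply: (is_derive_eq H); rewrite /GRing.scale/= mulr1.
Qed.

Lemma is_derive_gauss b x :
  is_derive x 1 (fun z : R => expR (- (b * z ^+ 2 / 2))) (- (b * x) * expR (- (b * x ^+ 2 / 2))).
Proof.
have h : is_derive x 1 (fun z : R => - (b * z ^+ 2 / 2)) (- (b * x)).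
  have := is_deriveZ (- (b / 2)) (is_derive_expn 2 x).
  rewrite /GRing.scale/= expr1.
  rewrite (_ : _ \*: _ = (fun z : R => - (b * z ^+ 2 / 2))).
    by move=> H; apply: (is_derive_eq H); field.
  by apply/funext => z /=; rewrite /GRing.scale/=; field.
have H := @is_derive1_comp R expR (fun z : R => - (b * z ^+ 2 / 2)) x _ _ (is_derive_expR (-
  (b * x ^+ 2 / 2))) h.
by apply: (is_derive_eq H); rewrite mulrC.
Qed.

Lemma is_derive_rmul F G x dF dG : is_derive x 1 F dF -> is_derive x 1 G dG ->
  is_derive x 1 (fun z => F z * G z) (F x * dG + G x * dF).
Proof. exact: is_deriveM. Qed.

Lemma cvg_pinfty_bound F (C : R) : (forall x, 1 <= x -> `|F x| <= C / x) ->
  F x @[x --> +oo] --> 0.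
Proof.
move=> FC; apply/cvgr0Pnorm_le => e e0.
near=> x.
have x1 : 1 <= x by near: x; apply: nbhs_pinfty_ge; rewrite num_real.
apply: (le_trans (FC _ x1)); rewrite ler_pdivrMr; last lra.
rewrite -ler_pdivrMl//; near: x; apply: nbhs_pinfty_ge; rewrite num_real.
Unshelve. all: by end_near. Qed.

Lemma ge0_FTCy (f F : R -> R) (a l : R) :
  (forall x, a <= x -> 0 <= f x) -> continuous f ->
  (forall x, is_derive x 1 F (f x)) -> F x @[x --> +oo] --> l ->
  (\int[mu]_(x in `[a, +oo[) (f x)%:E = (l - F a)%:E)%E.
Proof.
move=> f0 cf dF Fl; rewrite (@ge0_continuous_FTC2y R f F a l)//.
- exact: continuous_subspaceT.
- by apply: cvg_at_right_filter; exact: is_derive_continuous (dF a).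
- by move=> x _; rewrite derive1E; exact: (@derive_val _ _ _ _ _ _ _ (dF x)).
Qed.

(** Integration by parts as an inequality that remains meaningful for infinite integrals: on [0, n]
    the integral of [f] is that of [g] minus [F n], hence at most that of [g] plus e for large n. *)
Lemma ge0_parts_le (f g F : R -> R) :
  (forall x, 0 <= x -> 0 <= f x) -> (forall x, 0 <= x -> 0 <= g x) ->
  continuous f -> continuous g ->
  (forall x, is_derive x 1 F (g x - f x)) ->
  F 0 = 0 -> (forall e, 0 < e -> exists M, forall x, M <= x -> - F x <= e) ->
  (\int[mu]_(x in `[0%R, +oo[) (f x)%:E <= \int[mu]_(x in `[0%R, +oo[) (g x)%:E)%E.
Proof.
move=> f0 g0 cf cg dF F0 Fe.
have mf : measurable_fun [set: R] f by exact: continuous_measurable_fun.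
have mg : measurable_fun [set: R] g by exact: continuous_measurable_fun.
apply/lee_addgt0Pr => e e0; have [M HM] := Fe _ e0.
pose D (n : nat) : set (measurableTypeR R) := `[0%R, n%:R]%classic.
have UD : \bigcup_n D n = `[0%R, +oo[%classic.
  apply/seteqP; split => x /=.
    by move=> [n _]; rewrite /D/= !in_itv/= => /andP[->].
  rewrite in_itv/= andbT => x0; exists (Num.bound x) => //; rewrite /D /= in_itv/= x0/=.
  by apply/ltW; exact: archi_boundP.
have mD n : measurable (D n) by exact: measurable_itv.
have ndD : {homo D : n m / (n <= m)%N >-> (n <= m)%O}.
  move=> n m nm; apply/subsetPset => x /=; rewrite /D/= !in_itv/= => /andP[-> h].
  by rewrite (le_trans h)// ler_nat.
have D0 n x : D n x -> 0 <= x by rewrite /D/= in_itv/= => /andP[].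
have cvf : (\int[mu]_(x in D i) (f x)%:E @[i --> \oo] --> \int[mu]_(x in `[0%R, +oo[) (f x)%:E)%E.
  rewrite -UD; apply: ge0_nondecreasing_set_cvg_integral => //.
  - by move=> i; apply/measurable_EFinP; exact: measurable_funTS.
  - by move=> i x Dx; rewrite lee_fin f0// (D0 i).
rewrite -(cvg_lim _ cvf)//; apply: lime_le; first by apply/cvg_ex; eexists; exact: cvf.
near=> n.
have n0 : (0 < n%:R :> R).
  by rewrite ltr0n; near: n; exists 1%N.
have Mn : M <= n%:R.
  near: n; exists (Num.bound `|M|) => // k /= hk.
  rewrite (le_trans (ler_norm _))// (le_trans (ltW (archi_boundP _)))//.
  by rewrite ler_nat.
have intf (h : measurableTypeR R -> R) : continuous h -> mu.-integrable (D n) (EFin \o h).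
  move=> ch; apply: continuous_compact_integrable; first exact: segment_compact.
  exact: continuous_subspaceT.
have E : (\int[mu]_(x in D n) (g x - f x)%:E = (F n%:R)%:E)%E.
  rewrite (@continuous_FTC2 R (fun x => g x - f x) F 0 n%:R)//.
  - by rewrite F0 sube0.
  - by apply: continuous_subspaceT => x; apply: cvgB; [exact: cg|exact: cf].
  - split; first by move=> x _; exact: (@ex_derive _ _ _ _ _ _ _ (dF x)).
      by apply: cvg_at_right_filter; exact: is_derive_continuous (dF _).
    by apply: cvg_at_left_filter; exact: is_derive_continuous (dF _).
  - by move=> x _; rewrite derive1E; exact: (@derive_val _ _ _ _ _ _ _ (dF x)).
have intgf : (\int[mu]_(x in D n) (g x - f x)%:E =
  \int[mu]_(x in D n) (g x)%:E - \int[mu]_(x in D n) (f x)%:E)%E.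
  have If := intf f cf; have Ig := intf g cg.
  exact: (integralB_EFin (mD n) Ig If).
have ffin : (\int[mu]_(x in D n) (f x)%:E)%E \is a fin_num.
  exact: (integrable_fin_num (mD n) (intf f cf)).
have gfin : (\int[mu]_(x in D n) (g x)%:E)%E \is a fin_num.
  exact: (integrable_fin_num (mD n) (intf g cg)).
apply: (@le_trans _ _ (\int[mu]_(x in D n) (g x)%:E + e%:E)%E).
  move: intgf; rewrite E -(fineK ffin) -(fineK gfin) -EFinB -EFinD lee_fin => -[h].
  have := HM _ Mn; rewrite h; lra.
apply: leeD2r; apply: ge0_subset_integral => //.
- by apply/measurable_EFinP; exact: measurable_funTS.
- by move=> x /=; rewrite in_itv/= andbT lee_fin; exact: g0.
- by rewrite -UD => x Dx; exists n.
Unshelve. all: by end_near. Qed.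

(** With y = b x^2 / 2, the bound exp(y) >= y^(m+1) / (m+1)! makes the product at most C x^(-m-2),
    hence at most C / x for x >= 1. *)
Lemma cvg_expn_gauss (m : nat) b : 0 < b ->
  x ^+ m * expR (- (b * x ^+ 2 / 2)) @[x --> +oo] --> 0.
Proof.
move=> b0; apply: (@cvg_pinfty_bound _ ((m.+1)`!%:R * (2 / b) ^+ m.+1)) => x x1.
have x0 : 0 < x by lra.
rewrite ger0_norm ?mulr_ge0 ?expR_ge0 ?exprn_ge0 ?(ltW x0)//.
have y0 : 0 < b * x ^+ 2 / 2 by rewrite divr_gt0// mulr_gt0// exprn_gt0.
have f0 : 0 < ((m.+1)`!%:R : R) by rewrite ltr0n fact_gt0.
have h : (b * x ^+ 2 / 2) ^+ m.+1 / (m.+1)`!%:R <= expR (b * x ^+ 2 / 2).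
  by have := expR_ge1Dxn m (ltW y0); lra.
rewrite expRN ler_pdivrMr ?expR_gt0//.
apply: (@le_trans _ _ ((m.+1)`!%:R * (2 / b) ^+ m.+1 / x * ((b * x ^+ 2 / 2) ^+ m.+1 /
  (m.+1)`!%:R))); last first.
  by apply: ler_wpM2l => //; rewrite divr_ge0 ?mulr_ge0 ?exprn_ge0 ?divr_ge0 ?(ltW x0) ?(ltW b0).
have -> : (m.+1)`!%:R * (2 / b) ^+ m.+1 / x * ((b * x ^+ 2 / 2) ^+ m.+1 / (m.+1)`!%:R) =
    ((2 / b) * (b * x ^+ 2 / 2)) ^+ m.+1 / x.
  rewrite [in RHS]exprMn; set u := (2 / b) ^+ _; set v := (b * _ / _) ^+ _.
  by field; rewrite !gt_eqF.
have -> : 2 / b * (b * x ^+ 2 / 2) = x ^+ 2 by field; rewrite gt_eqF.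
rewrite -exprM ler_pdivlMr// -exprSr; apply: ler_weXn2l => //.
by rewrite mul2n -addnn leq_addr.
Qed.

Lemma continuous_expn_gauss (m : nat) b : continuous (fun x : R => x ^+ m * expR (-
  (b * x ^+ 2 / 2))).
Proof.
move=> x; apply: (is_derive_continuous (is_derive_rmul (is_derive_expn m x)
  (is_derive_gauss b x))).
Qed.

(** The Laplace transform at x^2 / 2 of the square of a standard normal variable ([normal_laplace]);
    its j-th power is that of a chi-square variable with j degrees of freedom. *)
Definition rad (x : R) : R := (Num.sqrt (1 + x ^+ 2))^-1.

Lemma rad_gt0 x : 0 < rad x.
Proof. by rewrite invr_gt0 sqrtr_gt0; have := sqr_ge0 x; lra. Qed.

Lemma rad_le1 x : rad x <= 1.
Proof.
rewrite invf_le1 ?sqrtr_gt0; last by have := sqr_ge0 x; lra.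
by rewrite -[leLHS]sqrtr1 ler_sqrt; have := sqr_ge0 x; lra.
Qed.

Lemma rad_sqr x : rad x ^+ 2 = (1 + x ^+ 2)^-1.
Proof. by rewrite exprVn sqr_sqrtr//; have := sqr_ge0 x; lra. Qed.

Lemma is_derive_rad (m : nat) x :
  is_derive x 1 (fun z => rad z ^+ m) (- (m%:R * x * rad x ^+ m.+2)).
Proof.
have p0 : 0 < 1 + x ^+ 2 by have := sqr_ge0 x; lra.
have s0 : Num.sqrt (1 + x ^+ 2) != 0 by rewrite gt_eqF// sqrtr_gt0.
have h1 : is_derive x 1 (fun z : R => 1 + z ^+ 2) (2 * x).
  have H := @is_deriveD R R^o R^o (cst (1 : R)) (fun z : R => z ^+ 2) x 1 _ _
    (is_derive_cst _ _ _) (is_derive_expn 2 x).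
  by apply: (is_derive_eq H); rewrite add0r expr1.
have h2 := @is_derive1_comp R Num.sqrt (fun z : R => 1 + z ^+ 2) x _ _ (is_derive1_sqrt p0) h1.
have h3 := @is_deriveV R (fun z : R => Num.sqrt (1 + z ^+ 2)) x _ 1 s0 h2.
have h4 := @is_derive1_comp R (fun z => z ^+ m) rad x _ _ (is_derive_expn m (rad x)) h3.
apply: (is_derive_eq h4); rewrite /GRing.scale/= -/(rad x).
have -> : Num.sqrt (1 + x ^+ 2) ^- 2 = rad x ^+ 2 by rewrite -exprVn.
have -> : (2 * Num.sqrt (1 + x ^+ 2))^-1 = rad x / 2 by rewrite invfM mulrC.
case: m {h4} => [|m]; first by rewrite !mul0r oppr0.
by rewrite /= !exprS; field.
Qed.

Lemma rad_le_inv x : 1 <= x -> rad x <= 1 / x.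
Proof.
move=> x1; rewrite div1r lef_pV2 ?posrE ?sqrtr_gt0; [|by have := sqr_ge0 x; lra|by lra].
have {1}-> : x = Num.sqrt (x ^+ 2) by rewrite sqrtr_sqr ger0_norm//; lra.
by rewrite ler_sqrt; have := sqr_ge0 x; lra.
Qed.

End improper_integrals.

(** * The integrals of z^m exp(-b z^2 / 2) and of z^m (1 + z^2)^(-n/2) *)

Section gaussian_integrals.
Context (R : realType).
Local Notation mu := (@lebesgue_measure R).
Implicit Types (x b : R).

Lemma is_derive_scale (F : R -> R) (k x d : R) :
  is_derive x 1 F d -> is_derive x 1 (fun z => k * F z) (k * d).
Proof. exact: is_deriveZ. Qed.

(** For b > 0 this is [gconst m] times b^(-(m+1)/2): a negative power of [b] written as an integral
    of exponentials in [b], ready for a Laplace transform. *)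
Definition gint (m : nat) b : \bar R :=
  (\int[mu]_(z in `[0%R, +oo[) (z ^+ m * expR (- (b * z ^+ 2 / 2)))%:E)%E.

(** The mean of [gint m] at a chi-square variable with [n] degrees of freedom, by [gint_chi2]. *)
Definition rint (m n : nat) : \bar R :=
  (\int[mu]_(z in `[0%R, +oo[) (z ^+ m * rad z ^+ n)%:E)%E.

Lemma continuous_expn_rad m n : continuous (fun x : R => x ^+ m * rad x ^+ n).
Proof.
move=> x; exact: (is_derive_continuous (is_derive_rmul (is_derive_expn m x) (is_derive_rad n x))).
Qed.

Lemma gint1 b : 0 < b -> gint 1 b = (b^-1)%:E.
Proof.
move=> b0; pose F (z : R) := - b^-1 * expR (- (b * z ^+ 2 / 2)).
transitivity (0 - F 0)%:E; last first.
  by rewrite /F expr0n/= mulr0 mul0r oppr0 expR0 mulr1 sub0r opprK.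
apply: ge0_FTCy.
- by move=> x x0; rewrite mulr_ge0// expR_ge0.
- exact: continuous_expn_gauss.
- move=> x; apply: (is_derive_eq (is_derive_scale _ (is_derive_gauss b x))).
  by rewrite expr1; field; rewrite gt_eqF.
- rewrite -[X in _ --> X](mulr0 (- b^-1)); apply: cvgM; first exact: cvg_cst.
  have := @cvg_expn_gauss R 0 b b0.
  by under eq_fun do rewrite expr0 mul1r.
Qed.

(** By evenness this is half the total mass of the normal density rescaled by [sqrt b]. *)
Lemma gint0 b : 0 < b -> gint 0 b = (Num.sqrt (pi / 2) / Num.sqrt b)%:E.
Proof.
move=> b0; have sb : 0 < Num.sqrt b by rewrite sqrtr_gt0.
pose k : R := (Num.sqrt (pi *+ 2))^-1.
have k0 : 0 < k by rewrite invr_gt0 sqrtr_gt0 mulrn_wgt0// pi_gt0.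
have sb0 : Num.sqrt b != 0 by rewrite gt_eqF.
have mphi : measurable_fun [set: R] (fun x : R => (normal_pdf 0 1 x)%:E).
  by apply/measurable_EFinP; exact: measurable_normal_pdf.
have phi0 (x : R) : (0 <= (normal_pdf 0 1 x)%:E :> \bar R)%E by rewrite lee_fin normal_pdf_ge0.
have := ge0_integral_affine 0 sb0 mphi phi0.
rewrite integral_normal_pdf.
under eq_integral => x _.
  rewrite normal_pdf01E add0r exprMn sqr_sqrtr ?ltW// -/k EFinM.
  over.
rewrite ge0_integralZl//=; last 2 first.
- apply/measurable_EFinP; apply: continuous_measurable_fun => x.
  exact: (is_derive_continuous (is_derive_gauss b x)).
- by rewrite lee_fin ltW.
rewrite ge0_symfun_integralT; last 3 first.
- by move=> x; exact: expR_ge0.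
- by move=> x; exact: (is_derive_continuous (is_derive_gauss b x)).
- by move=> x /=; rewrite sqrrN.
rewrite -set_itvcy (_ : (\int[mu]_(x in _) _)%E = gint 0 b); last first.
  by apply: eq_integral => x _; rewrite expr0 mul1r.
rewrite ger0_norm ?(ltW sb)// => h.
have gfin : gint 0 b \is a fin_num.
  rewrite ge0_fin_numE; last first.
    by apply: integral_ge0 => x _; rewrite lee_fin mulr_ge0 ?expR_ge0.
  rewrite ltey; apply/eqP => g; move: h; rewrite g.
  by rewrite !gt0_muley// ?lte_fin.
move: h; rewrite -(fineK gfin) -!EFinM => -[h]; congr EFin.
have E : Num.sqrt (pi / 2) = Num.sqrt (pi *+ 2) / 2 :> R.
  have -> : pi *+ 2 = (pi / 2) * (2 ^+ 2) :> R by rewrite -mulr_natr; field.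
  by rewrite [in RHS]sqrtrM ?divr_ge0 ?pi_ge0// sqrtr_sqr ger0_norm// mulfK.
have kE : Num.sqrt (pi *+ 2) = k^-1 by rewrite /k invrK.
rewrite E kE; apply: (mulfI (_ : Num.sqrt b * (k * 2) != 0)).
  by rewrite !mulf_neq0// gt_eqF.
rewrite -!mulrA h; field.
by rewrite !gt_eqF.
Qed.

(** Integration by parts against -z^(m+1) exp(-b z^2 / 2), which vanishes at 0 and at infinity. *)
Lemma gintS m b : 0 < b -> ((m.+1%:R / b)%:E * gint m b <= gint m.+2 b)%E.
Proof.
move=> b0.
have cf (c : R) (j : nat) : continuous (fun x : R => c * (x ^+ j * expR (- (b * x ^+ 2 / 2)))).
  move=> x; exact: (is_derive_continuous (is_derive_scale c (is_derive_rmul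
    (is_derive_expn j x) (is_derive_gauss b x)))).
have mj (j : nat) : measurable_fun [set: R] (fun x : R => x ^+ j * expR (- (b * x ^+ 2 / 2))).
  by apply: continuous_measurable_fun; exact: continuous_expn_gauss.
have p0 (j : nat) (x : R) : 0 <= x -> 0 <= x ^+ j * expR (- (b * x ^+ 2 / 2)).
  by move=> x0; rewrite mulr_ge0 ?expR_ge0 ?exprn_ge0.
have h : (\int[mu]_(z in `[0%R, +oo[) (m.+1%:R * (z ^+ m * expR (- (b * z ^+ 2 / 2))))%:E <=
    \int[mu]_(z in `[0%R, +oo[) (b * (z ^+ m.+2 * expR (- (b * z ^+ 2 / 2))))%:E)%E.
  apply: (@ge0_parts_le _ _ _ (fun z => -1 * (z ^+ m.+1 * expR (- (b * z ^+ 2 / 2))))).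
  - by move=> x x0; rewrite mulr_ge0 ?p0.
  - by move=> x x0; rewrite mulr_ge0 ?p0// ltW.
  - exact: cf.
  - exact: cf.
  - move=> x; apply: (is_derive_eq (is_derive_scale _ (is_derive_rmul (is_derive_expn m.+1 x)
    (is_derive_gauss b x)))).
    by rewrite /= !exprS; ring.
  - by rewrite exprS !mul0r mulr0.
  - move=> e e0; have /cvgr0Pnorm_le/(_ e e0) := cvg_expn_gauss m.+1 b0.
    move=> [M [_ HM]]; exists (M + 1) => x Mx.
    have : M < x by lra.
    move=> /HM; apply: le_trans; rewrite mulN1r opprK; exact: ler_norm.
rewrite /gint; have -> : (m.+1%:R / b)%:E = (b^-1%:E * (m.+1%:R)%:E)%E :> \bar R.
  by rewrite -EFinM mulrC.
rewrite -muleA -[in leRHS](mul1e (integral _ _ _)).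
have -> : (1%:E = b^-1%:E * b%:E :> \bar R)%E by rewrite -EFinM mulVf// gt_eqF.
rewrite -muleA; apply: lee_wpmul2l; first by rewrite lee_fin invr_ge0 ltW.
rewrite -!ge0_integralZl//=.
- by apply/measurable_EFinP; apply: measurable_funTS; exact: mj.
- by move=> x; rewrite in_itv/= andbT lee_fin; exact: p0.
- by rewrite lee_fin ltW.
- by apply/measurable_EFinP; apply: measurable_funTS; exact: mj.
- by move=> x; rewrite in_itv/= andbT lee_fin; exact: p0.
Qed.

(** The m-th moment of exp(-z^2 / 2) over the half line, that is 2^((m-1)/2) Gamma((m+1)/2). *)
Fixpoint gconst (m : nat) : R :=
  match m with
  | 0 => Num.sqrt (pi / 2)
  | 1 => 1
  | m'.+2 => m'.+1%:R * gconst m'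
  end.

Lemma nat_ind2 (Q : nat -> Prop) : Q 0%N -> Q 1%N -> (forall m, Q m -> Q m.+2) -> forall m, Q m.
Proof.
move=> Q0 Q1 QS m; suff: Q m /\ Q m.+1 by case.
by elim: m => [//|m [h1 h2]]; split=> //; exact: QS.
Qed.

Lemma gconst_gt0 m : 0 < gconst m.
Proof.
elim/nat_ind2: m => [||m IH] /=; first by rewrite sqrtr_gt0 divr_gt0 ?pi_gt0.
  exact: ltr01.
by rewrite mulr_gt0.
Qed.

Lemma gint_ge_pos m (y : R) : 0 < y -> ((gconst m * y ^+ m.+1)%:E <= gint m (y ^- 2))%E.
Proof.
move=> y0; have b0 : 0 < y ^- 2 by rewrite invr_gt0 exprn_gt0.
elim/nat_ind2: m => [||m IH].
- by rewrite gint0// sqrtrV ?sqr_ge0// invrK sqrtr_sqr ger0_norm ?(ltW y0)// expr1 lexx.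
- by rewrite gint1// invrK /= mul1r.
- apply: le_trans (gintS m b0); rewrite invrK.
  apply: (@le_trans _ _ ((m.+1%:R * y ^+ 2)%:E * (gconst m * y ^+ m.+1)%:E)%E).
    by rewrite -EFinM lee_fin /= !exprS le_eqVlt; apply/orP; left; apply/eqP; ring.
  by apply: lee_wpmul2l => //; rewrite lee_fin mulr_ge0// sqr_ge0.
Qed.

(** The hypothesis avoids dividing by [b], so that [b = 0], with its divergent integral, is
    included. For y > 0 it says [b <= y ^- 2], and the integrand decreases with [b]. *)
Lemma gint_ge m (y b : R) : 0 <= y -> 0 <= b -> y ^+ 2 * b <= 1 ->
  ((gconst m * y ^+ m.+1)%:E <= gint m b)%E.
Proof.
rewrite le_eqVlt => /predU1P[<-|y0] b0 yb.
  rewrite exprS mul0r mulr0; apply: integral_ge0 => x /=; rewrite in_itv/= andbT => x0.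
  by rewrite lee_fin mulr_ge0 ?expR_ge0 ?exprn_ge0.
apply: (le_trans (gint_ge_pos m y0)); apply: ge0_le_integral => //=.
- by move=> x; rewrite in_itv/= andbT => x0; rewrite lee_fin mulr_ge0 ?expR_ge0 ?exprn_ge0.
- by apply/measurable_EFinP; apply: measurable_funTS; apply: continuous_measurable_fun => x;
  exact: continuous_expn_gauss.
- by apply/measurable_EFinP; apply: measurable_funTS; apply: continuous_measurable_fun => x;
  exact: continuous_expn_gauss.
- move=> x; rewrite in_itv/= andbT => x0; rewrite lee_fin ler_wpM2l ?exprn_ge0// ler_expR lerN2.
  rewrite ler_wpM2r// ler_wpM2r ?sqr_ge0//.
  by rewrite -[leRHS]mul1r ler_pdivlMr ?exprn_gt0// mulrC.
Qed.

Lemma rint1 n : (rint 1 n.+3 <= (n.+1%:R^-1)%:E)%E.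
Proof.
pose F (z : R) : R := - n.+1%:R^-1 * rad z ^+ n.+1.
rewrite (_ : rint 1 n.+3 = (0 - F 0)%:E).
  rewrite /F sub0r mulNr opprK /rad expr0n/= addr0 sqrtr1 invr1 expr1n mulr1.
  exact: lexx.
apply: ge0_FTCy.
- by move=> x x0; rewrite mulr_ge0// exprn_ge0// (ltW (rad_gt0 _)).
- exact: continuous_expn_rad.
- move=> x; apply: (is_derive_eq (is_derive_scale _ (is_derive_rad n.+1 x))).
  by rewrite expr1; field.
- apply: (@cvg_pinfty_bound _ _ n.+1%:R^-1) => x x1.
  have rx : 0 <= rad x by exact/ltW/rad_gt0.
  have -> : `|F x| = n.+1%:R^-1 * rad x ^+ n.+1.
    by rewrite /F normrM normrN !ger0_norm ?invr_ge0 ?exprn_ge0.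
  apply: ler_wpM2l; first by rewrite invr_ge0.
  rewrite exprS.
  apply: (@le_trans _ _ (rad x * 1)).
    by apply: ler_wpM2l; [exact/ltW/rad_gt0|apply: exprn_ile1;
      [exact/ltW/rad_gt0|exact: rad_le1]].
  by rewrite mulr1 -div1r; exact: rad_le_inv.
Qed.

(** The derivative of z^(m+1) rad(z)^(n+1) is (m+1) z^m rad(z)^(n+1) - (n+1) z^(m+2)
    rad(z)^(n+3). *)
Lemma rintS m n : (rint m.+2 n.+3 <= (m.+1%:R / n.+1%:R)%:E * rint m n.+1)%E.
Proof.
have cf (c : R) (i j : nat) : continuous (fun x : R => c * (x ^+ i * rad x ^+ j)).
  move=> x; exact: (is_derive_continuous (is_derive_scale c (is_derive_rmul
    (is_derive_expn i x) (is_derive_rad j x)))).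
have mj (i j : nat) : measurable_fun [set: R] (fun x : R => x ^+ i * rad x ^+ j).
  by apply: continuous_measurable_fun; exact: continuous_expn_rad.
have p0 (i j : nat) (x : R) : 0 <= x -> 0 <= x ^+ i * rad x ^+ j.
  by move=> x0; rewrite mulr_ge0 ?exprn_ge0// ltW// rad_gt0.
have h : (\int[mu]_(z in `[0%R, +oo[) (n.+1%:R * (z ^+ m.+2 * rad z ^+ n.+3))%:E <=
    \int[mu]_(z in `[0%R, +oo[) (m.+1%:R * (z ^+ m * rad z ^+ n.+1))%:E)%E.
  apply: (@ge0_parts_le _ _ _ (fun z => z ^+ m.+1 * rad z ^+ n.+1)).
  - by move=> x x0; rewrite mulr_ge0 ?p0.
  - by move=> x x0; rewrite mulr_ge0 ?p0.
  - exact: cf.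
  - exact: cf.
  - move=> x; apply: (is_derive_eq (is_derive_rmul (is_derive_expn m.+1 x)
    (is_derive_rad n.+1 x))).
    by rewrite /= !exprS; ring.
  - by rewrite exprS !mul0r.
  - move=> e e0; exists 0 => x x0; apply: le_trans (ltW e0).
    by rewrite oppr_le0 p0.
rewrite /rint; have -> : (m.+1%:R / n.+1%:R)%:E = (n.+1%:R^-1%:E * (m.+1%:R)%:E)%E :> \bar R.
  by rewrite -EFinM mulrC.
rewrite -muleA -[in leLHS](mul1e (integral _ _ _)).
have -> : (1%:E = n.+1%:R^-1%:E * n.+1%:R%:E :> \bar R)%E by rewrite -EFinM mulVf.
rewrite -muleA; apply: lee_wpmul2l; first by rewrite lee_fin invr_ge0.
rewrite -!ge0_integralZl//=.
- by apply/measurable_EFinP; apply: measurable_funTS; exact: mj.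
- by move=> x; rewrite in_itv/= andbT lee_fin; exact: p0.
- by apply/measurable_EFinP; apply: measurable_funTS; exact: mj.
- by move=> x; rewrite in_itv/= andbT lee_fin; exact: p0.
Qed.

Lemma rint02 : rint 0 2 = (pi / 2)%:E.
Proof.
transitivity (pi / 2 - atan 0 : R)%:E; last by rewrite atan0 subr0.
apply: ge0_FTCy.
- by move=> x x0; rewrite mulr_ge0// exprn_ge0// (ltW (rad_gt0 _)).
- exact: continuous_expn_rad.
- by move=> x; apply: (is_derive_eq (is_derive1_atan x)); rewrite rad_sqr expr0 mul1r.
- exact: cvgy_atan.
Qed.

End gaussian_integrals.

(** * Numerical bounds *)

Section numeric_bounds.
Context (R : realType).
Implicit Types (x : R).

Lemma nondecreasing_from0 (F f : R -> R) : (forall x, is_derive x 1 F (f x)) ->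
  (forall x, 0 <= x -> 0 <= f x) -> forall x, 0 <= x -> F 0 <= F x.
Proof.
move=> dF f0 x x0.
have cF : {within `[0, x], continuous F}.
  by apply: continuous_subspaceT => y; exact: (is_derive_continuous (dF y)).
have [c cx E] := @MVT_segment R F f 0 x x0 (fun y _ => dF y) cF.
rewrite -subr_ge0 E subr0 mulr_ge0//; apply: f0.
by move: cx; rewrite in_itv/= => /andP[].
Qed.

Lemma is_derive_sub (F G : R -> R) x (dF dG : R) : is_derive x 1 F dF -> is_derive x 1 G dG ->
  is_derive x 1 (fun z => F z - G z) (dF - dG).
Proof. exact: is_deriveB. Qed.

Lemma is_derive_add (F G : R -> R) x (dF dG : R) : is_derive x 1 F dF -> is_derive x 1 G dG ->
  is_derive x 1 (fun z => F z + G z) (dF + dG).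
Proof. exact: is_deriveD. Qed.

Lemma sin_le_id x : 0 <= x -> sin x <= x.
Proof.
move=> x0; have := @nondecreasing_from0 (fun z => z - sin z) (fun z => 1 - cos z) _ _ _ x0.
rewrite sin0 subr0 subr_ge0; apply.
by move=> y _; rewrite subr_ge0 cos_le1.
Qed.

Lemma cos_ge_quad x : 0 <= x -> 1 - x ^+ 2 / 2 <= cos x.
Proof.
move=> x0; have := @nondecreasing_from0 (fun z => cos z + 2^-1 * z ^+ 2) (fun z =>
  z - sin z) _ _ _ x0.
rewrite cos0 expr0n/= mulr0 addr0 => h; suff : 1 <= cos x + 2^-1 * x ^+ 2 by lra.
apply: h.
- move=> y; have H := is_derive_add (is_derive_cos y) (is_derive_scale 2^-1 (is_derive_expn 2 y)).
  by apply: (is_derive_eq H); rewrite expr1; field.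
- by move=> y y0; rewrite subr_ge0 sin_le_id.
Qed.

Lemma sin_ge_cubic x : 0 <= x -> x - x ^+ 3 / 6 <= sin x.
Proof.
move=> x0; have := @nondecreasing_from0 (fun z => sin z - (z - 6^-1 * z ^+ 3))
  (fun z => cos z - (1 - z ^+ 2 / 2)) _ _ _ x0.
rewrite sin0 expr0n/= mulr0 !subr0 => h; suff : 0 <= sin x - (x - 6^-1 * x ^+ 3) by lra.
apply: h.
- move=> y; have H := is_derive_sub (is_derive_sin y) (is_derive_sub (is_derive_id y 1)
  (is_derive_scale 6^-1 (is_derive_expn 3 y))).
  by apply: (is_derive_eq H); rewrite /=; field.
- by move=> y y0; rewrite subr_ge0 cos_ge_quad.
Qed.

(** The triple angle: cos(3x) = cos x (cos^2 x - 3 sin^2 x) vanishes at x = pi/6. Combined with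
    Taylor bounds for the sine, this yields the rational bounds on pi. *)
Lemma sin_pi6 : sin (pi / 6) = 2^-1 :> R.
Proof.
set x : R := pi / 6; have p2 := @pi_ge2 R.
have cs := cos2Dsin2 x.
have cx : 0 < cos x.
  by apply: cos_gt0_pihalf; rewrite /x; apply/andP; split; lra.
have sx : 0 <= sin x.
  by apply: sin_ge0_pi; rewrite /x; apply/andP; split; lra.
have c3 : cos (x + (x + x)) = 0.
  rewrite (_ : x + (x + x) = pi / 2); last by rewrite /x; field.
  exact: cos_pihalf.
have : cos x * (cos x ^+ 2 - 3 * sin x ^+ 2) = 0.
  by rewrite -c3 !cosD !sinD; ring.
move=> /eqP; rewrite mulf_eq0 gt_eqF//= => /eqP h.
have : sin x ^+ 2 = 2^-1 ^+ 2 by lra.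
by move=> /eqP; rewrite eqrXn2// ?invr_ge0// => /eqP.
Qed.

Lemma pi_ge3 : 3 <= pi :> R.
Proof.
have p2 := @pi_ge2 R; have x0 : 0 <= pi / 6 :> R by lra.
by have := sin_le_id x0; rewrite sin_pi6; lra.
Qed.

Lemma pi_le33 : pi <= 33 / 10 :> R.
Proof.
have p2 := @pi_ge2 R; have p4 := @pihalf_lt2 R.
have x0 : 0 <= pi / 6 :> R by lra.
have := sin_ge_cubic x0; rewrite sin_pi6.
have : pi / 6 <= 2 / 3 :> R by lra.
set x : R := pi / 6 => x1 h; have -> : pi = 6 * x :> R by rewrite /x; field.
rewrite leNgt; apply/negP => hx.
have x2 : x ^+ 2 <= 4 / 9 by rewrite expr2; nra.
have : x * (1 - x ^+ 2 / 6) <= 2^-1 by move: h; rewrite exprS; lra.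
have : 55 / 100 * (1 - (4 / 9) / 6) <= x * (1 - x ^+ 2 / 6).
  by apply: ler_pM; lra.
lra.
Qed.

Lemma expR_le_inv x : x < 1 -> expR x <= (1 - x)^-1.
Proof.
move=> x1; rewrite -[expR x]invrK lef_pV2 ?posrE ?invr_gt0 ?expR_gt0//; last by lra.
by rewrite -expRN; have := expR_ge1Dx (- x); lra.
Qed.

Lemma expRN_ge_cubic x : 0 <= x -> 1 - x + x ^+ 2 / 2 - x ^+ 3 / 6 <= expR (- x).
Proof.
have dN (y : R) : is_derive y 1 (fun z : R => expR (- z)) (- expR (- y)).
  have H := is_derive1_comp (is_derive_expR (- y)) (is_deriveNid y 1).
  by apply: (is_derive_eq H); rewrite mulrN1.
have s2 (y : R) : 0 <= y -> expR (- y) <= 1 - y + y ^+ 2 / 2.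
  move=> y0; have := @nondecreasing_from0 (fun z => 2^-1 * z ^+ 2 - z - expR (- z))
     (fun z => z - 1 + expR (- z)) _ _ _ y0.
  rewrite expr0n/= mulr0 oppr0 expR0 => h.
  suff : 0 + 0 - 1 <= 2^-1 * y ^+ 2 - y - expR (- y) by lra.
  apply: h.
  - move=> z; have H := is_derive_sub (is_derive_sub (is_derive_scale 2^-1
    (is_derive_expn 2 z)) (is_derive_id z 1)) (dN z).
    by apply: (is_derive_eq H); rewrite expr1; field.
  - by move=> z _; have := expR_ge1Dx (- z); lra.
move=> x0; have := @nondecreasing_from0 (fun z => expR (- z) -
  (2^-1 * z ^+ 2 - z - 6^-1 * z ^+ 3))
     (fun z => 1 - z + z ^+ 2 / 2 - expR (- z)) _ _ _ x0.
rewrite !expr0n/= !mulr0 oppr0 expR0 => h.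
suff : 1 - (0 + 0 + 0) <= expR (- x) - (2^-1 * x ^+ 2 - x - 6^-1 * x ^+ 3) by lra.
apply: h.
- move=> z; have H := is_derive_sub (dN z) (is_derive_sub (is_derive_sub (is_derive_scale 2^-1
  (is_derive_expn 2 z)) (is_derive_id z 1)) (is_derive_scale 6^-1 (is_derive_expn 3 z))).
  by apply: (is_derive_eq H); rewrite /= expr1; field.
- by move=> z z0; have := s2 z z0; lra.
Qed.

(** The cubic Taylor bound is accurate enough at 1/4; two squarings, each rounded down, lead to
    exp(-1) >= 1833/5000. *)
Lemma expR1_le : expR 1 <= 2728 / 1000 :> R.
Proof.
have h0 : 973 / 1250 <= expR (- (1 / 4)) :> R.
  by apply: le_trans (expRN_ge_cubic _); lra.
have h1 : 1211 / 2000 <= expR (- (1 / 2)) :> R.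
  have -> : expR (- (1 / 2)) = expR (- (1 / 4)) ^+ 2 :> R.
    by rewrite -expRM_natr; congr expR; field.
  by rewrite expr2; nra.
have h2 : 1833 / 5000 <= expR (- 1) :> R.
  have -> : expR (- 1) = expR (- (1 / 2)) ^+ 2 :> R.
    by rewrite -expRM_natr; congr expR; field.
  by rewrite expr2; nra.
have e1 : expR (- 1) * expR 1 = 1 :> R by rewrite -expRD addNr expR0.
have e0 : 0 < expR 1 :> R := expR_gt0 1.
have : 1833 / 5000 * expR 1 <= 1 :> R by rewrite -[leRHS]e1; apply: ler_wpM2r => //; exact: ltW.
lra.
Qed.

Lemma expR2_le : expR 2 <= 7442 / 1000 :> R.
Proof.
have -> : expR 2 = expR 1 ^+ 2 :> R by rewrite -expRM_natr mul1r.
have := expR1_le; have := expR_gt0 (1 : R); rewrite expr2; nra.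
Qed.

(* Convexity: the right-hand side is the line through bounds at the two end points. *)
Lemma expR_chord x : 1 <= x -> x <= 104 / 27 -> expR (x / 2) <= 9 / 5 * x.
Proof.
move=> x1 x2.
have tan (v u : R) : expR v * (1 + (u - v)) <= expR u.
  rewrite (_ : expR u = expR v * expR (u - v)); last by rewrite -expRD; congr expR; lra.
  by apply: ler_wpM2l; [exact: expR_ge0|exact: expR_ge1Dx].
have ha : expR (1 / 2) <= 9 / 5 :> R.
  have := expR1_le; have -> : expR 1 = expR (1 / 2) ^+ 2 :> R.
    by rewrite -expRM_natr; congr expR; field.
  have := expR_gt0 (1 / 2 : R); rewrite expr2; nra.
have hb : expR (104 / 27 / 2) <= 104 / 15 :> R.
  have h := expR_ge1Dx (2 / 27 : R).
  have e2 := expR2_le.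
  have -> : expR (104 / 27 / 2) = expR 2 / expR (2 / 27) :> R.
    by rewrite -expRN -expRD; congr expR; field.
  rewrite ler_pdivrMr ?expR_gt0//.
  apply: (le_trans e2); lra.
have h1 := tan (x / 2) (1 / 2); have h2 := tan (x / 2) (104 / 27 / 2).
have e0 := expR_gt0 (x / 2).
(* Both tangent inequalities are taken at x/2 and weighted by the distance of x to the opposite end
   point. The linear terms cancel and leave the length 77/27; as 104/15 = (9/5)(104/27), the chord
   passes through the origin. *)
have k1 : (104 / 27 - x) * (expR (x / 2) * (1 + (1 / 2 - x / 2))) <= (104 / 27 - x) * (9 / 5).
  by apply: ler_wpM2l; lra.
have k2 : (x - 1) * (expR (x / 2) * (1 + (104 / 27 / 2 - x / 2))) <= (x - 1) * (104 / 15).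
  by apply: ler_wpM2l; lra.
have : expR (x / 2) * (77 / 27) <= (9 / 5 * x) * (77 / 27) by lra.
by rewrite ler_pM2r//; lra.
Qed.

(** With n = m + 3 the left side is ((n+1)/(n-1))^n, which tends to e^2. It factors as (1 + 1/n)^n
    <= e times (1 + 1/(n-1))^n <= e exp(1/(n-1)), and the last factor is at most 10/9 once n >= 11.
    The values n = 6, ..., 10 are computed. *)
Lemma ratio_pow_le (m : nat) : (3 <= m)%N ->
  (((m + 4)%:R / (m + 2)%:R) ^+ (m + 3) <= (26 / 9) ^+ 2 :> R).
Proof.
move=> m3; have [m8|m8] := leqP 8 m; last first.
  have r3 : (7 / 5) ^+ 6 <= (26 / 9) ^+ 2 :> R by lra.
  have r4 : (8 / 6) ^+ 7 <= (26 / 9) ^+ 2 :> R by lra.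
  have r5 : (9 / 7) ^+ 8 <= (26 / 9) ^+ 2 :> R by lra.
  have r6 : (10 / 8) ^+ 9 <= (26 / 9) ^+ 2 :> R by lra.
  have r7 : (11 / 9) ^+ 10 <= (26 / 9) ^+ 2 :> R by lra.
  by case: m m3 m8 => [|[|[|[|[|[|[|[|//]]]]]]]].
set n : R := (m + 3)%:R.
have n11 : 11 <= n by rewrite /n (ler_nat _ 11); lia.
have -> : (m + 4)%:R = n + 1 :> R by rewrite /n !natrD; lra.
have -> : (m + 2)%:R = n - 1 :> R by rewrite /n !natrD; lra.
have -> : (n + 1) / (n - 1) = (1 + n^-1) * (1 + (n - 1)^-1) by field; rewrite !gt_eqF; lra.
have ninv : n * n^-1 = 1 by rewrite mulfV// gt_eqF; lra.
rewrite exprMn.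
have a1 : (1 + n^-1) ^+ (m + 3) <= expR 1.
  have -> : expR 1 = expR n^-1 ^+ (m + 3) by rewrite -expRM_natr mulrC ninv.
  have n0 : 0 <= n^-1 by rewrite invr_ge0; lra.
  by apply: lerXn2r; rewrite ?nnegrE ?expR_ge0 ?expR_ge1Dx//; lra.
have a2 : (1 + (n - 1)^-1) ^+ (m + 3) <= expR 1 * (10 / 9).
  apply: (@le_trans _ _ (expR ((n - 1)^-1 * n))).
    have n0 : 0 <= (n - 1)^-1 by rewrite invr_ge0; lra.
    rewrite expRM_natr; apply: lerXn2r; rewrite ?nnegrE ?expR_ge0 ?expR_ge1Dx//; lra.
  have -> : (n - 1)^-1 * n = 1 + (n - 1)^-1.
    by field; rewrite subr_eq0 gt_eqF//; lra.
  rewrite expRD; apply: ler_wpM2l; first exact: expR_ge0.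
  have hi : (n - 1)^-1 <= 10^-1 by rewrite lef_pV2 ?posrE; lra.
  by apply: (le_trans (expR_le_inv _)); [lra|rewrite -[10 / 9]invrK lef_pV2 ?posrE; lra].
apply: (@le_trans _ _ (expR 1 * (expR 1 * (10 / 9)))).
  by apply: ler_pM => //; rewrite exprn_ge0// addr_ge0// invr_ge0; lra.
have := expR1_le; have := expR_gt0 (1 : R); rewrite expr2; nra.
Qed.

(* 26/9 makes the moment bound of order p hold for all p >= 4, and
   3 = (26/9)(27/26) leaves 27/26 for the Gaussian tail. *)
Definition wconst (m : nat) : R := Num.sqrt (26 / 9 / (m + 2)%:R).

Lemma wconst_sqr m : wconst m ^+ 2 = 26 / 9 / (m + 2)%:R.
Proof. by rewrite sqr_sqrtr// divr_ge0. Qed.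

Lemma ler_of_sqr (a b : R) : 0 <= a -> 0 <= b -> a ^+ 2 <= b ^+ 2 -> a <= b.
Proof. by move=> a0 b0; rewrite ler_pXn2r. Qed.

(** Squared and cleared of denominators, this is [ratio_pow_le]; it propagates the moment bound from
    m to m + 2. *)
Lemma wconst_step m : (3 <= m)%N -> wconst m ^+ m.+1 <= m.+2%:R * wconst m.+2 ^+ m.+3.
Proof.
move=> m3; have w0 j i : 0 <= wconst j ^+ i by rewrite exprn_ge0 ?sqrtr_ge0.
apply: ler_of_sqr (w0 _ _) (mulr_ge0 (ler0n _ _) (w0 _ _)) _.
rewrite exprMn -!exprM !(mulnC _ 2) !exprM !wconst_sqr.
have := ratio_pow_le m3; rewrite !addn3 !addn2 !addn4 => h.
have : 0 < 26 / 9 :> R by lra.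
move: (26 / 9) h => c h c0.
have a0 : 0 < (m.+2%:R : R) by []. have b0 : 0 < (m.+4%:R : R) by [].
rewrite !expr_div_n in h *.
rewrite ler_pdivrMr ?exprn_gt0//.
have -> : m.+2%:R ^+ 2 * (c ^+ m.+3 / m.+4%:R ^+ m.+3) * m.+2%:R ^+ m.+1 =
    c ^+ m.+3 * m.+2%:R ^+ m.+3 / m.+4%:R ^+ m.+3.
  by rewrite [m.+2%:R ^+ m.+3]exprS [m.+2%:R ^+ m.+2]exprS; ring.
rewrite ler_pdivlMr ?exprn_gt0//.
move: h; rewrite ler_pdivrMr ?exprn_gt0// => h.
rewrite (_ : c ^+ m.+3 = c ^+ m.+1 * c ^+ 2); last by rewrite -exprD addn2.
by rewrite -mulrA; apply: ler_wpM2l => //; rewrite exprn_ge0// ltW.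
Qed.

(** With p = m + 1, division by [gconst R m] makes this a bound on the mean of the power -p/2 of a
    chi-square variable with p + 1 degrees of freedom. The recursion [rintS] moves in steps of two,
    hence the two base cases. *)
Lemma rint_bound m : (3 <= m)%N -> (rint R m m.+2 <= (gconst R m * wconst m ^+ m.+1)%:E)%E.
Proof.
have step j : (3 <= j)%N -> (rint R j j.+2 <= (gconst R j * wconst j ^+ j.+1)%:E)%E ->
    (rint R j.+2 j.+4 <= (gconst R j.+2 * wconst j.+2 ^+ j.+3)%:E)%E.
  move=> j3 h; apply: (le_trans (rintS R j j.+1)).
  apply: (@le_trans _ _ ((j.+1%:R / j.+2%:R)%:E * (gconst R j * wconst j ^+ j.+1)%:E)%E).
    by apply: lee_wpmul2l => //; rewrite lee_fin divr_ge0.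
  rewrite -EFinM lee_fin /=.
  have -> : j.+1%:R / j.+2%:R * (gconst R j * wconst j ^+ j.+1) =
    (j.+1%:R * gconst R j) * (wconst j ^+ j.+1 / j.+2%:R) by ring.
  apply: ler_wpM2l; first by rewrite mulr_ge0// ltW// gconst_gt0.
  by rewrite ler_pdivrMr// mulrC; exact: wconst_step.
(* The case p = 4 fixes the constant: 2/3 <= 2 (c/5)^2 requires c^2 >= 25/3, and c = 26/9 barely
   suffices. *)
have b3 : (rint R 3 5 <= (gconst R 3 * wconst 3 ^+ 4)%:E)%E.
  apply: (le_trans (rintS R 1 2)).
  apply: (@le_trans _ _ ((2 / 3)%:E * (1^-1)%:E)%E).
    by apply: lee_wpmul2l; [rewrite lee_fin; lra|exact: (rint1 R 0)].
  have w4 : wconst 3 ^+ 4 = (26 / 9 / 5) ^+ 2 by rewrite (exprM _ 2 2) wconst_sqr.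
  rewrite -EFinM lee_fin w4 /=; lra.
have b4 : (rint R 4 6 <= (gconst R 4 * wconst 4 ^+ 5)%:E)%E.
  apply: (le_trans (rintS R 2 3)).
  apply: (@le_trans _ _ ((3 / 4)%:E * ((1 / 2) * (pi / 2))%:E)%E).
    apply: lee_wpmul2l; first by rewrite lee_fin; lra.
    by apply: (le_trans (rintS R 0 1)); rewrite rint02 -EFinM lexx.
  rewrite -EFinM lee_fin /=.
  have p3 := pi_ge3; have p33 := pi_le33.
  rewrite -(@ler_pXn2r _ 2) ?nnegrE//; last 2 first.
  - by lra.
  - by rewrite !mulr_ge0 ?exprn_ge0 ?sqrtr_ge0.
  rewrite !exprMn (sqr_sqrtr (_ : 0 <= pi / 2)); last lra.
  have -> : wconst 4 ^+ 2 = 26 / 9 / 6 := wconst_sqr 4.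
  (* After squaring, the claim is pi <= 128 (13/27)^5, about 3.312, which is why pi is bounded by
     33/10. *)
  suff : pi / 2 * (9 / 128 * pi) <= pi / 2 * (9 * (13 / 27) ^+ 5) :> R by lra.
  by apply: ler_wpM2l; lra.
elim/nat_ind2: m => [//|//|m IH].
by case: m IH => [//|[_ _|[_ _|m IH _]]]; [exact: b3|exact: b4|exact/step/IH].
Qed.

End numeric_bounds.

(** * Moments and tails of the normal law *)

Section normal_integrals.
Context (R : realType).
Implicit Types (x a c q z : R).
Local Notation mu := lebesgue_measure.
Local Notation N01 := (normal_prob (0 : R) 1).

Definition gpeak : R := (Num.sqrt (pi *+ 2))^-1.

Lemma gpeak_gt0 : 0 < gpeak.
Proof. by rewrite invr_gt0 sqrtr_gt0 mulrn_wgt0// pi_gt0. Qed.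

Lemma gpeak_sqr : gpeak ^+ 2 = (2 * pi)^-1.
Proof. have E : pi *+ 2 = 2 * pi :> R by rewrite mulr_natl.
by rewrite /gpeak exprVn E sqr_sqrtr// mulr_ge0// pi_ge0. Qed.

Lemma continuous_gauss (b : R) : continuous (fun x : R => expR (- (b * x ^+ 2 / 2))).
Proof. by move=> x; exact: (is_derive_continuous (is_derive_gauss b x)). Qed.

(** The integrand times the normal density is that density evaluated at sqrt(1 + z^2) x. *)
Lemma normal_laplace z : (\int[N01]_x (expR (- (z ^+ 2 * x ^+ 2 / 2)))%:E = (rad z)%:E)%E.
Proof.
have z0 : 0 < 1 + z ^+ 2 by have := sqr_ge0 z; lra.
have s0 : Num.sqrt (1 + z ^+ 2) != 0 by rewrite gt_eqF// sqrtr_gt0.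
have mphi : measurable_fun [set: R] (fun x : R => (normal_pdf 0 1 x)%:E).
  by apply/measurable_EFinP; exact: measurable_normal_pdf.
have phi0 (x : R) : (0 <= (normal_pdf 0 1 x)%:E :> \bar R)%E by rewrite lee_fin normal_pdf_ge0.
rewrite ge0_integral_normal_prob; last 2 first.
- by apply/measurable_EFinP; apply: continuous_measurable_fun; exact: continuous_gauss.
- by move=> x; rewrite lee_fin expR_ge0.
have := ge0_integral_affine 0 s0 mphi phi0.
rewrite integral_normal_pdf// => h.
have -> : (\int[mu]_x ((expR (- (z ^+ 2 * x ^+ 2 / 2)))%:E * (normal_pdf 0 1 x)%:E) =
    \int[mu]_x (normal_pdf 0 1 (0 + Num.sqrt (1 + z ^+ 2) * x))%:E)%E.
  apply: eq_integral => x _; rewrite -EFinM !normal_pdf01E add0r exprMn sqr_sqrtr ?(ltW z0)//.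
  by rewrite mulrCA -expRD; congr (_ * expR _)%:E; field.
move: h; set I := (\int[mu]_x _)%E; rewrite ger0_norm ?sqrtr_ge0// => h.
have -> : I = ((rad z)%:E * ((Num.sqrt (1 + z ^+ 2))%:E * I))%E.
  by rewrite muleA -EFinM mulVf// mul1e.
by rewrite h mule1.
Qed.

Lemma even_integral_normal (f : R -> R) : continuous f -> (forall x, 0 <= f x) ->
  (forall x, f (- x) = f x) ->
  (\int[N01]_x (f x)%:E = (2 * gpeak)%:E *
   \int[mu]_(x in `[0%R, +oo[) (f x * expR (- (1 * x ^+ 2 / 2)))%:E)%E.
Proof.
move=> cf f0 fN.
have c1 : continuous (fun x : R => f x * expR (- (1 * x ^+ 2 / 2))).
  by move=> x; apply: (@continuousM R R^o f _ x (cf x)); exact: continuous_gauss.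
rewrite ge0_integral_normal_prob; last 2 first.
- by apply/measurable_EFinP; apply: continuous_measurable_fun.
- by move=> x; rewrite lee_fin.
under eq_integral => x _.
  rewrite normal_pdf01E -/gpeak -EFinM mulrCA -[x ^+ 2]mul1r EFinM.
  over.
rewrite ge0_integralZl//=; last 3 first.
- by apply/measurable_EFinP; apply: continuous_measurable_fun.
- by move=> x _; rewrite lee_fin mulr_ge0 ?expR_ge0.
- by rewrite lee_fin ltW// gpeak_gt0.
rewrite ge0_symfun_integralT; last 3 first.
- by move=> x; rewrite mulr_ge0 ?expR_ge0.
- exact: c1.
- by move=> x /=; rewrite sqrrN fN.
by rewrite -set_itvcy muleA -EFinM [gpeak * 2]mulrC.
Qed.

Lemma normal_second_moment : (\int[N01]_x (x ^+ 2)%:E <= 1)%E.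
Proof.
have g0 := gpeak_gt0.
rewrite even_integral_normal; last 3 first.
- by move=> x; exact: (is_derive_continuous (is_derive_expn 2 x)).
- by move=> x; exact: sqr_ge0.
- by move=> x; rewrite sqrrN.
apply: (@le_trans _ _ ((2 * gpeak)%:E * gint 0 (1 : R))%E).
  apply: lee_wpmul2l; first by rewrite lee_fin; lra.
  apply: (@ge0_parts_le R _ _ (fun x => x * expR (- (1 * x ^+ 2 / 2)))).
  - by move=> x x0; rewrite mulr_ge0 ?expR_ge0 ?sqr_ge0.
  - by move=> x x0; rewrite mulr_ge0 ?expR_ge0.
  - exact: continuous_expn_gauss 2 1.
  - exact: continuous_expn_gauss 0 1.
  - move=> x; have H := is_derive_rmul (is_derive_id x 1) (is_derive_gauss 1 x).
    by apply: (is_derive_eq H); rewrite expr0; ring.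
  - by rewrite mul0r.
  - move=> e e0; exists 0 => x x0; apply: (@le_trans _ _ 0); last exact: ltW.
    by rewrite oppr_le0 mulr_ge0 ?expR_ge0.
rewrite gint0// -EFinM lee_fin sqrtr1 invr1 mulr1.
have -> : Num.sqrt (pi / 2) = (2 * gpeak)^-1.
  apply/eqP; rewrite -(@eqrXn2 _ 2)//; last by rewrite invr_ge0; lra.
  rewrite exprVn exprMn gpeak_sqr sqr_sqrtr; last by rewrite divr_ge0 ?pi_ge0.
  move: (lt0r_neq0 (pi_gt0 R)); move: (pi : R) => p p0; by apply/eqP; field; rewrite p0.
by rewrite mulfV//; rewrite gt_eqF//; lra.
Qed.

(** Averaging over x and -x removes the cross term before integration, so that every integrand stays
    nonnegative. *)
Lemma normal_affine_sqr z c : (\int[N01]_x ((z + c * x) ^+ 2)%:E <= (z ^+ 2 + c ^+ 2)%:E)%E.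
Proof.
have mP (a b : R) : measurable_fun [set: R] (fun x : R => ((a + b * x) ^+ 2)%:E).
  apply/measurable_EFinP; apply: measurable_funX.
  by apply: measurable_funD => //; exact: measurable_funM.
have P0 (a b x : R) : (0 <= ((a + b * x) ^+ 2)%:E :> \bar R)%E by rewrite lee_fin sqr_ge0.
have EN : (\int[N01]_x ((z + c * x) ^+ 2)%:E = \int[N01]_x ((z + - c * x) ^+ 2)%:E)%E.
  have mphi : measurable_fun [set: R] (fun x : R => (normal_pdf 0 1 x)%:E).
    by apply/measurable_EFinP; exact: measurable_normal_pdf.
  rewrite !ge0_integral_normal_prob//.
  rewrite -(@ge0_integral_affine R 0 (-1) (fun x => ((z + c * x) ^+ 2)%:E *
    (normal_pdf 0 1 x)%:E)%E)//.
  - rewrite normrN1 mul1e; apply: eq_integral => x _.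
    by rewrite !normal_pdf01E add0r mulrA mulrN1 mulN1r sqrrN.
  - exact: (emeasurable_funM (mP z c) mphi).
  - by move=> x; rewrite mule_ge0// lee_fin normal_pdf_ge0.
have m2 : measurable_fun [set: R] (fun x : R => (x ^+ 2)%:E).
  by apply/measurable_EFinP; exact: measurable_funX.
have S : (\int[N01]_x ((z + c * x) ^+ 2)%:E + \int[N01]_x ((z + - c * x) ^+ 2)%:E <=
    (2 * (z ^+ 2 + c ^+ 2))%:E)%E.
  rewrite -ge0_integralD//; [|exact: mP|exact: mP].
  have -> : (\int[N01]_x (((z + c * x) ^+ 2)%:E + ((z + - c * x) ^+ 2)%:E) =
     \int[N01]_x ((2 * z ^+ 2)%:E + (2 * c ^+ 2)%:E * (x ^+ 2)%:E))%E.
    by apply: eq_integral => x _; rewrite -EFinM -!EFinD; congr EFin; ring.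
  rewrite ge0_integralD//=; last 3 first.
  - by move=> x _; rewrite lee_fin; have := sqr_ge0 z; lra.
  - by move=> x _; rewrite mule_ge0// lee_fin; [have := sqr_ge0 c; lra|exact: sqr_ge0].
  - exact: (measurable_funeM (2 * c ^+ 2)%:E m2).
  have -> : (\int[N01]_x (2 * z ^+ 2)%:E = (2 * z ^+ 2)%:E)%E.
    have -> := @integral_cst _ _ _ N01 setT measurableT (2 * z ^+ 2)%:E.
    have h : N01 setT = 1%E by exact: probability_setT.
    by rewrite [X in (_ * X)%E](_ : _ = 1%E) ?mule1//; exact: h.
  rewrite ge0_integralZl//=; last 2 first.
  - by move=> x _; rewrite lee_fin sqr_ge0.
  - by rewrite lee_fin; have := sqr_ge0 c; lra.
  rewrite mulrDr EFinD; apply: leeD2l.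
  rewrite -[leRHS]mule1; apply: lee_wpmul2l; last exact: normal_second_moment.
  by rewrite lee_fin; have := sqr_ge0 c; lra.
move: S; rewrite -EN; set I := (\int[N01]_x _)%E => S.
have I0 : (0 <= I)%E by exact: integral_ge0.
move: I0 S; case: I => [r| |]//; rewrite -?EFinD !lee_fin; lra.
Qed.

(** Up to normalization, the integral of x^2 - a beyond s = sqrt a is s exp(-s^2/2) minus a - 1
    times the Gaussian tail. The Mills ratio bound, tail >= s exp(-s^2/2) / (1 + s^2), is built into
    the primitive [F], whose derivative [f] exceeds the integrand by 2 (a - 1) rad^4 times the
    Gaussian. *)
Lemma normal_tail a : 2 <= a ->
  (\int[N01]_x (Num.max (x ^+ 2 - a) 0)%:E <= (2 * expR (- (13 * (a + 2) / 27)))%:E)%E.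
Proof.
move=> a2; have g0 := gpeak_gt0.
set s := Num.sqrt a; have s0 : 0 < s by rewrite sqrtr_gt0; lra.
have s2 : s ^+ 2 = a by rewrite sqr_sqrtr//; lra.
pose ph x : R := expR (- (1 * x ^+ 2 / 2)).
have ph0 x : 0 <= ph x by exact: expR_ge0.
pose F x := - (x * ph x * (1 - (a - 1) * rad x ^+ 2)).
pose f x := (x ^+ 2 - 1 - (a - 1) * (1 - 2 * rad x ^+ 4)) * ph x.
have dF x : is_derive x 1 F (f x).
  have d1 := is_derive_rmul (is_derive_id x 1) (is_derive_gauss 1 x).
  have d2 := is_derive_sub (is_derive_cst (1 : R) x 1) (is_derive_scale (a - 1)
    (is_derive_rad 2 x)).
  have H := is_derive_scale (-1) (is_derive_rmul d1 d2).
  have E : F = (fun z => -1 * (z * expR (- (1 * z ^+ 2 / 2)) * (1 - (a - 1) * rad z ^+ 2))).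
    by apply/funext => z; rewrite /F mulN1r.
  rewrite E; apply: (is_derive_eq H); rewrite /f /ph /=.
  have r2 : x ^+ 2 * rad x ^+ 2 = 1 - rad x ^+ 2.
    rewrite rad_sqr; field; rewrite gt_eqF//; have := sqr_ge0 x; lra.
  have -> : rad x ^+ 4 = rad x ^+ 2 ^+ 2 by rewrite -exprM.
  move: r2; move: (rad x ^+ 2) (expR _) => r e r2.
  apply/eqP; rewrite -subr_eq0.
  rewrite (_ : _ - _ = - (a - 1) * (2 * r + 1) * e * (x ^+ 2 * r - (1 - r))); last by ring.
  by rewrite r2 subrr mulr0.
have cf : continuous f.
  move=> x; pose d1 := is_derive_sub (is_derive_cst (1 : R) x 1) (is_derive_scale 2
    (is_derive_rad 4 x)).
  pose d2 := is_derive_sub (is_derive_expn 2 x) (is_derive_cst (1 : R) x 1).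
  exact: (is_derive_continuous (is_derive_rmul (is_derive_sub d2 (is_derive_scale (a - 1) d1))
    (is_derive_gauss 1 x))).
have limF : F x @[x --> +oo] --> 0.
  have l1 : rad x ^+ 2 @[x --> +oo] --> (0 : R).
    apply: (@cvg_pinfty_bound _ _ 1) => x x1; rewrite ger0_norm ?sqr_ge0//.
    apply: le_trans (rad_le_inv x1); rewrite expr2 ger_pMr ?rad_gt0//; exact: rad_le1.
  have l2 := @cvg_expn_gauss R 1 1 ltr01.
  have l3 : x * ph x * (1 - (a - 1) * rad x ^+ 2) @[x --> +oo] --> 0 * (1 - (a - 1) * 0).
    apply: (@cvgM R R _ _ (fun x => x * ph x)); first exact: l2.
    by apply: cvgB; [exact: cvg_cst|apply: cvgMr; exact: l1].
  have := cvgN l3; rewrite mul0r oppr0; exact.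
have lef x : (x ^+ 2 - a) * ph x <= f x.
  rewrite /f; apply: ler_wpM2r => //.
  have := exprn_ge0 4 (ltW (rad_gt0 x)) => r0.
  have : 0 <= (a - 1) * rad x ^+ 4 by rewrite mulr_ge0//; lra.
  lra.
have f0 x : s <= x -> 0 <= f x.
  move=> sx; apply: le_trans (lef x); rewrite mulr_ge0// subr_ge0 -s2.
  by apply: lerXn2r => //; rewrite nnegrE; lra.
have intf := @ge0_FTCy R f F s 0 f0 cf dF limF.
have Fs : 0 - F s = s * ph s * (2 / (a + 1)).
  rewrite /F rad_sqr s2 sub0r opprK; congr (_ * _); field; rewrite gt_eqF//; lra.
have cm : continuous (fun x : R => Num.max (x ^+ 2 - a) 0).
  have E x : Num.max (x ^+ 2 - a) 0 = 2^-1 * (x ^+ 2 - a + `|x ^+ 2 - a|).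
    by rewrite maxr_absE !addr0 subr0 mulrC.
  rewrite (funext E) => x.
  have cx := is_derive_continuous (is_derive_sub (is_derive_expn 2 x) (is_derive_cst a x 1)).
  by apply: cvgMr; apply: cvgD; [exact: cx|apply: cvg_norm; exact: cx].
rewrite even_integral_normal//; last 2 first.
- by move=> x; rewrite le_max lexx orbT.
- by move=> x; rewrite sqrrN.
apply: (@le_trans _ _ ((2 * gpeak)%:E * (s * ph s * (2 / (a + 1)))%:E)%E).
  apply: lee_wpmul2l; first by rewrite lee_fin; lra.
  rewrite -Fs -intf.
  have -> : `[s, +oo[%classic = (`[0%R, +oo[ `&` `[s, +oo[)%classic :> set R.
    apply/seteqP; split => x /=; rewrite !in_itv/= !andbT; last by case.
    by move=> sx; split => //; lra.
  have -> : (\int[mu]_(x in `[0%R, +oo[) (Num.max (x ^+ 2 - a) 0 * expR (- (1 * x ^+ 2 / 2)))%:E =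
      \int[mu]_(x in `[0%R, +oo[ `&` `[s, +oo[) (Num.max (x ^+ 2 - a) 0 * expR (-
        (1 * x ^+ 2 / 2)))%:E)%E.
    rewrite integral_mkcondr; apply: eq_integral => x.
    rewrite inE /= in_itv/= andbT => x0; rewrite /patch.
    case: ifPn => // /negP; rewrite inE/= in_itv/= andbT => /negP; rewrite -ltNge => sx.
    have : x ^+ 2 <= a by rewrite -s2; apply: lerXn2r; rewrite ?nnegrE; lra.
    by move=> xa; rewrite max_r ?mul0r// subr_le0.
  apply: ge0_le_integral => //.
  - exact: measurableI.
  - by move=> x _; rewrite lee_fin mulr_ge0 ?expR_ge0// le_max lexx orbT.
  - apply: measurable_funTS; apply/measurable_EFinP; apply: continuous_measurable_fun => x.
    by apply: (@continuousM R R^o _ _ x (cm x)); exact: continuous_gauss.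
  - by apply: measurable_funTS; apply/measurable_EFinP; exact: continuous_measurable_fun.
  - move=> x [_]; rewrite /= in_itv/= andbT => sx; rewrite lee_fin.
    apply: le_trans (lef x); apply: ler_wpM2r => //; rewrite ge_max lexx subr_ge0 -s2.
    by apply: lerXn2r => //; rewrite nnegrE; lra.
rewrite -EFinM lee_fin /ph s2 mul1r.
(* The exponent is -a/2 + (a+2)/54 - 1. The middle term contributes a factor of at least 29/27 when
   a >= 2, which the estimate [key] consumes. *)
have -> : expR (- (13 * (a + 2) / 27)) = expR (- (a / 2)) * (expR ((a + 2) / 54) / expR 1).
  by rewrite -expRN -!expRD; congr expR; field.
have e1 := expR1_le R; have e10 := expR_gt0 (1 : R).
have hx : 29 / 27 <= expR ((a + 2) / 54) by have := expR_ge1Dx ((a + 2) / 54); lra.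
have p3 := @pi_ge3 R.
have key : 2 * gpeak * s / (a + 1) * expR 1 <= 29 / 27.
  apply: ler_of_sqr; [by rewrite !mulr_ge0 ?invr_ge0 ?(ltW s0) ?(ltW g0) ?(ltW e10)//; lra|lra|].
  have -> : (2 * gpeak * s / (a + 1) * expR 1) ^+ 2 =
    4 * (gpeak ^+ 2 * (a / (a + 1) ^+ 2) * expR 1 ^+ 2).
    by rewrite -s2; field; rewrite gt_eqF//; lra.
  have h1 : gpeak ^+ 2 <= 6^-1 by rewrite gpeak_sqr lef_pV2 ?posrE; lra.
  have h2 : a / (a + 1) ^+ 2 <= 2 / 9.
    rewrite ler_pdivrMr ?exprn_gt0//; last lra.
    have : 0 <= (2 * a - 1) * (a - 2) by rewrite mulr_ge0//; lra.
    rewrite expr2; lra.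
  have h3 : expR 1 ^+ 2 <= 7442 / 1000 :> R by rewrite expr2; nra.
  have h4 : gpeak ^+ 2 * (a / (a + 1) ^+ 2) <= 6^-1 * (2 / 9).
    by apply: ler_pM; rewrite ?sqr_ge0// divr_ge0 ?sqr_ge0//; lra.
  have h5 : gpeak ^+ 2 * (a / (a + 1) ^+ 2) * expR 1 ^+ 2 <= 6^-1 * (2 / 9) * (7442 / 1000).
    by apply: ler_pM; rewrite ?sqr_ge0// mulr_ge0 ?sqr_ge0// divr_ge0 ?sqr_ge0//; lra.
  lra.
have -> : 2 * gpeak * (s * expR (- (a / 2)) * (2 / (a + 1))) =
    2 * (expR (- (a / 2)) * ((2 * gpeak * s / (a + 1) * expR 1) / expR 1)).
  by field; rewrite !gt_eqF//; lra.
apply: ler_wpM2l => //; apply: ler_wpM2l; first exact: expR_ge0.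
by apply: ler_wpM2r; [rewrite invr_ge0 ltW|lra].
Qed.

End normal_integrals.

(** * Square roots of positive semidefinite matrices *)

Section square_root.
Context (R : realType).

Lemma interpolation_exists (f : R -> R) (s : seq R) : exists q : {poly R}, {in s, forall x,
  q.[x] = f x}.
Proof.
elim: s => [|a s [q qs]]; first by exists 0.
have [as_|as_] := boolP (a \in s).
  by exists q => x; rewrite inE => /predU1P[->|]; exact: qs.
pose w := \prod_(y <- s) ('X - y%:P) : {poly R}.
have w0 : w.[a] != 0 by rewrite -rootE root_prod_XsubC.
exists (q + ((f a - q.[a]) / w.[a])%:P * w) => x; rewrite hornerD hornerM hornerC inE.
have [->|xa /= xs] := eqVneq x a; first by rewrite divfK// addrC subrK.
have /eqP -> : w.[x] == 0 by rewrite -rootE root_prod_XsubC.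
by rewrite mulr0 addr0 qs.
Qed.

Lemma trmx_horner_mx n (M : 'M[R]_n.+1) (q : {poly R}) :
  M^T = M -> (horner_mx M q)^T = horner_mx M q.
Proof.
move=> Ms; elim/poly_ind: q => [|q c IH]; first by rewrite rmorph0 trmx0.
rewrite rmorphD rmorphM/= horner_mx_X horner_mx_C linearD/= tr_scalar_mx; congr (_ + _).
by rewrite trmx_mul IH Ms; apply: comm_mx_horner.
Qed.

Lemma mulmx_tr_ge0 n (x : 'rV[R]_n) : 0 <= (x *m x^T) 0 0.
Proof. by rewrite mxE; apply: sumr_ge0 => i _; rewrite mxE -expr2 sqr_ge0. Qed.

Lemma mulmx_tr_gt0 n (x : 'rV[R]_n) : x != 0 -> 0 < (x *m x^T) 0 0.
Proof.
move=> x0; rewrite lt_neqAle mulmx_tr_ge0 andbT eq_sym; apply: contraNneq x0.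
rewrite mxE => /eqP; rewrite psumr_eq0; last by move=> i _; rewrite mxE -expr2 sqr_ge0.
move=> /allP h; apply/eqP/rowP => i; rewrite [RHS]mxE; apply/eqP.
by have := h i (mem_index_enum i); rewrite /= mxE -expr2 sqrf_eq0.
Qed.

Lemma horner_mx_pow4 (F : fieldType) (j : {rmorphism R -> F}) p (M : 'M[R]_p.+1)
    (B : 'M[F]_p.+1) (s : 'I_p.+1 -> R) (q : {poly R}) :
  B \in unitmx -> map_mx j M = invmx B *m diag_mx (\row_a j (s a)) *m B ->
  (forall a, q.[s a] ^+ 4 = s a) ->
  horner_mx M q *m horner_mx M q *m (horner_mx M q *m horner_mx M q) = M.
Proof.
move=> uB E qs; set Y := horner_mx M q.
have YC : map_mx j Y = invmx B *m diag_mx (\row_a j (q.[s a])) *m B.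
  rewrite map_horner_mx [in LHS]E horner_mx_uconjC// horner_mx_diag.
  by congr (_ *m diag_mx _ *m _); apply/rowP => a; rewrite !mxE horner_map.
have mulE (d d' : 'rV[F]_p.+1) : invmx B *m diag_mx d *m B *m (invmx B *m diag_mx d' *m B) =
    invmx B *m diag_mx (\row_a (d 0 a * d' 0 a)) *m B.
  by rewrite !mulmxA mulmxK// -(mulmxA (invmx B)) mulmx_diag.
apply: (@map_mx_inj _ _ j); rewrite !map_mxM YC !mulE E.
congr (_ *m diag_mx _ *m _); apply/rowP => a; rewrite !mxE -!rmorphM; congr (j _).
by rewrite -[RHS]qs !exprS expr0 mulr1 !mulrA.
Qed.

(** The spectral theorem is applied over the complex numbers, but the root is a real polynomial in
    [M] and so stays real and symmetric. Interpolating fourth roots instead of square roots makes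
    the result the square of a symmetric matrix, hence positive semidefinite at once. *)
Lemma psd_sqrt_exists p (M : 'M[R]_p) : psdmx M -> exists X, psdmx X /\ X *m X = M.
Proof.
case: p M => [|p] M [Ms Mp].
  by exists M; split; [split|rewrite [LHS]flatmx0 [RHS]flatmx0].
pose C : numClosedFieldType := complex.complex R;
  pose j : {rmorphism R -> C} := complex.real_complex_def (Phant R).
pose MC := map_mx j M.
have MCherm : MC \is hermsymmx.
  apply: realsym_hermsym.
    apply/is_hermitianmxP; rewrite expr0 scale1r map_mx_id// /MC map_trmx Ms//.
  by apply/mxOverP => a b; rewrite mxE; apply/complex.complex_realP; exists (M a b).
have := hermitian_normalmx MCherm => /orthomx_spectralP.
set Pm := spectralmx MC; set sp := spectral_diag MC => E.
have uP : Pm \in unitmx by exact: spectral_unit.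
have /mxOverP/(_ 0) spr := hermitian_spectral_diag_real MCherm.
pose s a : R := complex.Re (sp 0 a).
have spE a : sp 0 a = j (s a).
  by have /complex.complex_realP[x xE] := spr a; rewrite /s xE.
have s0 a : 0 <= s a.
  have : eigenvalue MC (j (s a)).
    apply/eigenvalueP; exists (row a Pm).
      rewrite -row_mul {1}E !mulmxA mulmxV// mul1mx; apply/rowP => b.
      rewrite !mxE -spE -[RHS]mul1r; under eq_bigr do rewrite !mxE.
      rewrite (bigD1 a)//= eqxx mulr1n big1 ?addr0 ?mul1r// => c ca.
      by rewrite eq_sym (negbTE ca) mulr0n mul0r.
    apply: contraTneq uP => r0; rewrite -row_free_unit -kermx_eq0.
    apply/negP => /eqP k0.
    have : (delta_mx 0 a : 'rV[C]_p.+1) *m Pm = 0 by rewrite -rowE.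
    move=> /sub_kermxP; rewrite k0 submx0 => /eqP /rowP/(_ a).
    by rewrite !mxE !eqxx => /eqP; rewrite oner_eq0.
  (* Through the characteristic polynomial the real eigenvalue acquires a real eigenvector, to which
     the positivity of [M] applies. *)
  rewrite eigenvalue_root_char -map_char_poly fmorph_root -eigenvalue_root_char.
  move=> /eigenvalueP[v vM v0]; have := Mp v; rewrite vM -scalemxAl mxE.
  by rewrite pmulr_lge0// mulmx_tr_gt0.
have [q qE] := interpolation_exists (fun x => Num.sqrt (Num.sqrt x)) [seq s a | a : 'I_p.+1].
pose Y := horner_mx M q.
have Ys : Y^T = Y by exact: trmx_horner_mx.
have Y4 : Y *m Y *m (Y *m Y) = M.
  apply: (horner_mx_pow4 (j := j) uP (s := s)).
    by rewrite -/MC E; congr (_ *m diag_mx _ *m _); apply/rowP => a; rewrite mxE spE.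
  move=> a; rewrite qE; last by apply/mapP; exists a => //; rewrite mem_enum.
  by rewrite (exprM _ 2 2) sqr_sqrtr ?sqrtr_ge0// sqr_sqrtr.
exists (Y *m Y); split=> //; split; first by rewrite trmx_mul Ys.
move=> x; have -> : x *m (Y *m Y) *m x^T = (x *m Y) *m (x *m Y)^T by rewrite trmx_mul Ys !mulmxA.
exact: mulmx_tr_ge0.
Qed.

Lemma sqrtmxP p (M : 'M[R]_p) : psdmx M -> psdmx (sqrtmx M) /\ sqrtmx M *m sqrtmx M = M.
Proof. by move=> /psd_sqrt_exists h; have := xgetPex 0 h. Qed.

End square_root.

(** * Frobenius norm and projections *)

Section frobenius.
Context (R : realType).

Definition fsq (p q : nat) (M : 'M[R]_(p, q)) : R := \sum_i \sum_j M i j ^+ 2.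

Lemma fsq_ge0 p q (M : 'M[R]_(p, q)) : 0 <= fsq M.
Proof. by apply: sumr_ge0 => i _; apply: sumr_ge0 => j _; exact: sqr_ge0. Qed.

Lemma frob_sqr p q (M : 'M[R]_(p, q)) : frob M ^+ 2 = fsq M.
Proof. by rewrite sqr_sqrtr ?fsq_ge0. Qed.

Lemma frob_ge0 p q (M : 'M[R]_(p, q)) : 0 <= frob M.
Proof. exact: sqrtr_ge0. Qed.

Lemma fsqE p q (M : 'M[R]_(p, q)) : fsq M = \tr (M *m M^T).
Proof.
by apply: eq_bigr => i _; rewrite mxE; apply: eq_bigr => j _; rewrite mxE expr2.
Qed.

Lemma fsq_tr p q (M : 'M[R]_(p, q)) : fsq M^T = fsq M.
Proof. by rewrite !fsqE trmxK mxtrace_mulC. Qed.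

Lemma frob_tr p q (M : 'M[R]_(p, q)) : frob M^T = frob M.
Proof. by congr Num.sqrt; exact: fsq_tr. Qed.

Lemma fsq_entry p q (M : 'M[R]_(p, q)) i j : M i j ^+ 2 <= fsq M.
Proof.
rewrite /fsq (bigD1 i)//= (bigD1 j)//= -addrA lerDl addr_ge0// sumr_ge0// => a _.
- exact: sqr_ge0.
- by apply: sumr_ge0 => b _; exact: sqr_ge0.
Qed.

Lemma fsq_eq0 p q (M : 'M[R]_(p, q)) : fsq M = 0 -> M = 0.
Proof.
move=> h; apply/matrixP => i j; rewrite mxE; apply/eqP; rewrite -sqrf_eq0 eq_le sqr_ge0 andbT.
by rewrite -h fsq_entry.
Qed.

Lemma fsq0 p q : fsq (0 : 'M[R]_(p, q)) = 0.
Proof. by rewrite fsqE mul0mx mxtrace0. Qed.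

Lemma fsqZ p q (a : R) (M : 'M[R]_(p, q)) : fsq (a *: M) = a ^+ 2 * fsq M.
Proof.
rewrite /fsq mulr_sumr; apply: eq_bigr => i _; rewrite mulr_sumr.
by apply: eq_bigr => j _; rewrite mxE exprMn.
Qed.

Lemma fsq_isoL p q s (Q : 'M[R]_(p, q)) (M : 'M[R]_(q, s)) :
  Q^T *m Q = 1%:M -> fsq (Q *m M) = fsq M.
Proof.
by move=> h; rewrite -fsq_tr fsqE trmxK trmx_mul mulmxA -(mulmxA M^T) h mulmx1 -[RHS]fsq_tr
  fsqE trmxK.
Qed.

Lemma fsqD p q (A B : 'M[R]_(p, q)) :
  fsq (A + B) = fsq A + fsq B + 2 * \tr (A *m B^T).
Proof.
rewrite !fsqE linearD/= mulmxDl !mulmxDr !mxtraceD.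
have -> : \tr (B *m A^T) = \tr (A *m B^T) by rewrite -mxtrace_tr trmx_mul trmxK.
by ring.
Qed.

Lemma fsqB_ge p q (A B : 'M[R]_(p, q)) : 2 * \tr (A *m B^T) <= fsq A + fsq B.
Proof.
have := fsq_ge0 (A - B); rewrite fsqD linearN/= mulmxN linearN/= => h.
have : fsq (- B) = fsq B by rewrite -scaleN1r fsqZ sqrrN expr1n mul1r.
lra.
Qed.

Lemma frob_dot_le p q (A B : 'M[R]_(p, q)) : \tr (A *m B^T) <= frob A * frob B.
Proof.
have [a0|a0] := eqVneq (frob A) 0.
  have : fsq A = 0 by rewrite -frob_sqr a0 expr0n.
  by move=> /fsq_eq0 ->; rewrite mul0mx mxtrace0 mulr_ge0 ?frob_ge0.
have [b0|b0] := eqVneq (frob B) 0.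
  have : fsq B = 0 by rewrite -frob_sqr b0 expr0n.
  by move=> /fsq_eq0 ->; rewrite linear0 mulmx0 mxtrace0 mulr_ge0 ?frob_ge0.
have := fsqB_ge ((frob A)^-1 *: A) ((frob B)^-1 *: B).
rewrite !fsqZ -!frob_sqr !exprVn !mulVf ?expf_eq0// linearZ/= -scalemxAl -scalemxAr !mxtraceZ
  => h.
have A0 : 0 < frob A by rewrite lt_def a0 frob_ge0.
have B0 : 0 < frob B by rewrite lt_def b0 frob_ge0.
have : (frob A)^-1 * ((frob B)^-1 * \tr (A *m B^T)) <= 1 by lra.
by rewrite ler_pdivrMl// ler_pdivrMl// mulr1 mulrC.
Qed.

Lemma frob_triangle p q (A B : 'M[R]_(p, q)) : frob (A + B) <= frob A + frob B.
Proof.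
apply: ler_of_sqr; rewrite ?addr_ge0 ?frob_ge0// frob_sqr fsqD -!frob_sqr.
have := frob_dot_le A B; rewrite expr2; lra.
Qed.

Lemma fsq_pyth p q (Q : 'M[R]_p) (M : 'M[R]_(p, q)) : Q^T = Q -> Q *m Q = Q ->
  fsq M = fsq (Q *m M) + fsq ((1%:M - Q) *m M).
Proof.
move=> Qs QQ; have {1}-> : M = Q *m M + (1%:M - Q) *m M by rewrite -mulmxDl addrC subrK mul1mx.
rewrite fsqD (_ : \tr _ = 0) ?mulr0 ?addr0//.
rewrite trmx_mul linearB/= trmx1 Qs mxtrace_mulC !mulmxA -(mulmxA M^T) mulmxBl mul1mx QQ subrr.
by rewrite mulmx0 mul0mx mxtrace0.
Qed.

Lemma fsq_projL p q (Q : 'M[R]_p) (M : 'M[R]_(p, q)) : Q^T = Q -> Q *m Q = Q ->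
  fsq ((1%:M - Q) *m M) <= fsq M.
Proof. by move=> Qs QQ; rewrite (fsq_pyth M Qs QQ) lerDr fsq_ge0. Qed.

Lemma fsq_coisoL p q s (Q : 'M[R]_(p, q)) (M : 'M[R]_(q, s)) :
  Q *m Q^T = 1%:M -> fsq (Q *m M) <= fsq M.
Proof.
move=> h; rewrite -(fsq_isoL (Q *m M) (_ : (Q^T)^T *m Q^T = 1%:M)) ?trmxK// mulmxA.
rewrite (fsq_pyth M (Q := Q^T *m Q)); first by rewrite lerDl fsq_ge0.
- by rewrite trmx_mul trmxK.
- by rewrite mulmxA -(mulmxA Q^T) h mulmx1.
Qed.

Lemma fsq_coisoR p q s (Q : 'M[R]_(q, s)) (M : 'M[R]_(p, q)) :
  Q^T *m Q = 1%:M -> fsq (M *m Q) <= fsq M.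
Proof.
by move=> h; rewrite -fsq_tr trmx_mul (le_trans (fsq_coisoL _ _)) ?trmxK// fsq_tr.
Qed.

(** Unit vectors are added one at a time from the common kernel of the rows present so far, nonzero
    for reasons of dimension. The rows of [B] may be dependent. *)
Lemma orthonormal_complement a l (B : 'M[R]_(a, l)) j : (j + a <= l)%N ->
  exists N : 'M[R]_(j, l), N *m N^T = 1%:M /\ B *m N^T = 0.
Proof.
elim: j => [_|j IH jal]; first by exists 0; split; apply/matrixP => ? [].
have [N [NN BN]] := IH (ltnW jal).
have : kermx (col_mx B N)^T != 0.
  rewrite kermx_eq0 /row_free; apply: contraL jal => /eqP h.
  by have := rank_leq_col (col_mx B N)^T; rewrite h; lia.
move=> /rowV0Pn[v /sub_kermxP vk v0].
move: vk; rewrite tr_col_mx mul_mx_row -[0]row_mx0 => /eq_row_mx[vB vN].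
have s0 := mulmx_tr_gt0 v0; set s := (v *m v^T) 0 0 in s0.
have vv : v *m v^T = s%:M by rewrite [LHS]mx11_scalar.
pose W := col_mx ((Num.sqrt s)^-1 *: v) N.
have Nv : N *m v^T = 0 by rewrite -[N]trmxK -trmx_mul vN trmx0.
have Bv : B *m v^T = 0 by rewrite -[B]trmxK -trmx_mul vB trmx0.
have W1 : W *m W^T = 1%:M.
  rewrite tr_col_mx mul_col_row linearZ/= -!scalemxAl -!scalemxAr vv vN Nv !scaler0 NN.
  rewrite scalerA -invfM -expr2 sqr_sqrtr ?(ltW s0)// scale_scalar_mx mulVf ?gt_eqF//.
  by rewrite -scalar_mx_block.
have W2 : B *m W^T = 0.
  by rewrite tr_col_mx mul_mx_row linearZ/= -scalemxAr BN Bv scaler0 row_mx0.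
by exists W.
Qed.

End frobenius.

(** * Projections, singular value blocks and the deterministic error bound *)

Section projections.
Context (R : realType).

Lemma colproj_sym p q (M : 'M[R]_(p, q)) : (colproj M)^T = colproj M.
Proof. by have [] := mpinvP M. Qed.

Lemma colprojK p q (M : 'M[R]_(p, q)) : colproj M *m M = M.
Proof. by have [] := mpinvP M. Qed.

Lemma colproj_idem p q (M : 'M[R]_(p, q)) : colproj M *m colproj M = colproj M.
Proof. by rewrite {2}/colproj mulmxA colprojK. Qed.

(** The complementary projection kills [Z *m Y] and does not increase the norm. *)
Lemma fsq_residual_le p q n (Z : 'M[R]_(p, q)) (A : 'M[R]_(p, n)) (Y : 'M[R]_(q, n)) :
  fsq ((1%:M - colproj Z) *m A) <= fsq (A - Z *m Y).
Proof.
have -> : (1%:M - colproj Z) *m A = (1%:M - colproj Z) *m (A - Z *m Y).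
  have h : (1%:M - colproj Z) *m Z = 0 by rewrite mulmxBl mul1mx colprojK subrr.
  by rewrite [RHS]mulmxBr (mulmxA _ Z) h mul0mx subr0.
by apply: fsq_projL; [exact: colproj_sym|exact: colproj_idem].
Qed.

Lemma mpinv_inverse p (M B : 'M[R]_p) : M *m B = 1%:M -> mpinv M = B.
Proof.
move=> MB; have BM := mulmx1C MB.
by apply: mpinv_eq; split; rewrite ?MB ?BM ?mul1mx ?trmx1.
Qed.

Lemma colproj_iso p q (Q : 'M[R]_(p, q)) (X : 'M[R]_q) :
  Q^T *m Q = 1%:M -> X \in unitmx -> colproj (Q *m X) = Q *m Q^T.
Proof.
move=> QQ u; have E : (Q *m X) *m (invmx X *m Q^T) = Q *m Q^T by rewrite mulmxA mulmxK.
have F : (invmx X *m Q^T) *m (Q *m X) = 1%:M.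
  by rewrite mulmxA -(mulmxA _ Q^T) QQ mulmx1 mulVmx.
rewrite /colproj (@mpinv_eq _ _ _ _ (invmx X *m Q^T)); first exact: E.
split; rewrite ?E ?F ?mul1mx ?trmx1//.
- by rewrite mulmxA -(mulmxA Q) QQ mulmx1.
- by rewrite trmx_mul trmxK.
Qed.

Lemma hd_tl_mul (q q' p k : nat) (kp : (k <= p)%N) (M : 'M[R]_(q, p)) (N : 'M[R]_(q', p)) :
  hd_cols kp M *m (hd_cols kp N)^T + tl_cols kp M *m (tl_cols kp N)^T = M *m N^T.
Proof.
apply/matrixP => i j; rewrite !mxE.
have e := subnKC kp.
rewrite [RHS](reindex (cast_ord e))/=; last first.
  by exists (cast_ord (esym e)) => x _; apply: val_inj.
rewrite big_split_ord/=; congr (_ + _); apply: eq_bigr => a _; rewrite !mxE.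
- by rewrite (_ : hd_ord kp a = cast_ord e (lshift _ a))//; apply: val_inj.
- by rewrite /tl_ord; congr (M i _ * N j _); apply: val_inj.
Qed.

Lemma fsq_splitL p q a b (E : 'M[R]_(p, a)) (F : 'M[R]_(p, b)) (X : 'M[R]_(p, q)) :
  E *m E^T + F *m F^T = 1%:M -> fsq X = fsq (E^T *m X) + fsq (F^T *m X).
Proof.
move=> h; have eqn c (Y : 'M[R]_(c, q)) : fsq Y = \tr (Y^T *m Y) by rewrite -fsq_tr fsqE trmxK.
rewrite !eqn !trmx_mul !trmxK -mxtraceD; congr (\tr _).
by rewrite !mulmxA -mulmxDl -!(mulmxA X^T) -mulmxDr h mulmx1.
Qed.

Lemma fsq_splitR p q a b (E : 'M[R]_(p, a)) (F : 'M[R]_(p, b)) (X : 'M[R]_(q, p)) :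
  E *m E^T + F *m F^T = 1%:M -> fsq X = fsq (X *m E) + fsq (X *m F).
Proof.
move=> h; rewrite -fsq_tr (fsq_splitL _ h) -fsq_tr trmx_mul !trmxK; congr (_ + _).
by rewrite -fsq_tr trmx_mul !trmxK.
Qed.

Lemma orthomx_blocks p k (kp : (k <= p)%N) (U : 'M[R]_p) : Defs.orthomx U ->
  [/\ (hd_cols kp U)^T *m hd_cols kp U = 1%:M, (tl_cols kp U)^T *m tl_cols kp U = 1%:M,
      (hd_cols kp U)^T *m tl_cols kp U = 0, (tl_cols kp U)^T *m hd_cols kp U = 0 &
      hd_cols kp U *m (hd_cols kp U)^T + tl_cols kp U *m (tl_cols kp U)^T = 1%:M].
Proof.
move=> [U1 U2].
have sub a b (f : 'I_a -> 'I_p) (g : 'I_b -> 'I_p) :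
    (colsub f U)^T *m colsub g U = mxsub f g 1%:M.
  apply/matrixP => i j; rewrite -U1 !mxE; apply: eq_bigr => c _; by rewrite !mxE.
split; last by rewrite hd_tl_mul.
- by rewrite sub; apply/matrixP => i j; rewrite !mxE; congr (_%:R);
  apply/eqP/eqP => [/(congr1 val) h|->//]; exact: val_inj.
- rewrite sub; apply/matrixP => i j; rewrite !mxE; congr (_%:R).
  have [->|ij] := eqVneq i j; first by rewrite eqxx.
  congr nat_of_bool; apply: contraNF ij => /eqP /(congr1 val) /= h; apply/eqP;
    apply: val_inj => /=.
  by have : (k + i = k + j)%N by []; lia.
- rewrite sub; apply/matrixP => i j; rewrite !mxE; case: eqP => // /(congr1 val) /= h.
  by have := ltn_ord i; rewrite h; lia.
- rewrite sub; apply/matrixP => i j; rewrite !mxE; case: eqP => // /(congr1 val) /= h.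
  by have := ltn_ord j; rewrite -h; lia.
Qed.

Section svd.
Context (m n k : nat) (A : 'M[R]_(m, n)) (U : 'M[R]_m) (S : 'M[R]_(m, n)) (V : 'M[R]_n).
Context (km : (k <= m)%N) (kn : (k <= n)%N) (svdA : is_svd A U S V).
Let Uk := hd_cols km U.
Let Ub := tl_cols km U.
Let Vk := hd_cols kn V.
Let Vb := tl_cols kn V.
Let Sk := hd_block km kn S.
Let Sb := tl_block km kn S.

Lemma svd_blocks : [/\ Uk^T *m A *m Vk = Sk, Uk^T *m A *m Vb = 0,
  Ub^T *m A *m Vk = 0 & Ub^T *m A *m Vb = Sb].
Proof.
have [[U1 _] [V1 _] -> dS _] := svdA.
have E : U^T *m (U *m S *m V^T) *m V = S.
  by rewrite !mulmxA U1 mul1mx -mulmxA V1 mulmx1.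
have sub a b (f : 'I_a -> 'I_m) (g : 'I_b -> 'I_n) (B : 'M[R]_(m, n)) :
    (colsub f U)^T *m B *m colsub g V = mxsub f g (U^T *m B *m V).
  apply/matrixP => i j; rewrite !mxE; apply: eq_bigr => c _; rewrite !mxE; congr (_ * _).
  by apply: eq_bigr => c' _; rewrite !mxE.
have d0 (i : 'I_m) (j : 'I_n) : i != j :> nat -> S i j = 0.
  by move=> ij; exact: (is_diag_mxP dS).
split; rewrite sub E //; apply/matrixP => i j; rewrite !mxE; apply: d0 => /=.
- by have := ltn_ord i; lia.
- by have := ltn_ord j; lia.
Qed.

Lemma hd_block_sym : Sk^T = Sk.
Proof.
have [_ _ _ dS _] := svdA; apply/matrixP => i j; rewrite !mxE.
have [->//|ij] := eqVneq i j.
rewrite !(is_diag_mxP dS)//=.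
by rewrite eq_sym.
Qed.

(** In the singular bases, A - Z W Vk^T has the blocks Sk - Uk^T Z W = 0 and 0 above, -Ub^T Z W and
    Sb below. *)
Lemma fsq_residual_svd (l : nat) (Z : 'M[R]_(m, l)) (W : 'M[R]_(l, k)) :
  Uk^T *m Z *m W = Sk ->
  fsq ((1%:M - colproj Z) *m A) <= fsq Sb + fsq (Ub^T *m Z *m W).
Proof.
move=> h; apply: le_trans (fsq_residual_le Z A (W *m Vk^T)) _.
have [oU oV _ _ _] := svdA.
have [_ _ _ _ eU] := orthomx_blocks km oU.
have [V1 _ V2 _ eV] := orthomx_blocks kn oV.
have [s1 s2 s3 s4] := svd_blocks.
rewrite (fsq_splitL _ eU) (fsq_splitR (_^T *m _) eV) (fsq_splitR ((tl_cols km U)^T *m _) eV).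
rewrite -/Uk -/Ub -/Vk -/Vb !mulmxBr !mulmxBl s1 s2 s3 s4.
have X1 a (B : 'M[R]_(m, a)) : B^T *m (Z *m (W *m Vk^T)) *m Vk = B^T *m Z *m W.
  by rewrite !mulmxA -(mulmxA _ Vk^T) V1 mulmx1.
have X2 a (B : 'M[R]_(m, a)) : B^T *m (Z *m (W *m Vk^T)) *m Vb = 0.
  by rewrite !mulmxA -(mulmxA _ Vk^T) V2 mulmx0.
rewrite !X1 !X2 h subrr !subr0 !fsq0 !add0r -[- _]scaleN1r fsqZ sqrrN expr1n mul1r.
by rewrite addrC.
Qed.

(** If the tail vanished, [A] would factor through [k] columns. *)
Lemma tl_block_neq0 : (k < \rank A)%N -> 0 < fsq Sb.
Proof.
move=> kA; rewrite lt_def fsq_ge0 andbT; apply: contraTneq kA => /fsq_eq0 Sb0.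
have [oU oV _ _ _] := svdA.
have [_ _ _ _ eU] := orthomx_blocks km oU.
have [_ _ _ _ eV] := orthomx_blocks kn oV.
have [s1 s2 s3 s4] := svd_blocks.
have -> : A = Uk *m (Sk *m Vk^T).
  rewrite -[LHS]mul1mx -eU -[LHS]mulmx1 -eV !(mulmxDl, mulmxDr) -/Uk -/Ub -/Vk -/Vb.
  have F (a b : nat) (E : 'M[R]_(m, a)) (E' : 'M[R]_(a, m)) (H : 'M[R]_(n, b))
    (H' : 'M[R]_(b, n)) :
    E *m E' *m A *m (H *m H') = E *m (E' *m A *m H) *m H' by rewrite !mulmxA.
  rewrite !F// s1 s2 s3 s4 Sb0 !mulmx0 !mul0mx !addr0.
  by rewrite mulmxA.
by rewrite -leqNgt (leq_trans (mxrankM_maxl _ _))// rank_leq_col.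
Qed.

(** Since G1^T K^-1 is a right inverse of [G1], Uk^T D G T = X G1 T = Sk. Inserting Q Q^T + N^T N =
    1 between [D] and [G] splits Ub^T D G T: its first part is the tangent term, because Uk^T D D^T
    Uk = X^2. *)
Lemma residual_bound (r r' l : nat) (D : 'M[R]_(m, r)) (Q : 'M[R]_(r, k)) (N : 'M[R]_(r', r))
    (X : 'M[R]_k) (G : 'M[R]_(r, l)) (G1 : 'M[R]_(k, l)) :
  D^T *m Uk = Q *m X -> X^T = X -> X \in unitmx -> Q^T *m Q = 1%:M ->
  Q *m Q^T + N^T *m N = 1%:M -> G1 = Q^T *m G -> G1 *m G1^T \in unitmx ->
  fsq ((1%:M - colproj (D *m G)) *m A) <= fsq Sb +
    fsq (mxtan Uk Ub (D *m D^T *m Uk) *m Sk +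
         Ub^T *m D *m N^T *m (N *m G) *m (G1^T *m invmx (G1 *m G1^T) *m (invmx X *m Sk))).
Proof.
move=> DU Xs Xu QQ QN G1E Ku.
set T := G1^T *m _ *m _.
have UD : Uk^T *m D = X *m Q^T by rewrite -[Uk^T *m D]trmxK trmx_mul trmxK DU trmx_mul Xs.
have G1T : G1 *m T = invmx X *m Sk by rewrite /T !mulmxA mulmxV// mul1mx.
have h : Uk^T *m (D *m G) *m T = Sk.
  by rewrite mulmxA UD -(mulmxA X) -G1E -mulmxA G1T mulmxA mulmxV// mul1mx.
apply: le_trans (fsq_residual_svd h) _; rewrite lerD2l.
have tanE : mxtan Uk Ub (D *m D^T *m Uk) = Ub^T *m D *m Q *m invmx X.
  have E1 : D *m D^T *m Uk = D *m Q *m X by rewrite -mulmxA DU mulmxA.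
  rewrite /mxtan E1 !mulmxA UD -(mulmxA X) QQ mulmx1.
  rewrite (@mpinv_inverse _ _ (invmx X *m invmx X)).
    by rewrite !mulmxA mulmxK.
  by rewrite mulmxA mulmxK// mulmxV.
have -> // : Ub^T *m (D *m G) *m T = mxtan Uk Ub (D *m D^T *m Uk) *m Sk + Ub^T *m D *m N^T *m
  (N *m G) *m T.
rewrite tanE -(mulmxA _ (invmx X)) -G1T G1E.
rewrite -[D in LHS]mulmx1 -QN !(mulmxDr, mulmxDl) !mulmxA.
by [].
Qed.

(** The complement of the projection is N^T N. Compression by [Ub] can only decrease the norm, and
    N^T is an isometry. *)
Lemma tail_coupling_le (r r' : nat) (D : 'M[R]_(m, r)) (Q : 'M[R]_(r, k)) (N : 'M[R]_(r', r))
    (X : 'M[R]_k) :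
  D^T *m Uk = Q *m X -> X \in unitmx -> Q^T *m Q = 1%:M -> N *m N^T = 1%:M ->
  Q *m Q^T + N^T *m N = 1%:M ->
  fsq (Ub^T *m D *m N^T) <= fsq ((1%:M - colproj (D^T *m Uk)) *m D^T).
Proof.
move=> DU Xu QQ NN QN; have [oU _ _ _ _] := svdA.
have [_ b1 _ _ _] := orthomx_blocks km oU.
rewrite DU colproj_iso// -QN addrC addKr -fsq_tr !trmx_mul !trmxK mulmxA.
apply: le_trans (fsq_coisoR _ b1) _.
by rewrite -mulmxA fsq_isoL// trmxK.
Qed.

End svd.

Lemma orthonormal_sum (r k r' : nat) (e : r = (k + r')%N) (Q : 'M[R]_(r, k)) (N : 'M[R]_(r', r)) :
  Q^T *m Q = 1%:M -> N *m N^T = 1%:M -> N *m Q = 0 -> Q *m Q^T + N^T *m N = 1%:M.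
Proof.
subst r => QQ NN NQ.
have QN : Q^T *m N^T = 0 by rewrite -trmx_mul NQ trmx0.
have h : col_mx Q^T N *m (col_mx Q^T N)^T = 1%:M.
  by rewrite tr_col_mx mul_col_row trmxK QQ NN NQ QN -scalar_mx_block.
by have := mulmx1C h; rewrite tr_col_mx trmxK mul_row_col.
Qed.

(** The polar decomposition: the symmetric root [X] is chosen because its inverse is the power -1/2
    that occurs in rho. *)
Lemma orthonormal_factor (r k : nat) (C : 'M[R]_(r, k)) : \rank C = k ->
  exists r', exists (Q : 'M[R]_(r, k)) (N : 'M[R]_(r', r)),
  let X := sqrtmx (C^T *m C) in
  [/\ C = Q *m X, X^T = X, X \in unitmx, Q^T *m Q = 1%:M &
      [/\ N *m N^T = 1%:M, N *m Q = 0 & Q *m Q^T + N^T *m N = 1%:M]].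
Proof.
move=> rC; have kr : (k <= r)%N by rewrite -rC rank_leq_row.
have Cu : C^T *m C \in unitmx.
  by rewrite -[X in _ *m X]trmxK; apply: gram_unit; rewrite /row_free mxrank_tr rC.
have psdC : psdmx (C^T *m C).
  split; first by rewrite trmx_mul trmxK.
  move=> x; have -> : x *m (C^T *m C) *m x^T = (x *m C^T) *m (x *m C^T)^T.
    by rewrite trmx_mul trmxK !mulmxA.
  exact: mulmx_tr_ge0.
have [[Xs _] XX] := sqrtmxP psdC.
set X := sqrtmx _ in Xs XX *.
have Xu : X \in unitmx by move: Cu; rewrite -XX unitmx_mul => /andP[].
pose Q := C *m invmx X.
have QQ : Q^T *m Q = 1%:M.
  rewrite /Q trmx_mul mulmxA -(mulmxA _ C^T) -XX trmx_inv Xs.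
  by rewrite (mulmxA (invmx X)) mulVmx// mul1mx mulmxV.
exists (r - k)%N; have e := subnKC kr.
have [N [NN QN]] := @orthonormal_complement R k r Q^T (r - k) (eq_leq (subnK kr)).
have NQ : N *m Q = 0 by rewrite -[N *m Q]trmxK trmx_mul QN trmx0.
exists Q, N; split => //; first by rewrite mulmxKV.
split => //.
exact: (@orthonormal_sum _ _ _ (esym e) _ _ QQ NN NQ).
Qed.

End projections.

(** * Measurability of matrix functions *)

Lemma measurable_inv (R : realType) : measurable_fun [set: R] (fun x : R => x^-1).
Proof.
have -> : (fun x : R => x^-1) = (fun x => if x == 0 then 0 else x^-1).
  by apply/funext => x; case: eqP => // ->; rewrite invr0.
apply: measurable_fun_if => //.
- exact: measurable_fun_eqr.
- have -> : ([set: R] `&` (fun x : R => x == 0) @^-1` [set false])%classic = [set x : R | x != 0].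
    by apply/seteqP; split => x /=; [case=> _ ->|move=> /negbTE ->].
  apply: open_continuous_measurable_fun.
    exact: open_neq.
  by move=> x; rewrite inE/= => x0; exact: inv_continuous.
Qed.

Lemma cvg_sqr_bound (R : realType) (u : nat -> R) (a c : R) :
  (forall n, (u n - a) ^+ 2 <= c / n.+1%:R) -> u n @[n --> \oo] --> a.
Proof.
move=> h; apply/cvgrPdist_le => e e0.
have c0 : 0 <= c by have := h 0%N; rewrite divr1; apply: le_trans; exact: sqr_ge0.
have ce : 0 <= c / e ^+ 2 by rewrite divr_ge0 ?sqr_ge0.
exists (Num.bound (c / e ^+ 2)) => // n /= Nn.
rewrite distrC -(@ler_pXn2r _ 2)// ?nnegrE ?(ltW e0)// real_normK ?num_real//.
apply: le_trans (h n) _; rewrite ler_pdivrMr// mulrC -ler_pdivrMr ?exprn_gt0//.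
apply: le_trans (ltW (archi_boundP ce)) _.
by rewrite ler_nat (leq_trans Nn).
Qed.

Section matrix_measurability.
Context (R : realType) (d : measure_display) (T : measurableType d).

Definition mx_measurable (p q : nat) (F : T -> 'M[R]_(p, q)) : Prop :=
  forall i j, measurable_fun [set: T] (fun w => F w i j).

Lemma mx_measurable_cst p q (A : 'M[R]_(p, q)) : mx_measurable (fun _ => A).
Proof. by move=> i j; exact: measurable_cst. Qed.

Lemma mx_measurable_tr p q (F : T -> 'M[R]_(p, q)) :
  mx_measurable F -> mx_measurable (fun w => (F w)^T).
Proof. by move=> h i j; under eq_fun do rewrite mxE; exact: h. Qed.

Lemma mx_measurable_add p q (F G : T -> 'M[R]_(p, q)) :
  mx_measurable F -> mx_measurable G -> mx_measurable (fun w => F w + G w).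
Proof. by move=> h g i j; under eq_fun do rewrite mxE; apply: measurable_funD. Qed.

Lemma mx_measurable_sub p q (F G : T -> 'M[R]_(p, q)) :
  mx_measurable F -> mx_measurable G -> mx_measurable (fun w => F w - G w).
Proof. by move=> h g i j; under eq_fun do rewrite !mxE; apply: measurable_funB. Qed.

Lemma mx_measurable_mul p q s (F : T -> 'M[R]_(p, q)) (G : T -> 'M[R]_(q, s)) :
  mx_measurable F -> mx_measurable G -> mx_measurable (fun w => F w *m G w).
Proof.
move=> h g i j; under eq_fun do rewrite mxE.
by apply: measurable_sum => a; apply: measurable_funM.
Qed.

Lemma measurable_det p (F : T -> 'M[R]_p) : mx_measurable F ->
  measurable_fun [set: T] (fun w => \det (F w)).
Proof.
move=> h; rewrite /determinant; apply: measurable_sum => s; apply: measurable_funM => //.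
by apply: measurable_prod => i _; exact: h.
Qed.

Lemma measurable_fun_unitmx p (F : T -> 'M[R]_p) : mx_measurable F ->
  measurable_fun [set: T] (fun w => F w \in unitmx).
Proof.
move=> h.
have -> : (fun w => F w \in unitmx) = (fun w => if \det (F w) == 0 then false else true).
  by apply/funext => w; rewrite unitmxE unitfE; case: eqP.
apply: measurable_fun_ifT => //; apply: measurable_fun_eqr => //; exact: measurable_det.
Qed.

Lemma mx_measurable_inv p (F : T -> 'M[R]_p) : mx_measurable F ->
  mx_measurable (fun w => invmx (F w)).
Proof.
move=> h i j.
(* Cofactor formula; on a singular matrix [invmx] returns the matrix itself. *)
have -> : (fun w => invmx (F w) i j) = (fun w => if F w \in unitmx
    then (\det (F w))^-1 * ((-1) ^+ (j + i) * \det (row' j (col' i (F w)))) else F w i j).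
  by apply/funext => w; rewrite /invmx; case: ifP => // _; rewrite !mxE.
apply: measurable_fun_ifT; [exact: measurable_fun_unitmx| |exact: h].
apply: measurable_funM.
  by apply: (measurableT_comp (@measurable_inv R)); exact: measurable_det.
apply: measurable_funM => //; apply: measurable_det => a b.
by under eq_fun do rewrite !mxE; exact: h.
Qed.

Lemma measurable_fsq p q (F : T -> 'M[R]_(p, q)) : mx_measurable F ->
  measurable_fun [set: T] (fun w => fsq (F w)).
Proof.
move=> h; apply: measurable_sum => i; apply: measurable_sum => j.
by apply: measurable_funX; exact: h.
Qed.

Lemma measurable_frob p q (F : T -> 'M[R]_(p, q)) : mx_measurable F ->
  measurable_fun [set: T] (fun w => frob (F w)).
Proof.
move=> h; apply: (measurableT_comp (continuous_measurable_fun (@sqrt_continuous R))).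
exact: measurable_fsq.
Qed.

(* With W = e (Z^T Z + e)^-1 X for X the pseudo-inverse, the error is Z W, and
   |Z W|^2 + e |W|^2 = e <X, W>. *)
Lemma colproj_regularized p q (Z : 'M[R]_(p, q)) (e : R) : 0 < e ->
  fsq (Z *m invmx (Z^T *m Z + e%:M) *m Z^T - colproj Z) <= fsq (mpinv Z) * e.
Proof.
move=> e0; set J := invmx _; have [x1 x2 x3 x4] := mpinvP Z.
set X := mpinv Z in x1 x2 x3 x4 *.
have uK : Z^T *m Z + e%:M \in unitmx.
  rewrite -row_free_unit -kermx_eq0; apply/eqP/row_matrixP => i; rewrite row0.
  set v := row i _; have : v *m (Z^T *m Z + e%:M) = 0 by apply/sub_kermxP; rewrite row_sub.
  move=> /(congr1 (fun y => (y *m v^T) 0 0)); rewrite mul0mx mulmxDr mulmxDl.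
  rewrite mul_mx_scalar -scalemxAl [LHS]mxE [X in _ + X]mxE [RHS]mxE => h; apply/eqP;
    apply: contraT => v0.
  have := mulmx_tr_gt0 v0; have := mulmx_tr_ge0 (v *m Z^T).
  rewrite trmx_mul trmxK mulmxA -(mulmxA v) => h1 h2.
  have : 0 < e * (v *m v^T) 0 0 by rewrite mulr_gt0.
  lra.
have ZtZX : Z^T *m Z *m X = Z^T by rewrite -mulmxA -x3 -trmx_mul x1.
pose W := e *: (J *m X).
have KW : (Z^T *m Z + e%:M) *m W = e *: X by rewrite -scalemxAr mulmxA mulmxV// mul1mx.
have E : Z *m J *m Z^T - colproj Z = - (Z *m W).
  rewrite -{1}ZtZX -[Z^T *m Z](addrK e%:M) mulmxBl mulmxBr.
  rewrite mulmxA -(mulmxA Z J) mulVmx// mulmx1 -/X /colproj -/X mul_scalar_mx.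
  by rewrite addrC addKr /W -!scalemxAr mulmxA.
have key : fsq (Z *m W) + e * fsq W = e * \tr (X *m W^T).
  have -> : fsq (Z *m W) = \tr (Z^T *m Z *m W *m W^T).
    by rewrite fsqE trmx_mul mulmxA mxtrace_mulC !mulmxA.
  rewrite fsqE -!mxtraceZ -mxtraceD -[e *: (W *m _)]mul_scalar_mx
    (mulmxA e%:M) -mulmxDl -mulmxDl KW.
  by rewrite scalemxAl.
have h := fsqB_ge X W.
rewrite E -scaleN1r fsqZ sqrrN expr1n mul1r.
have X0 := fsq_ge0 X; have W0 := fsq_ge0 W.
have : e * (2 * \tr (X *m W^T)) <= e * (fsq X + fsq W) by apply: ler_wpM2l => //; exact: ltW.
have : 0 <= e * fsq X by rewrite mulr_ge0// ltW.
have : 0 <= e * fsq W by rewrite mulr_ge0// ltW.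
lra.
Qed.

Lemma mx_measurable_colproj p q (F : T -> 'M[R]_(p, q)) : mx_measurable F ->
  mx_measurable (fun w => colproj (F w)).
Proof.
move=> h i j.
apply: (@measurable_fun_cvg _ _ _ _ (fun n w =>
  (F w *m invmx ((F w)^T *m F w + (n.+1%:R^-1)%:M) *m (F w)^T) i j)).
  move=> n; have ht := mx_measurable_tr h.
  apply: (mx_measurable_mul _ ht); apply: (mx_measurable_mul h); apply: mx_measurable_inv.
  by apply: mx_measurable_add; [exact: mx_measurable_mul|exact: mx_measurable_cst].
move=> w _; apply: (@cvg_sqr_bound _ _ _ (fsq (mpinv (F w)))) => n.
have n0 : 0 < n.+1%:R^-1 :> R by rewrite invr_gt0.
apply: le_trans (colproj_regularized (F w) n0).
by have := fsq_entry (F w *m invmx ((F w)^T *m F w + (n.+1%:R^-1)%:M) *m (F w)^T - colproj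
  (F w)) i j; rewrite !mxE.
Qed.

End matrix_measurability.

(** * Linear and bilinear functions of Gaussian arrays *)

Section gauss_combinations.
Context (R : realType) (d : measure_display) (T : measurableType d) (P : probability T R).

(** The orthonormal rows of [o] are completed to a square orthogonal matrix, and the added
    coordinates of the image are dropped. *)
Lemma gauss_array_iso (I J : finType) (o : J -> I -> R) (X : I -> T -> R) :
  (forall i j, \sum_k o i k * o j k = (i == j)%:R) -> gauss_array P X ->
  gauss_array P (fun j w => \sum_k o j k * X k w).
Proof.
move=> oo gX; pose a := #|J|; pose l := #|I|.
pose B : 'M[R]_(a, l) := \matrix_(i, k) o (enum_val i) (enum_val k).
have BB : B *m B^T = 1%:M.
  apply/matrixP => i j; rewrite !mxE.
  transitivity (\sum_k o (enum_val i) k * o (enum_val j) k).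
    rewrite [RHS](reindex (@enum_val I predT)) /=; last by apply: onW_bij; exact: enum_val_bij.
    by apply: eq_bigr => k _; rewrite !mxE.
  by rewrite oo; congr (_%:R); rewrite (inj_eq enum_val_inj).
have al : (a <= l)%N.
  have := mxrankM_maxl B B^T; rewrite BB mxrank1 => h.
  exact: leq_trans h (rank_leq_col _).
have [N [NN BN]] := @orthonormal_complement R a l B (l - a) (eq_leq (subnK al)).
pose Om := col_mx B N.
have OmOm : Om *m Om^T = 1%:M.
  have NB : N *m B^T = 0 by rewrite -[N *m _]trmxK trmx_mul trmxK BN trmx0.
  by rewrite tr_col_mx mul_col_row BB NN BN NB -scalar_mx_block.
have e : (a + (l - a))%N = l := subnKC al.
pose o' (i k : 'I_l) := Om (cast_ord (esym e) i) k.
have oo' : orth_array o'.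
  move=> i j; have /matrixP/(_ (cast_ord (esym e) i) (cast_ord (esym e) j)) := OmOm.
  rewrite !mxE => h; transitivity (\sum_k Om (cast_ord (esym e) i) k * Om^T k (cast_ord
    (esym e) j)).
    by apply: eq_bigr => k _; rewrite [Om^T _ _]mxE.
  by rewrite h (inj_eq (@cast_ord_inj _ _ _)).
have g1 : gauss_array P (fun (k : 'I_l) => X (enum_val k)).
  exact: (gauss_array_inj enum_val_inj gX).
have g2 := gauss_array_lin oo' g1.
pose f (j : J) : 'I_l := cast_ord e (lshift (l - a) (enum_rank j)).
have fi : injective f by move=> x y /cast_ord_inj/lshift_inj/enum_rank_inj.
have := gauss_array_inj fi g2.
suff -> : (fun j => lin_array o' (fun k : 'I_l => X (enum_val k)) (f j)) =
  (fun j w => \sum_k o j k * X k w) by [].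
apply/funext => j; apply/funext => w; rewrite /lin_array.
rewrite [RHS](reindex (@enum_val I predT)) /=; last by apply: onW_bij; exact: enum_val_bij.
apply: eq_bigr => k _; congr (_ * _).
by rewrite /o' /f cast_ordK col_mxEu mxE enum_rankK.
Qed.

(** Normalized coefficients form a single orthonormal row, so the combination is an array indexed by
    [unit]. Zero coefficients, which cannot be normalized, are treated apart. *)
Lemma gauss_comb_law (I : finType) (X : I -> T -> R) (c : I -> R) (h : R -> \bar R) :
  gauss_array P X -> measurable_fun [set: R] h -> (forall x, 0 <= h x)%E ->
  (\int[P]_w h (\sum_i c i * X i w)%R =
   \int[normal_prob 0 1]_x h (Num.sqrt (\sum_i c i ^+ 2) * x)%R)%E.
Proof.
move=> gX mh h0; set s2 := \sum_i c i ^+ 2; set s := Num.sqrt s2.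
have s20 : 0 <= s2 by apply: sumr_ge0 => i _; exact: sqr_ge0.
have mhs : measurable_fun [set: R] (fun x : R => h (s * x)).
  by apply: measurableT_comp => //; exact: measurable_funM.
have [s0|s0] := eqVneq s2 0.
  have c0 i : c i = 0.
    apply/eqP; rewrite -sqrf_eq0 eq_le sqr_ge0 andbT -s0 /s2 (bigD1 i)//= lerDl.
    by apply: sumr_ge0 => k _; exact: sqr_ge0.
  rewrite /s s0 sqrtr0.
  have E w : \sum_i c i * X i w = 0 by apply: big1 => i _; rewrite c0 mul0r.
  under eq_integral do rewrite E.
  under [RHS]eq_integral do rewrite mul0r.
  have -> := @integral_cst _ _ _ P setT measurableT (h 0).
  have -> := @integral_cst _ _ _ (normal_prob (0 : R) 1) setT measurableT (h 0).
  congr (_ * _)%E; rewrite [LHS]probability_setT; apply/esym; exact: probability_setT.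
have sp : 0 < s by rewrite sqrtr_gt0 lt_def s0.
have ss : s ^+ 2 = s2 by rewrite sqr_sqrtr.
have g1 : gauss_array P (fun (_ : unit) w => \sum_i (c i / s) * X i w).
  apply: (gauss_array_iso (o := fun _ i => c i / s)) => // i j.
  have -> : (i == j) = true by case: i; case: j.
  under eq_bigr do rewrite mulrACA -expr2 -invfM -expr2 ss.
  by rewrite -mulr_suml mulfV.
rewrite -(gauss_array_expect g1 tt mhs)//; apply: eq_integral => w _; congr h.
by rewrite mulr_sumr; apply: eq_bigr => i _; rewrite mulrA (mulrC s) divfK// gt_eqF.
Qed.

Lemma gauss_comb_sqr (I : finType) (X : I -> T -> R) (c : I -> R) (z : R) : gauss_array P X ->
  (\int[P]_w ((z + \sum_i c i * X i w) ^+ 2)%:E <= (z ^+ 2 + \sum_i c i ^+ 2)%:E)%E.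
Proof.
move=> gX; rewrite (@gauss_comb_law _ _ c (fun x => ((z + x) ^+ 2)%:E) gX); last 2 first.
- by apply/measurable_EFinP; apply: measurable_funX; exact: measurable_funD.
- by move=> x; rewrite lee_fin sqr_ge0.
apply: le_trans (normal_affine_sqr _ _) _; rewrite sqr_sqrtr//.
by apply: sumr_ge0 => i _; exact: sqr_ge0.
Qed.

Lemma gauss_comb_tail (I : finType) (X : I -> T -> R) (c : I -> R) (a : R) :
  gauss_array P X -> 2 <= a ->
  (\int[P]_w (Num.max ((\sum_i c i * X i w) ^+ 2 - a * \sum_i c i ^+ 2) 0)%:E <=
   ((\sum_i c i ^+ 2) * (2 * expR (- (13 * (a + 2) / 27))))%:E)%E.
Proof.
move=> gX a2; set s2 := \sum_i c i ^+ 2.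
have s20 : 0 <= s2 by apply: sumr_ge0 => i _; exact: sqr_ge0.
have mq (b e : R) : measurable_fun [set: R] (fun x : R => (Num.max ((b * x) ^+ 2 - e) 0)%:E).
  apply/measurable_EFinP; apply: measurable_maxr => //; apply: measurable_funB => //.
  by apply: measurable_funX; exact: measurable_funM.
rewrite (@gauss_comb_law _ _ c (fun x => (Num.max (x ^+ 2 - a * s2) 0)%:E) gX); last 2 first.
- by have := mq 1 (a * s2); under eq_fun do rewrite mul1r.
- by move=> x; rewrite lee_fin le_max lexx orbT.
have -> : (\int[normal_prob 0 1]_x (Num.max ((Num.sqrt s2 * x) ^+ 2 - a * s2) 0)%:E =
   \int[normal_prob 0 1]_x (s2%:E * (Num.max (x ^+ 2 - a) 0)%:E))%E.
  apply: eq_integral => x _; rewrite -EFinM; congr EFin.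
  by rewrite maxr_pMr// mulr0 exprMn sqr_sqrtr//; congr (Num.max _ _); ring.
rewrite ge0_integralZl//=; last 2 first.
- by have := mq 1 a; under eq_fun do rewrite mul1r.
- by move=> x _; rewrite lee_fin le_max lexx orbT.
by rewrite EFinM; apply: lee_wpmul2l; [rewrite lee_fin|exact: normal_tail].
Qed.

Lemma gauss_array_decouple_le (I : finType) (X : I -> T -> R) (J : pred I)
    (H : (I -> R) -> \bar R) (F : T -> \bar R) :
  gauss_array P X -> borel_array H -> (forall x, 0 <= H x)%E ->
  measurable_fun [set: T] F -> (forall w, 0 <= F w)%E ->
  (forall w, \int[P]_w' H (fun i => if J i then X i w else X i w') <= F w)%E ->
  (\int[P]_w H (X ^~ w) <= \int[P]_w F w)%E.
Proof.
move=> gX bH H0 mF F0 h; rewrite (gauss_array_decouple gX J bH H0).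
apply: ge0_le_integral => //.
- by move=> w _; exact: integral_ge0.
- pose f (z : T * T) := H (fun i => if J i then X i z.1 else X i z.2).
  apply: (@measurable_fun_fubini_tonelli_F _ _ _ _ _ P f) => //.
  apply: (bH _ _ (fun i (z : T * T) => if J i then X i z.1 else X i z.2)).
  by have [] := gauss_array_prod gX J.
  by move=> z; exact: H0.
Qed.

End gauss_combinations.

(** * Inverse moments through Laplace transforms *)

Section inverse_moment.
Context (R : realType) (d : measure_display) (T : measurableType d) (P : probability T R).
Local Notation mu := lebesgue_measure.

Lemma integral_prob_cst (c : \bar R) : (\int[P]_w c = c)%E.
Proof.
have -> := @integral_cst _ _ _ P setT measurableT c.
by rewrite -[RHS]mule1; congr (_ * _)%E; exact: probability_setT.
Qed.

Definition arr_mx (p q : nat) (x : 'I_p * 'I_q -> R) : 'M[R]_(p, q) := \matrix_(i, j) x (i, j).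

Definition borel_mx (p q : nat) (h : 'M[R]_(p, q) -> R) : Prop :=
  forall (d : measure_display) (T : measurableType d) (F : T -> 'M[R]_(p, q)),
    mx_measurable F -> measurable_fun [set: T] (fun w => h (F w)).

Lemma borel_mx_array p q (h : 'M[R]_(p, q) -> R) :
  borel_mx h -> borel_array (fun x => (h (arr_mx x))%:E).
Proof.
move=> bh d' T' X mX; apply/measurable_EFinP; apply: bh => i j.
by under eq_fun do rewrite mxE; exact: mX.
Qed.

Let D : set (measurableTypeR R) := `[0%R, +oo[%classic.

Let mD : measurable D. Proof. exact: measurable_itv. Qed.

(** The integrand of [gint], extended by zero to the whole line and taken jointly in the sample
    point and z, as Tonelli's theorem requires. *)
Definition gint_fun (m : nat) (b : T -> R) (u : T * measurableTypeR R) : \bar R :=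
  (\1_D u.2 * (u.2 ^+ m * expR (- (b u.1 * u.2 ^+ 2 / 2))))%:E.

Lemma gint_fun_ge0 m b u : (0 <= gint_fun m b u)%E.
Proof.
rewrite lee_fin indicE; case: (boolP (u.2 \in D)) => [|_]; last by rewrite mul0r.
move=> /set_mem; rewrite /D /= in_itv/= andbT => u0.
by rewrite mul1r mulr_ge0 ?expR_ge0 ?exprn_ge0.
Qed.

Lemma measurable_gint_fun m b : measurable_fun [set: T] b ->
  measurable_fun [set: T * measurableTypeR R] (gint_fun m b).
Proof.
move=> mb.
have m2 : measurable_fun [set: T * measurableTypeR R] (fun u => u.2 : R) by exact: measurable_snd.
apply/measurable_EFinP; apply: measurable_funM.
  by apply: (measurableT_comp (measurable_indic mD)); exact: measurable_snd.
apply: measurable_funM; first exact: measurable_funX.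
apply: (measurableT_comp (@measurable_expR R)); apply: measurableT_comp => //.
apply: measurable_funM => //; apply: measurable_funM; last exact: measurable_funX.
by apply: (measurableT_comp mb); exact: measurable_fst.
Qed.

Lemma gint_funE m b w : gint m (b w) = (\int[mu]_z gint_fun m b (w, z))%E.
Proof.
rewrite /gint integral_mkcond; apply: eq_integral => z _; rewrite /gint_fun /patch indicE /=.
by rewrite -/D; case: ifP => _; rewrite ?mul1r ?mul0r.
Qed.

Lemma measurable_gint m (b : T -> R) : measurable_fun [set: T] b ->
  measurable_fun [set: T] (fun w => gint m (b w)).
Proof.
move=> mb; rewrite (funext (gint_funE m b)).
apply: (@measurable_fun_fubini_tonelli_F _ _ _ _ _ mu (gint_fun m b)).
  exact: measurable_gint_fun.
exact: gint_fun_ge0.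
Qed.

(* Tonelli: the Laplace transform of a chi-square variable with j degrees of
   freedom is a power of rad. *)
Lemma gint_chi2 (j m : nat) (Y : 'I_j -> T -> R) : gauss_array P Y ->
  (\int[P]_w gint m (\sum_i Y i w ^+ 2) = rint R m j)%E.
Proof.
move=> gY; have [mY _] := gY; pose b w := \sum_i Y i w ^+ 2.
have mb : measurable_fun [set: T] b.
  by apply: measurable_sum => i; apply: measurable_funX; exact: mY.
under eq_integral do rewrite (gint_funE m b).
rewrite (@fubini_tonelli _ _ _ _ R P mu _ (measurable_gint_fun m mb) (gint_fun_ge0 m b)).
rewrite /rint [RHS]integral_mkcond.
apply: eq_integral => z _; rewrite /patch -/D.
transitivity (\int[P]_w ((\1_D z * z ^+ m)%:E * (\prod_(i <- index_enum 'I_j) expR (-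
  (z ^+ 2 * Y i w ^+ 2 / 2)))%:E))%E.
  apply: eq_integral => w _; rewrite -EFinM /gint_fun /= mulrA; congr (_ * _)%:E.
  rewrite -expR_sum; congr expR; rewrite -mulrA mulr_suml -sumrN; apply: eq_bigr => i _; ring.
have mg : measurable_fun [set: R] (fun x : R => expR (- (z ^+ 2 * x ^+ 2 / 2))).
  by apply: continuous_measurable_fun; exact: continuous_gauss.
rewrite ge0_integralZl//=; last 3 first.
- by apply/measurable_EFinP; apply: measurable_prod => i _; exact: (measurableT_comp mg (mY i)).
- by move=> w _; rewrite lee_fin prodr_ge0// => i _; exact: expR_ge0.
- rewrite lee_fin indicE; case: (boolP (z \in D)) => [|_]; last by rewrite mul0r.
  by move=> /set_mem; rewrite /D /= in_itv/= andbT => u0; rewrite mul1r exprn_ge0.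
rewrite (gauss_array_expect_prod gY (index_enum_uniq _) mg _ (normal_laplace z)); last first.
  by move=> x; exact: expR_ge0.
have -> : size (index_enum 'I_j) = j by rewrite /index_enum unlock -enumT size_enum_ord.
rewrite -EFinM indicE.
by case: ifP => _; rewrite ?mul1r ?mul0r.
Qed.

(* Conditionally on the other rows, row 0 times N^T is a standard Gaussian vector
   for any orthonormal N orthogonal to them, and xi <= 1 / |row 0 * N^T|^2. *)
Lemma inverse_moment (k l m j : nat) (X : 'I_k.+1 * 'I_l -> T -> R) (xi : 'M[R]_(k.+1, l) -> R) :
  gauss_array P X -> (j + k <= l)%N -> borel_mx xi -> (forall G, 0 <= xi G) ->
  (forall G (N : 'M[R]_(j, l)), N *m N^T = 1%:M -> row' ord0 G *m N^T = 0 ->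
     xi G * fsq (row ord0 G *m N^T) <= 1) ->
  (\int[P]_w (gconst R m * Num.sqrt (xi (arr_mx (X ^~ w))) ^+ m.+1)%:E <= rint R m j)%E.
Proof.
move=> gX jkl bxi xi0 hxi; have gc := gconst_gt0 R m; have [mX _] := gX.
have rint0 : (0 <= rint R m j)%E.
  apply: integral_ge0 => z; rewrite /= in_itv/= andbT => z0.
  by rewrite lee_fin mulr_ge0 ?exprn_ge0// ltW// rad_gt0.
apply: (@le_trans _ _ (\int[P]_w (cst (rint R m j) w))%E); last first.
  by rewrite integral_prob_cst.
pose H (x : 'I_k.+1 * 'I_l -> R) := (gconst R m * Num.sqrt (xi (arr_mx x)) ^+ m.+1)%:E.
have bH : borel_array H.
  apply: (@borel_mx_array _ _ (fun G => gconst R m * Num.sqrt (xi G) ^+ m.+1)) => d' T' F mF.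
  apply: measurable_funM => //; apply: measurable_funX.
  by apply: (measurableT_comp (continuous_measurable_fun (@sqrt_continuous R))); exact: bxi.
apply: (@gauss_array_decouple_le _ _ _ P _ X (fun ib => ib.1 != ord0) H) => //.
- by move=> x; rewrite lee_fin mulr_ge0 ?(ltW gc)// exprn_ge0// sqrtr_ge0.
- move=> w.
  pose B : 'M[R]_(k, l) := \matrix_(i, b) X (lift ord0 i, b) w.
  have [N [NN BN]] := @orthonormal_complement R k l B j jkl.
  pose Y (i : 'I_j) w' := \sum_b N i b * X (ord0, b) w'.
  have gY : gauss_array P Y.
    apply: (gauss_array_iso (o := fun i b => N i b) (X := fun b => X (ord0, b))).
      move=> i i'; have /matrixP/(_ i i') := NN; rewrite !mxE => <-.
      by apply: eq_bigr => b _; rewrite mxE.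
    by apply: (gauss_array_inj (f := fun b => (ord0, b))) gX => b b' [].
  rewrite -(gint_chi2 m gY); apply: ge0_le_integral => //.
  + by move=> w' _; rewrite lee_fin mulr_ge0 ?(ltW gc)// exprn_ge0// sqrtr_ge0.
  + apply: (bH _ _ (fun i w' => if i.1 != ord0 then X i w else X i w')) => i.
    by case: (i.1 != ord0) => //; exact: mX.
  + by apply: measurable_gint; apply: measurable_sum => i; apply: measurable_funX;
    have [mY _] := gY; exact: mY.
  + move=> w' _; rewrite /H; set G := arr_mx _.
    have GB : row' ord0 G = B by apply/matrixP => i b; rewrite !mxE /= .
    have GN : fsq (row ord0 G *m N^T) = \sum_i Y i w' ^+ 2.
      rewrite /fsq big_ord1; apply: eq_bigr => i _; rewrite mxE; congr (_ ^+ 2).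
      by apply: eq_bigr => b _; rewrite !mxE /= mulrC.
    apply: gint_ge; first exact: sqrtr_ge0.
      by apply: sumr_ge0 => i _; exact: sqr_ge0.
    rewrite sqr_sqrtr// -GN; apply: hxi => //.
    by rewrite GB.
Qed.

End inverse_moment.

(** * Inverse moments of Gaussian Gram matrices *)

Section gram_matrix.
Context (R : realType).

Definition gram (k l : nat) (G : 'M[R]_(k, l)) : 'M[R]_k := G *m G^T.

Lemma gram_sym k l (G : 'M[R]_(k, l)) : (gram G)^T = gram G.
Proof. by rewrite trmx_mul trmxK. Qed.

Lemma gram_kernel k l (G : 'M[R]_(k, l)) (v : 'rV[R]_k) : v *m gram G = 0 -> v *m G = 0.
Proof.
move=> h; apply: fsq_eq0; rewrite fsqE trmx_mul mulmxA -(mulmxA v) -/(gram G) h mul0mx.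
exact: mxtrace0.
Qed.

Lemma gram_singular k l (G : 'M[R]_(k, l)) : gram G \notin unitmx ->
  exists2 v : 'rV[R]_k, v != 0 & v *m gram G = 0.
Proof.
rewrite -row_free_unit -kermx_eq0 => /rowV0Pn[v vk v0]; exists v => //.
exact/sub_kermxP.
Qed.

Lemma mul_row_split k l (v : 'rV[R]_k.+1) (G : 'M[R]_(k.+1, l)) :
  v *m G = v 0 0 *: row ord0 G + (\row_i v 0 (lift ord0 i)) *m row' ord0 G.
Proof.
apply/rowP => j; rewrite !mxE big_ord_recl; congr (_ + _).
by apply: eq_bigr => i _; rewrite !mxE.
Qed.

(** A linear relation between the rows must involve row 0, the others being independent; so row 0
    lies in their span, which N^T annihilates. *)
Lemma gram_singular_row k l j (G : 'M[R]_(k.+1, l)) (N : 'M[R]_(j, l)) :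
  gram G \notin unitmx -> gram (row' ord0 G) \in unitmx ->
  row' ord0 G *m N^T = 0 -> row ord0 G *m N^T = 0.
Proof.
move=> sG uG' GN; have [v v0 /gram_kernel vG] := gram_singular sG.
pose v' := \row_i v 0 (lift ord0 i) : 'rV[R]_k.
move: vG; rewrite mul_row_split -/v' => vG.
have [v00|v00] := eqVneq (v 0 0) 0.
  move: vG; rewrite v00 scale0r add0r => vG'.
  have : v' *m gram (row' ord0 G) = 0 by rewrite mulmxA vG' mul0mx.
  move=> /(congr1 (mulmx^~ (invmx (gram (row' ord0 G))))).
  rewrite mulmxK// mul0mx => v'0; case/eqP: v0; apply/rowP => i; rewrite mxE.
  case: (unliftP ord0 i) => [i' ->|->//].
  by move/rowP: v'0 => /(_ i'); rewrite !mxE.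
move: vG => /(congr1 (mulmx^~ N^T)); rewrite mulmxDl -mulmxA GN mulmx0 addr0 mul0mx -scalemxAl.
by move/eqP; rewrite scaler_eq0 (negbTE v00) => /eqP.
Qed.

(** The form u K^-1 u^T; the value 0 on singular K keeps it nonnegative and Borel everywhere. *)
Definition qinv (k l : nat) (u : 'rV[R]_k) (G : 'M[R]_(k, l)) : R :=
  if gram G \in unitmx then (u *m invmx (gram G) *m u^T) 0 0 else 0.

Lemma invmx_gram_sym k l (G : 'M[R]_(k, l)) : (invmx (gram G))^T = invmx (gram G).
Proof. by rewrite trmx_inv gram_sym. Qed.

Lemma qinvE k l (u : 'rV[R]_k) (G : 'M[R]_(k, l)) : gram G \in unitmx ->
  qinv u G = fsq (u *m invmx (gram G) *m G).
Proof.
move=> uG; rewrite /qinv uG fsqE !trmx_mul invmx_gram_sym -!mulmxA (mulmxA G) -/(gram G).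
by rewrite (mulmxA (gram G)) mulmxV// mul1mx !mulmxA [in RHS]/mxtrace big_ord1.
Qed.

Lemma qinv_ge0 k l (u : 'rV[R]_k) (G : 'M[R]_(k, l)) : 0 <= qinv u G.
Proof.
have [h|h] := boolP (gram G \in unitmx); first by rewrite qinvE// fsq_ge0.
by rewrite /qinv (negbTE h).
Qed.

Lemma mx_measurable_gram (d : measure_display) (T : measurableType d) k l
  (F : T -> 'M[R]_(k, l)) :
  mx_measurable F -> mx_measurable (fun w => gram (F w)).
Proof. by move=> h; apply: mx_measurable_mul => //; exact: mx_measurable_tr. Qed.

Lemma borel_qinv k l (u : 'rV[R]_k) : borel_mx (@qinv k l u).
Proof.
move=> d T F mF; have mK := mx_measurable_gram mF.
apply: measurable_fun_ifT => //; first exact: measurable_fun_unitmx.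
suff h : mx_measurable (fun w => u *m invmx (gram (F w)) *m u^T) by exact: h.
apply: mx_measurable_mul; last exact: mx_measurable_cst.
by apply: mx_measurable_mul; [exact: mx_measurable_cst|exact: mx_measurable_inv].
Qed.

(** Let v be the first row of K^-1 and x its first entry, so that |v G|^2 = x. Since N^T annihilates
    the other rows, v G N^T is x times row 0 times N^T; hence x^2 |row 0 N^T|^2 <= x. *)
Lemma qinv_row_le k l j (G : 'M[R]_(k.+1, l)) (N : 'M[R]_(j, l)) :
  N *m N^T = 1%:M -> row' ord0 G *m N^T = 0 ->
  qinv (delta_mx 0 ord0) G * fsq (row ord0 G *m N^T) <= 1.
Proof.
move=> NN GN; have [h|h] := boolP (gram G \in unitmx); last first.
  by rewrite /qinv (negbTE h) mul0r.
set x := qinv _ _; pose v := delta_mx 0 ord0 *m invmx (gram G) : 'rV[R]_k.+1.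
have vx : v 0 0 = x.
  by rewrite /x /qinv h -/v trmx_delta -colE [RHS]mxE.
have xE : x = fsq (v *m G) by exact: qinvE.
have E : v *m G *m N^T = x *: (row ord0 G *m N^T).
  by rewrite mul_row_split mulmxDl -mulmxA GN mulmx0 addr0 vx scalemxAl.
have le : x ^+ 2 * fsq (row ord0 G *m N^T) <= x.
  by rewrite -fsqZ -E [leRHS]xE; apply: fsq_coisoR; rewrite trmxK.
have x0 : 0 <= x by exact: qinv_ge0.
have [xz|xz] := eqVneq x 0; first by rewrite xz mul0r.
have xp : 0 < x by rewrite lt_def xz.
by rewrite -(ler_pM2l xp) mulr1 mulrA -expr2.
Qed.

Lemma qinv_rot k l (u : 'rV[R]_k) (G : 'M[R]_(k, l)) (Om : 'M[R]_k) : Om *m Om^T = 1%:M ->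
  qinv u (Om *m G) = qinv (u *m Om) G.
Proof.
move=> OO; have OO' := mulmx1C OO.
have uO : Om \in unitmx by case: (mulmx1_unit OO).
have uOt : Om^T \in unitmx by rewrite unitmx_tr.
have E : gram (Om *m G) = Om *m gram G *m Om^T by rewrite /gram trmx_mul !mulmxA.
rewrite /qinv E !unitmx_mul uO uOt andbT /=; case: ifP => //.
move: (gram G) => K uG.
have -> : invmx (Om *m K *m Om^T) = Om *m invmx K *m Om^T.
  have h : Om *m K *m Om^T *m (Om *m invmx K *m Om^T) = 1%:M.
    by rewrite -!mulmxA (mulmxA Om^T) OO' mul1mx (mulmxA K) mulmxV// mul1mx OO.
  have uE : Om *m K *m Om^T \in unitmx by rewrite !unitmx_mul uO uG.
  by rewrite -[LHS]mulmx1 -h [LHS]mulmxA mulVmx// mul1mx.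
by rewrite trmx_mul !mulmxA.
Qed.

End gram_matrix.

Section gram_moments.
Context (R : realType) (d : measure_display) (T : measurableType d) (P : probability T R).

Lemma gauss_array_rows p q l (Om : 'M[R]_(p, q)) (X : 'I_q * 'I_l -> T -> R) :
  Om *m Om^T = 1%:M -> gauss_array P X ->
  gauss_array P (fun (ib : 'I_p * 'I_l) w => (Om *m arr_mx (X ^~ w)) ib.1 ib.2).
Proof.
move=> OO gX; pose o (ib : 'I_p * 'I_l) (ab : 'I_q * 'I_l) := Om ib.1 ab.1 * (ib.2 == ab.2)%:R.
have -> : (fun (ib : 'I_p * 'I_l) w => (Om *m arr_mx (X ^~ w)) ib.1 ib.2) =
    (fun ib w => \sum_ab o ib ab * X ab w).
  apply/funext => -[i b]; apply/funext => w; rewrite mxE /=.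
  transitivity (\sum_a \sum_b' o (i, b) (a, b') * X (a, b') w); last first.
    by rewrite pair_bigA; apply: eq_bigr => -[].
  apply: eq_bigr => a _; rewrite (bigD1 b)//= big1 ?addr0; first by rewrite /o /= eqxx mulr1 mxE.
  by move=> b' bb; rewrite /o /= eq_sym (negbTE bb) mulr0 mul0r.
apply: gauss_array_iso => // -[i b] [i' b'].
transitivity (\sum_a \sum_b1 o (i, b) (a, b1) * o (i', b') (a, b1)).
  by rewrite pair_bigA; apply: eq_bigr => -[].
transitivity (\sum_a Om i a * Om^T a i' * (b == b')%:R).
  apply: eq_bigr => a _; rewrite (bigD1 b)//= big1 ?addr0.
    by rewrite /o /= eqxx mulr1 mulrA (eq_sym b') mxE.
  by move=> b1 bb; rewrite /o /= [b == b1]eq_sym (negbTE bb) mulr0 mul0r.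
rewrite -mulr_suml; have /matrixP/(_ i i') := OO; rewrite [LHS]mxE => ->.
by rewrite mxE -natrM mulnb.
Qed.

Lemma gauss_array_mx k l (X : 'I_k * 'I_l -> T -> R) : gauss_array P X ->
  mx_measurable (fun w => arr_mx (X ^~ w)).
Proof. by move=> [mX _] i j; under eq_fun do rewrite mxE; exact: mX. Qed.

(* On the event that row 0 depends on the other, independent, rows its projection
   off their span vanishes, so [inverse_moment] applies to any constant xi there. *)
Lemma gram_singular_null k l (X : 'I_k * 'I_l -> T -> R) : gauss_array P X -> (k + 2 <= l)%N ->
  P [set w | gram (arr_mx (X ^~ w)) \notin unitmx] = 0%E.
Proof.
elim: k X => [|k IH] X gX kl.
  rewrite (_ : [set w | _] = set0) ?measure0//; apply/seteqP; split => w //=.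
  by rewrite unitmxE det_mx00 unitr1.
pose X' (ib : 'I_k * 'I_l) := X (lift ord0 ib.1, ib.2).
have gX' : gauss_array P X'.
  by apply: (gauss_array_inj (f := fun ib => (lift ord0 ib.1, ib.2))) gX => -[a b] [a' b'] e;
    have /= /lift_inj -> := congr1 fst e; have /= -> := congr1 snd e.
have null' := IH X' gX' (ltnW kl).
have rowE w : row' ord0 (arr_mx (X ^~ w)) = arr_mx (X' ^~ w).
  by apply/matrixP => i j; rewrite !mxE.
have mset h l' (F : T -> 'M[R]_(h, l')) : mx_measurable F ->
    measurable [set w | gram (F w) \in unitmx].
  move=> mF; have mb := measurable_fun_unitmx (mx_measurable_gram mF).
  have := mb measurableT [set true] I; rewrite setTI.
  by congr (measurable _); apply/seteqP; split => w /=.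
pose bad (G : 'M[R]_(k.+1, l)) := (gram G \notin unitmx) && (gram (row' ord0 G) \in unitmx).
pose E := [set w | bad (arr_mx (X ^~ w))].
have mE : measurable E.
  rewrite (_ : E = ~` [set w | gram (arr_mx (X ^~ w)) \in unitmx] `&` [set w | gram (arr_mx
    (X' ^~ w)) \in unitmx]).
    apply: measurableI; last by apply: mset; exact: gauss_array_mx.
    by apply: measurableC; apply: mset; exact: gauss_array_mx.
  apply/seteqP; split => w; rewrite /E /bad /= rowE; first by move=> /andP[/negP].
  by move=> [/negP h ->]; rewrite h.
have bound (c : R) : 0 <= c -> (c%:E * P E <= 1)%E.
  move=> c0; pose xi (G : 'M[R]_(k.+1, l)) :=
    if gram (row' ord0 G) \in unitmx then if gram G \in unitmx then 0 else c else 0.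
  have xiE w : xi (arr_mx (X ^~ w)) = c * \1_E w.
    have -> : \1_E w = (bad (arr_mx (X ^~ w)))%:R :> R.
      by rewrite indicE; congr (nat_of_bool _)%:R; apply/idP/idP; rewrite inE.
    by rewrite /xi /bad; case: (gram _ \in _); case: (gram _ \in _); rewrite /= ?mulr0 ?mulr1.
  have bxi : borel_mx xi.
    move=> d' T' F mF; apply: measurable_fun_ifT => //.
      apply: measurable_fun_unitmx; apply: mx_measurable_gram => i j.
      by under eq_fun do rewrite mxE; exact: mF.
    by apply: measurable_fun_ifT => //; exact: measurable_fun_unitmx (mx_measurable_gram mF).
  have xi0 G : 0 <= xi G by rewrite /xi; case: ifP => // _; case: ifP.
  have lk : (l - k + k <= l)%N by rewrite subnK//; lia.
  have := @inverse_moment R d T P k l 1 (l - k) X xi gX lk bxi xi0.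
  (* The hypothesis on [l] leaves at least three degrees of freedom, as many as a finite first
     inverse moment demands. *)
  have -> : (l - k = (l - k - 3).+3)%N by lia.
  move=> h; have {h} : (\int[P]_w (gconst R 1 * Num.sqrt (xi (arr_mx (X ^~ w))) ^+ 2)%:E <= 1)%E.
    apply: (le_trans (h _)) => [G N NN GN|].
      rewrite /xi; case: ifP => [h1|]; last by rewrite mul0r.
      case: ifPn => [|h2]; first by rewrite mul0r.
      by rewrite (gram_singular_row h2 h1 GN) fsq0 mulr0.
    apply: (le_trans (rint1 _ _)); rewrite lee_fin invf_le1//.
    by rewrite ler1n.
  have -> : (\int[P]_w (gconst R 1 * Num.sqrt (xi (arr_mx (X ^~ w))) ^+ 2)%:E =
      \int[P]_w (c%:E * (\1_E w)%:E))%E.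
    by apply: eq_integral => w _; rewrite sqr_sqrtr// xiE -EFinM /= mul1r.
  rewrite ge0_integralZl//=; last first.
    by apply/measurable_EFinP; exact: measurable_indic.
  by rewrite integral_indic// setIT.
have PE : P E = 0%E.
  have fE : P E \is a fin_num by exact: fin_num_measure.
  have p0 : (0 <= P E)%E by exact: measure_ge0.
  move: p0 bound fE; case: (P E) => // p; rewrite lee_fin => p0 bound _.
  congr EFin; apply/eqP; rewrite eq_le p0 andbT leNgt; apply/negP => pp.
  have := bound (2 / p) (divr_ge0 (ler0n _ _) p0); rewrite -EFinM lee_fin.
  by rewrite divfK ?gt_eqF//; lra.
apply/eqP; rewrite eq_le measure_ge0 andbT.
apply: (@le_trans _ _ (P ([set w | gram (arr_mx (X' ^~ w)) \notin unitmx] `|` E))).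
  apply: le_measure; rewrite ?inE.
  - rewrite (_ : [set w | _] = ~` [set w | gram (arr_mx (X ^~ w)) \in unitmx]).
      by apply: measurableC; apply: mset; exact: gauss_array_mx.
    by apply/seteqP; split => w /= /negP.
  - apply: measurableU => //; rewrite (_ : [set w | _] =
    ~` [set w | gram (arr_mx (X' ^~ w)) \in unitmx]).
      by apply: measurableC; apply: mset; exact: gauss_array_mx.
    by apply/seteqP; split => w /= /negP.
  - move=> w /= h; have [h'|h'] := boolP (gram (arr_mx (X' ^~ w)) \in unitmx); [right|by left].
    by rewrite /E /bad /= h rowE.
apply: (@le_trans _ _ (P [set w | gram (arr_mx (X' ^~ w)) \notin unitmx] + P E)%E).
  apply: measureU2 => //; rewrite (_ : [set w | _] =
    ~` [set w | gram (arr_mx (X' ^~ w)) \in unitmx]).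
    by apply: measurableC; apply: mset; exact: gauss_array_mx.
  by apply/seteqP; split => w /= /negP.
by rewrite null' PE adde0.
Qed.

(** The convex function s^((m+2)/2) of s = b^2 lies above its tangent at a^2. In steps of two no
    real powers occur, and each step gains (m+2)/2 a^m (b^2 - a^2)^2. *)
Lemma power_tangent (a b : R) (m : nat) : 0 <= a -> 0 <= b ->
  a ^+ m.+2 + m.+2%:R / 2 * a ^+ m * (b ^+ 2 - a ^+ 2) <= b ^+ m.+2.
Proof.
move=> a0 b0; elim/nat_ind2: m => [||m IH].
- by rewrite expr0 divff// !mul1r addrC subrK.
- have : 0 <= (b - a) ^+ 2 * (b + a / 2) by rewrite mulr_ge0 ?sqr_ge0// addr_ge0// divr_ge0.
  rewrite !exprS expr0; lra.
- have h : b ^+ 2 * (a ^+ m.+2 + m.+2%:R / 2 * a ^+ m * (b ^+ 2 - a ^+ 2)) <= b ^+ m.+4.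
    rewrite [leRHS](_ : _ = b ^+ 2 * b ^+ m.+2); last by rewrite -exprD.
    by apply: ler_wpM2l => //; exact: sqr_ge0.
  apply: le_trans h; rewrite -subr_ge0.
  have -> : b ^+ 2 * (a ^+ m.+2 + m.+2%:R / 2 * a ^+ m * (b ^+ 2 - a ^+ 2)) -
      (a ^+ m.+4 + m.+4%:R / 2 * a ^+ m.+2 * (b ^+ 2 - a ^+ 2)) =
      m.+2%:R / 2 * a ^+ m * (b ^+ 2 - a ^+ 2) ^+ 2.
    by rewrite -(natr1 m.+3) -(natr1 m.+2) !exprS; field.
  apply: mulr_ge0 (sqr_ge0 _); apply: mulr_ge0 (exprn_ge0 _ a0).
  by apply: divr_ge0.
Qed.

Lemma sqrt_power_jensen (I : finType) (lam x : I -> R) (m : nat) :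
  (forall i, 0 <= lam i) -> \sum_i lam i = 1 -> (forall i, 0 <= x i) ->
  Num.sqrt (\sum_i lam i * x i) ^+ m.+2 <= \sum_i lam i * Num.sqrt (x i) ^+ m.+2.
Proof.
move=> l0 l1 x0; set a := Num.sqrt _.
have s0 : 0 <= \sum_i lam i * x i by apply: sumr_ge0 => i _; exact: mulr_ge0.
have a2 : a ^+ 2 = \sum_i lam i * x i by rewrite sqr_sqrtr.
have a0 : 0 <= a by exact: sqrtr_ge0.
apply: (@le_trans _ _ (\sum_i lam i * (a ^+ m.+2 + m.+2%:R / 2 * a ^+ m * (Num.sqrt
  (x i) ^+ 2 - a ^+ 2)))).
  rewrite (eq_bigr (fun i => lam i * (a ^+ m.+2 - m.+2%:R / 2 * a ^+ m * a ^+ 2) +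
    (m.+2%:R / 2 * a ^+ m) * (lam i * x i))).
    by rewrite big_split/= -mulr_suml l1 -mulr_sumr -a2 mul1r subrK.
  by move=> i _; rewrite sqr_sqrtr//; ring.
by apply: ler_sum => i _; apply: ler_wpM2l => //; apply: power_tangent => //; exact: sqrtr_ge0.
Qed.

Lemma qinvZ k l (a : R) (u : 'rV[R]_k) (G : 'M[R]_(k, l)) : qinv (a *: u) G = a ^+ 2 * qinv u G.
Proof.
rewrite /qinv; case: ifP => _; last by rewrite mulr0.
by rewrite linearZ/= -!scalemxAl -!scalemxAr scalerA mxE expr2.
Qed.

(** The quantity |T|^2, set to 0 where the Gram matrix is singular. *)
Definition tsq (k s l : nat) (M : 'M[R]_(k, s)) (G : 'M[R]_(k, l)) : R :=
  if gram G \in unitmx then fsq (G^T *m invmx (gram G) *m M) else 0.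

Lemma fsq_rows p q (A : 'M[R]_(p, q)) : fsq A = \sum_i fsq (row i A).
Proof.
apply: eq_bigr => i _; rewrite /fsq big_ord1; apply: eq_bigr => j _; by rewrite mxE.
Qed.

Lemma tsqE k s l (M : 'M[R]_(k, s)) (G : 'M[R]_(k, l)) :
  tsq M G = \sum_j qinv (row j M^T) G.
Proof.
rewrite /tsq; have [h|h] := boolP (gram G \in unitmx); last first.
  by rewrite big1// => j _; rewrite /qinv (negbTE h).
rewrite -fsq_tr !trmx_mul trmxK invmx_gram_sym fsq_rows; apply: eq_bigr => j _.
by rewrite qinvE// -!row_mul !mulmxA.
Qed.

Lemma tsq_ge0 k s l (M : 'M[R]_(k, s)) (G : 'M[R]_(k, l)) : 0 <= tsq M G.
Proof. by rewrite /tsq; case: ifP => // _; exact: fsq_ge0. Qed.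

Lemma borel_tsq k s l (M : 'M[R]_(k, s)) : borel_mx (@tsq k s l M).
Proof.
move=> d' T' F mF; under eq_fun do rewrite tsqE.
by apply: measurable_sum => j; exact: borel_qinv.
Qed.

(** The matrix has [k.+1] rows here, so [l - k] is the number of columns minus that of rows, plus
    one. *)
Lemma qinv_moment k l m (u : 'rV[R]_k.+1) (X : 'I_k.+1 * 'I_l -> T -> R) :
  u *m u^T = 1%:M -> gauss_array P X -> (k <= l)%N ->
  (\int[P]_w (gconst R m * Num.sqrt (qinv u (arr_mx (X ^~ w))) ^+ m.+1)%:E <= rint R m (l - k))%E.
Proof.
move=> uu gX kl; have [N [NN uN]] := @orthonormal_complement R 1 k.+1 u k (eq_leq (addn1 k)).
pose Om : 'M[R]_k.+1 := col_mx u N.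
have OO : Om *m Om^T = 1%:M.
  have Nu : N *m u^T = 0 by rewrite -[N *m _]trmxK trmx_mul trmxK uN trmx0.
  have h : col_mx u N *m (col_mx u N)^T = 1%:M.
    by rewrite tr_col_mx mul_col_row uu NN uN Nu -scalar_mx_block.
  exact: h.
have gX' := gauss_array_rows OO gX.
have lk : (l - k + k <= l)%N by rewrite subnK.
have := @inverse_moment R d T P k l m (l - k) _ (qinv (delta_mx 0 ord0)) gX' lk
  (@borel_qinv R _ _ _) (@qinv_ge0 R _ _ _) (fun G N => @qinv_row_le R k l (l - k) G N).
have E w : qinv (delta_mx 0 ord0) (arr_mx (fun ib : 'I_k.+1 * 'I_l => (Om *m arr_mx
  (X ^~ w)) ib.1 ib.2)) =
    qinv u (arr_mx (X ^~ w)).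
  have -> : arr_mx (fun ib : 'I_k.+1 * 'I_l => (Om *m arr_mx (X ^~ w)) ib.1 ib.2) =
    Om *m arr_mx (X ^~ w).
    by apply/matrixP => i j; rewrite mxE.
  rewrite qinv_rot//; congr (qinv _ _); rewrite -rowE; apply/rowP => i; rewrite mxE.
  by have := col_mxEu u N ord0 i; rewrite (_ : lshift k ord0 = ord0)//; apply: val_inj.
by under eq_integral do rewrite E.
Qed.

Lemma unit_multiple k (v : 'rV[R]_k.+1) : exists2 u : 'rV[R]_k.+1, u *m u^T = 1%:M & v =
  frob v *: u.
Proof.
have [v0|v0] := eqVneq (frob v) 0.
  exists (delta_mx 0 ord0); first by rewrite trmx_delta mul_delta_mx; apply/matrixP => i j;
    rewrite !ord1 !mxE !eqxx.
  by rewrite v0 scale0r; apply: fsq_eq0; rewrite -frob_sqr v0 expr0n.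
exists ((frob v)^-1 *: v); last by rewrite scalerA mulfV// scale1r.
apply/matrixP => i j; rewrite !ord1.
have : fsq ((frob v)^-1 *: v) = 1 by rewrite fsqZ -frob_sqr exprVn mulVf// expf_eq0.
by rewrite fsqE /mxtrace big_ord1 => ->; rewrite mxE eqxx.
Qed.

(** Each column of [M] is a multiple of a unit vector, and with m = 1 the moment bound gives 1/(j-2)
    for j degrees of freedom. *)
Lemma tsq_mean k s l (M : 'M[R]_(k, s)) (X : 'I_k * 'I_l -> T -> R) :
  (0 < k)%N -> gauss_array P X -> (k + 2 <= l)%N ->
  (\int[P]_w (tsq M (arr_mx (X ^~ w)))%:E <= (fsq M / (l%:R - k%:R - 1))%:E)%E.
Proof.
case: k M X => // k M X _ gX kl.
have lk0 : 0 < l%:R - k.+1%:R - 1 :> R.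
  have : (k.+1 + 2)%:R <= l%:R :> R by rewrite ler_nat.
  rewrite natrD; lra.
have mX := gauss_array_mx gX.
under eq_integral do rewrite tsqE -sumEFin.
rewrite ge0_integral_sum//=; last 2 first.
- by move=> j; apply/measurable_EFinP; exact: borel_qinv.
- by move=> j w _; rewrite lee_fin qinv_ge0.
have -> : fsq M / (l%:R - k.+1%:R - 1) = \sum_j fsq (row j M^T) / (l%:R - k.+1%:R - 1).
  by rewrite -mulr_suml -fsq_rows fsq_tr.
rewrite -sumEFin; apply: lee_sum => j _.
set v := row j _; have [u uu vE] := unit_multiple v.
have E w : (qinv v (arr_mx (X ^~ w)))%:E = ((fsq v)%:E * (qinv u (arr_mx (X ^~ w)))%:E)%E.
  by rewrite -EFinM {1}vE qinvZ frob_sqr.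
under eq_integral do rewrite E.
rewrite ge0_integralZl//=; last 3 first.
- by apply/measurable_EFinP; exact: borel_qinv.
- by move=> w _; rewrite lee_fin qinv_ge0.
- by rewrite lee_fin fsq_ge0.
rewrite EFinM; apply: lee_wpmul2l; first by rewrite lee_fin fsq_ge0.
have kl' : (k <= l)%N by lia.
have := @qinv_moment k l 1 u X uu gX kl'.
have -> : (l - k = (l - k - 3).+3)%N by lia.
move=> h; have {}h := le_trans h (rint1 _ _).
have -> : l%:R - k.+1%:R - 1 = (l - k - 3).+1%:R :> R.
  rewrite (_ : (l - k - 3).+1 = l - (k + 2))%N; last by lia.
  by rewrite natrB ?natrD -?natr1; [lra|lia].
apply: le_trans h; rewrite le_eqVlt; apply/orP; left; apply/eqP; apply: eq_integral => w _.
by rewrite /= mul1r sqr_sqrtr// qinv_ge0.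
Qed.

(** The order is p = l - k.+1 with p + 1 degrees of freedom; thus m = p - 1, and p >= 4 is the
    condition m >= 3 of [rint_bound]. *)
Lemma qinv_power k l (u : 'rV[R]_k.+1) (X : 'I_k.+1 * 'I_l -> T -> R) :
  u *m u^T = 1%:M -> gauss_array P X -> (k.+1 + 4 <= l)%N ->
  (\int[P]_w (Num.sqrt (qinv u (arr_mx (X ^~ w))) ^+ (l - k.+1))%:E <=
    (wconst R (l - k.+1).-1 ^+ (l - k.+1))%:E)%E.
Proof.
move=> uu gX kl; have mX := gauss_array_mx gX.
have [m [pE m3]] : exists m, (l - k.+1 = m.+1 /\ 3 <= m)%N by exists (l - k.+1).-1; lia.
have kl' : (k <= l)%N by lia.
have := @qinv_moment k l m u X uu gX kl'.
have -> : (l - k = m.+2)%N by lia.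
move=> h; have {}h := le_trans h (rint_bound _ m3); rewrite pE /=.
have g0 := gconst_gt0 R m.
move: h; under eq_integral do rewrite EFinM.
rewrite ge0_integralZl//=; last 2 first.
- apply/measurable_EFinP; apply: measurable_funX.
  by apply: (measurableT_comp (continuous_measurable_fun (@sqrt_continuous R)));
    exact: borel_qinv.
- by rewrite lee_fin ltW.
by rewrite EFinM lee_pmul2l// ?fin_numE// lte_fin.
Qed.

(** Jensen's inequality with the squared column norms of [M], divided by [fsq M], as weights: the
    constant is that of a single unit vector, whatever the number of columns. *)
Lemma tsq_power k s l (M : 'M[R]_(k, s)) (X : 'I_k * 'I_l -> T -> R) :
  (0 < k)%N -> gauss_array P X -> (k + 4 <= l)%N ->
  (\int[P]_w (Num.sqrt (tsq M (arr_mx (X ^~ w))) ^+ (l - k))%:E <=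
    ((frob M * wconst R (l - k).-1) ^+ (l - k))%:E)%E.
Proof.
case: k M X => // k M X _ gX kl; have mX := gauss_array_mx gX.
have w0 : 0 <= wconst R (l - k.+1).-1 by exact: sqrtr_ge0.
have [M0|M0] := eqVneq (fsq M) 0.
  rewrite (fsq_eq0 M0); under eq_integral => w _.
    rewrite (_ : tsq _ _ = 0).
      rewrite sqrtr0 (_ : (l - k.+1 = (l - k.+1).-1.+1)%N); last by lia.
      rewrite expr0n/=; over.
    by rewrite /tsq; case: ifP => // _; rewrite mulmx0 fsq0.
  by rewrite integral0 lee_fin exprn_ge0// mulr_ge0// frob_ge0.
have Mp : 0 < fsq M by rewrite lt_def M0 fsq_ge0.
have /choice[u uP] : forall j, exists u : 'rV[R]_k.+1,
    u *m u^T = 1%:M /\ row j M^T = frob (row j M^T) *: u.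
  by move=> j; have [u uu vE] := unit_multiple (row j M^T); exists u.
pose lam j := fsq (row j M^T) / fsq M.
have lam0 j : 0 <= lam j by rewrite divr_ge0 ?fsq_ge0.
have lam1 : \sum_j lam j = 1 by rewrite -mulr_suml -fsq_rows fsq_tr mulfV.
have [m pE] : exists m, (l - k.+1 = m.+2)%N by exists (l - k.+1).-2; lia.
have le w : Num.sqrt (tsq M (arr_mx (X ^~ w))) ^+ (l - k.+1) <=
    \sum_j (frob M ^+ (l - k.+1) * lam j) * Num.sqrt (qinv (u j) (arr_mx (X ^~ w))) ^+ (l - k.+1).
  have -> : tsq M (arr_mx (X ^~ w)) = fsq M * \sum_j lam j * qinv (u j) (arr_mx (X ^~ w)).
    rewrite tsqE mulr_sumr; apply: eq_bigr => j _; have [_ {1}->] := uP j.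
    by rewrite qinvZ frob_sqr mulrA /lam mulrCA mulfV// mulr1.
  rewrite sqrtrM ?fsq_ge0// exprMn -/(frob M).
  under [leRHS]eq_bigr do rewrite -mulrA.
  rewrite -mulr_sumr; apply: ler_wpM2l; first by rewrite exprn_ge0// frob_ge0.
  by rewrite pE; apply: sqrt_power_jensen => // j; exact: qinv_ge0.
have ms (h : 'M[R]_(k.+1, l) -> R) : borel_mx h ->
    measurable_fun [set: T] (fun w => Num.sqrt (h (arr_mx (X ^~ w))) ^+ (l - k.+1)).
  move=> bh; apply: measurable_funX.
  by apply: (measurableT_comp (continuous_measurable_fun (@sqrt_continuous R))); exact: bh.
apply: (@le_trans _ _ (\int[P]_w (\sum_j (frob M ^+ (l - k.+1) * lam j)%:E * (Num.sqrt (qinv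
  (u j) (arr_mx (X ^~ w))) ^+ (l - k.+1))%:E)%E)%E).
  apply: ge0_le_integral => //.
  - by apply/measurable_EFinP; apply: ms; exact: borel_tsq.
  - apply: emeasurable_sum => j; apply: measurable_funeM; apply/measurable_EFinP; apply: ms;
    exact: borel_qinv.
  - by move=> w _; under eq_bigr do rewrite -EFinM; rewrite sumEFin lee_fin.
have c0 j : (0 <= (frob M ^+ (l - k.+1) * lam j)%:E)%E.
  by rewrite lee_fin mulr_ge0// exprn_ge0// frob_ge0.
rewrite ge0_integral_sum//=; last 2 first.
- by move=> j; apply: measurable_funeM; apply/measurable_EFinP; apply: ms; exact: borel_qinv.
- by move=> j w _; rewrite mule_ge0// lee_fin exprn_ge0// sqrtr_ge0.
have -> : (frob M * wconst R (l - k.+1).-1) ^+ (l - k.+1) =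
    \sum_j (frob M ^+ (l - k.+1) * lam j) * wconst R (l - k.+1).-1 ^+ (l - k.+1).
  by rewrite exprMn -mulr_suml -mulr_sumr lam1 mulr1.
rewrite -sumEFin; apply: lee_sum => j _.
rewrite ge0_integralZl//=; last first.
  by apply/measurable_EFinP; apply: ms; exact: borel_qinv.
rewrite [X in (_ <= X)%E]EFinM; apply: lee_wpmul2l => //; apply: qinv_power => //.
by have [] := uP j.
Qed.

End gram_moments.

(** * Bounds for a frozen right factor *)

Section conditional_bounds.
Context (R : realType) (d : measure_display) (T : measurableType d) (P : probability T R).

Lemma measurable_lt_set (f g : T -> R) : measurable_fun [set: T] f -> measurable_fun [set: T] g ->
  measurable [set w | f w < g w].
Proof.
move=> mf mg; have := measurable_fun_ltr mf mg measurableT (I : measurable [set true]).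
by rewrite setTI; congr measurable; apply/seteqP; split => w.
Qed.

Lemma markov_ge0 (f : T -> R) (c m : R) : measurable_fun [set: T] f -> (forall w, 0 <= f w) ->
  0 < c -> (\int[P]_w (f w)%:E <= m%:E)%E -> (P [set w | (c < f w)%R] <= (m / c)%:E)%E.
Proof.
move=> mf f0 c0 fm; set E := [set w | _].
have mE : measurable E by apply: measurable_lt_set => //; exact: measurable_cst.
have h : (c%:E * P E <= m%:E)%E.
  apply: le_trans fm.
  have -> : (c%:E * P E = \int[P]_w (c%:E * (\1_E w)%:E))%E.
    by rewrite ge0_integralZl//= ?integral_indic ?setIT ?lee_fin ?(ltW c0)//;
      apply/measurable_EFinP; exact: measurable_indic.
  apply: ge0_le_integral => //.
  - by move=> w _; rewrite mule_ge0 ?lee_fin ?(ltW c0).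
  - by apply: measurable_funeM; apply/measurable_EFinP; exact: measurable_indic.
  - by apply/measurable_EFinP.
  - move=> w _; rewrite -EFinM lee_fin indicE; case: (boolP (w \in E)) => [|_].
      by rewrite inE /E /= mulr1; exact: ltW.
    by rewrite mulr0.
have fE : P E \is a fin_num by exact: fin_num_measure.
by move: h; rewrite -(fineK fE) -EFinM !lee_fin ler_pdivlMr// mulrC.
Qed.

Section fixed_right_factor.
Context (q r l s : nat) (Sg : 'M[R]_(q, r)) (Tm : 'M[R]_(l, s)).
Context (Y : 'I_r * 'I_l -> T -> R) (gY : gauss_array P Y).

Let c (i : 'I_q) (j : 'I_s) (ab : 'I_r * 'I_l) : R := Sg i ab.1 * Tm ab.2 j.

Lemma bilinear_entry w i j : (Sg *m arr_mx (Y ^~ w) *m Tm) i j = \sum_ab c i j ab * Y ab w.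
Proof.
transitivity (\sum_a \sum_b c i j (a, b) * Y (a, b) w); last first.
  by rewrite pair_bigA; apply: eq_bigr => -[].
rewrite mxE exchange_big /=; apply: eq_bigr => b _; rewrite mxE mulr_suml.
by apply: eq_bigr => a _; rewrite mxE /c /=; ring.
Qed.

Lemma bilinear_weights : \sum_i \sum_j \sum_ab c i j ab ^+ 2 = fsq Sg * fsq Tm.
Proof.
rewrite -(fsq_tr Tm) /fsq mulr_suml; apply: eq_bigr => i _; rewrite mulr_sumr.
apply: eq_bigr => j _.
transitivity (\sum_a \sum_b c i j (a, b) ^+ 2).
  by rewrite pair_bigA; apply: eq_bigr => -[].
rewrite mulr_suml; apply: eq_bigr => a _; rewrite mulr_sumr; apply: eq_bigr => b _.
by rewrite /c /= exprMn mxE.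
Qed.

Let mcomb (i : 'I_q) (j : 'I_s) : measurable_fun [set: T] (fun w => \sum_ab c i j ab * Y ab w).
Proof.
by have [mY _] := gY; apply: measurable_sum => ab; apply: measurable_funM => //; exact: mY.
Qed.

Lemma fixed_mean (Th : 'M[R]_(q, s)) :
  (\int[P]_w (fsq (Th + Sg *m arr_mx (Y ^~ w) *m Tm))%:E <= (fsq Th + fsq Sg * fsq Tm)%:E)%E.
Proof.
have E w : (fsq (Th + Sg *m arr_mx (Y ^~ w) *m Tm))%:E =
    (\sum_i \sum_j ((Th i j + \sum_ab c i j ab * Y ab w) ^+ 2)%:E)%E.
  rewrite /fsq -sumEFin; apply: eq_bigr => i _; rewrite -sumEFin; apply: eq_bigr => j _.
  by rewrite mxE bilinear_entry.
have mt i j : measurable_fun [set: T] (fun w => ((Th i j + \sum_ab c i j ab * Y ab w) ^+ 2)%:E).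
  by apply/measurable_EFinP; apply: measurable_funX; apply: measurable_funD => //; exact: mcomb.
have t0 i j w : (0 <= ((Th i j + \sum_ab c i j ab * Y ab w) ^+ 2)%:E :> \bar R)%E by rewrite
  lee_fin sqr_ge0.
under eq_integral do rewrite E.
rewrite ge0_integral_sum//=; last 2 first.
- by move=> i; apply: emeasurable_sum => j; exact: mt.
- by move=> i w _; apply: sume_ge0 => j _; exact: t0.
rewrite -bilinear_weights /fsq -big_split/= -sumEFin; apply: lee_sum => i _.
rewrite ge0_integral_sum//=.
rewrite -big_split/= -sumEFin; apply: lee_sum => j _; exact: gauss_comb_sqr.
Qed.

(** Entries are Gaussian with variances adding up to V. The excess of the squared norm over a V is
    at most the sum of the entrywise excesses, of mean at most 2 V exp(-13(a+2)/27); Markov's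
    inequality at level 2 V leaves the exponential alone. Dependence between entries is harmless. *)
Lemma fixed_tail (a : R) : 2 <= a ->
  (P [set w | ((a + 2) * (fsq Sg * fsq Tm) < fsq (Sg *m arr_mx (Y ^~ w) *m Tm))%R] <=
   (expR (- (13 * (a + 2) / 27)))%:E)%E.
Proof.
move=> a2; set V := fsq Sg * fsq Tm.
have V0 : 0 <= V by rewrite mulr_ge0 ?fsq_ge0.
have [Vz|Vz] := eqVneq V 0.
  rewrite (_ : [set w | _] = set0) ?measure0 ?lee_fin ?expR_ge0//.
  apply/seteqP; split => w //=; rewrite Vz mulr0.
  move/eqP: Vz; rewrite mulf_eq0 => /orP[]/eqP/fsq_eq0 ->; rewrite ?mul0mx ?mulmx0 fsq0 ltxx//.
have Vp : 0 < V by rewrite lt_def Vz.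
pose s2 i j := \sum_ab c i j ab ^+ 2.
pose f w := \sum_i \sum_j Num.max ((\sum_ab c i j ab * Y ab w) ^+ 2 - a * s2 i j) 0.
have t0 i j w : 0 <= Num.max ((\sum_ab c i j ab * Y ab w) ^+ 2 - a * s2 i j) 0 by rewrite
  le_max lexx orbT.
have mt i j : measurable_fun [set: T] (fun w => Num.max
  ((\sum_ab c i j ab * Y ab w) ^+ 2 - a * s2 i j) 0).
  apply: measurable_maxr => //; apply: measurable_funB => //.
  by apply: measurable_funX; exact: mcomb.
have mf : measurable_fun [set: T] f by apply: measurable_sum => i; apply: measurable_sum => j;
  exact: mt.
have f0 w : 0 <= f w by apply: sumr_ge0 => i _; apply: sumr_ge0.
have int : (\int[P]_w (f w)%:E <= (V * (2 * expR (- (13 * (a + 2) / 27))))%:E)%E.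
  have E w : (f w)%:E = (\sum_i \sum_j (Num.max
    ((\sum_ab c i j ab * Y ab w) ^+ 2 - a * s2 i j) 0)%:E)%E.
    by rewrite /f -sumEFin; apply: eq_bigr => i _; rewrite -sumEFin.
  under eq_integral do rewrite E.
  rewrite ge0_integral_sum//=; last 2 first.
  - by move=> i; apply: emeasurable_sum => j; apply/measurable_EFinP; exact: mt.
  - by move=> i w _; apply: sume_ge0 => j _; rewrite lee_fin.
  rewrite /V -bilinear_weights mulr_suml -sumEFin; apply: lee_sum => i _.
  rewrite ge0_integral_sum//=; last 2 first.
  - by move=> j; apply/measurable_EFinP; exact: mt.
  - by move=> j w _; rewrite lee_fin.
  by rewrite mulr_suml -sumEFin; apply: lee_sum => j _; exact: gauss_comb_tail.
have V2 : 0 < 2 * V by rewrite mulr_gt0.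
have := markov_ge0 mf f0 V2 int.
have -> : V * (2 * expR (- (13 * (a + 2) / 27))) / (2 * V) = expR (- (13 * (a + 2) / 27)).
  by field; rewrite gt_eqF.
apply: le_trans; apply: le_measure; rewrite ?inE.
- apply: measurable_lt_set => //.
  have -> : (fun w => fsq (Sg *m arr_mx (Y ^~ w) *m Tm)) =
    (fun w => \sum_i \sum_j (\sum_ab c i j ab * Y ab w) ^+ 2).
    by apply/funext => w; apply: eq_bigr => i _; apply: eq_bigr => j _; rewrite bilinear_entry.
  by apply: measurable_sum => i; apply: measurable_sum => j; apply: measurable_funX; exact: mcomb.
- by apply: measurable_lt_set => //; exact: measurable_cst.
- move=> w /= h.
  have : fsq (Sg *m arr_mx (Y ^~ w) *m Tm) - a * V <= f w.
    rewrite /V -bilinear_weights /fsq mulr_sumr -sumrB; apply: ler_sum => i _.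
    rewrite mulr_sumr -sumrB; apply: ler_sum => j _; rewrite bilinear_entry.
    by rewrite le_max lexx.
  by move: h; rewrite mulrDl; lra.
Qed.

End fixed_right_factor.
End conditional_bounds.

(** * The residual of the sketch *)

Section residual.
Context (R : realType) (d : measure_display) (T : measurableType d) (P : probability T R).
Context (q k r l s : nat) (Sg : 'M[R]_(q, r)) (M : 'M[R]_(k, s)).
Context (X : 'I_(k + r) * 'I_l -> T -> R) (gX : gauss_array P X).

Definition gsol (G : 'M[R]_(k + r, l)) : 'M[R]_(l, s) :=
  (usubmx G)^T *m invmx (gram (usubmx G)) *m M.

(** The random part of the error bound: [Th] is the tangent term in the mean bound and 0 in the
    deviation bound. *)
Definition resid (Th : 'M[R]_(q, s)) (G : 'M[R]_(k + r, l)) : R :=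
  if gram (usubmx G) \in unitmx then fsq (Th + Sg *m dsubmx G *m gsol G) else 0.

Lemma resid_ge0 Th G : 0 <= resid Th G.
Proof. by rewrite /resid; case: ifP => // _; exact: fsq_ge0. Qed.

Lemma mx_measurable_usub (d' : measure_display) (T' : measurableType d') (F : T' -> 'M[R]_(k +
  r, l)) :
  mx_measurable F -> mx_measurable (fun w => usubmx (F w)).
Proof. by move=> h i j; under eq_fun do rewrite mxE; exact: h. Qed.

Lemma borel_resid Th : borel_mx (resid Th).
Proof.
move=> d' T' F mF; have mU := mx_measurable_usub mF.
apply: measurable_fun_ifT => //.
  by apply: measurable_fun_unitmx; exact: mx_measurable_gram.
apply: measurable_fsq; apply: mx_measurable_add; first exact: mx_measurable_cst.
apply: mx_measurable_mul.
  apply: mx_measurable_mul; first exact: mx_measurable_cst.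
  by move=> i j; under eq_fun do rewrite mxE; exact: mF.
apply: mx_measurable_mul; last exact: mx_measurable_cst.
apply: mx_measurable_mul; first exact: mx_measurable_tr.
by apply: mx_measurable_inv; exact: mx_measurable_gram.
Qed.

Let XU (ib : 'I_k * 'I_l) := X (lshift r ib.1, ib.2).
Let XD (ib : 'I_r * 'I_l) := X (rshift k ib.1, ib.2).

Let gXU : gauss_array P XU.
Proof.
apply: (gauss_array_inj (f := fun ib => (lshift r ib.1, ib.2))) gX => -[a b] [a' b'] e.
by have /= /lshift_inj -> := congr1 fst e; have /= -> := congr1 snd e.
Qed.

Let gXD : gauss_array P XD.
Proof.
apply: (gauss_array_inj (f := fun ib => (rshift k ib.1, ib.2))) gX => -[a b] [a' b'] e.
by have /= /rshift_inj -> := congr1 fst e; have /= -> := congr1 snd e.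
Qed.

Let G w := arr_mx (X ^~ w).
Let U w := usubmx (G w).

Let UE w : U w = arr_mx (XU ^~ w).
Proof. by apply/matrixP => i j; rewrite !mxE. Qed.

Let mG : mx_measurable G.
Proof. exact: (gauss_array_mx gX). Qed.

Let mU : mx_measurable U.
Proof. exact: (mx_measurable_usub mG). Qed.

Let J : pred ('I_(k + r) * 'I_l) := fun ib => (ib.1 < k)%N.

Let mixU w w' : usubmx (arr_mx (fun i => if J i then X i w else X i w')) = U w.
Proof. by apply/matrixP => i j; rewrite !mxE /J /= ltn_ord. Qed.

Let mixD w w' : dsubmx (arr_mx (fun i => if J i then X i w else X i w')) = arr_mx (XD ^~ w').
Proof. by apply/matrixP => i j; rewrite !mxE /J /= ltnNge leq_addr. Qed.

Lemma resid_mean Th : (0 < k)%N -> (k + 2 <= l)%N ->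
  (\int[P]_w (resid Th (G w))%:E <= (fsq Th + fsq Sg * (fsq M / (l%:R - k%:R - 1)))%:E)%E.
Proof.
move=> k0 kl.
have mt : measurable_fun [set: T] (fun w => tsq M (U w)) by exact: (borel_tsq M mU).
apply: (@le_trans _ _ (\int[P]_w ((fsq Th)%:E + (fsq Sg)%:E * (tsq M (U w))%:E))%E).
  apply: (@gauss_array_decouple_le _ _ _ P _ X J (fun x => (resid Th (arr_mx x))%:E)) => //.
  - by apply: borel_mx_array; exact: borel_resid.
  - by move=> x; rewrite lee_fin resid_ge0.
  - by apply: emeasurable_funD => //; apply: measurable_funeM; exact/measurable_EFinP.
  - by move=> w; rewrite adde_ge0 ?mule_ge0 ?lee_fin ?fsq_ge0 ?tsq_ge0.
  - move=> w; rewrite /resid /gsol; under eq_integral do rewrite mixU mixD.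
    rewrite /tsq; case: ifP => _; first by rewrite -EFinM -EFinD; exact: (fixed_mean _ _ gXD).
    by rewrite integral0 mule0 adde0 lee_fin fsq_ge0.
rewrite ge0_integralD//=; last 3 first.
- by move=> w _; rewrite lee_fin fsq_ge0.
- by move=> w _; rewrite mule_ge0 ?lee_fin ?fsq_ge0 ?tsq_ge0.
- by apply: measurable_funeM; exact/measurable_EFinP.
rewrite integral_prob_cst ge0_integralZl//=; last 3 first.
- exact/measurable_EFinP.
- by move=> w _; rewrite lee_fin tsq_ge0.
- by rewrite lee_fin fsq_ge0.
rewrite EFinD EFinM; apply: leeD => //; apply: lee_wpmul2l; first by rewrite lee_fin fsq_ge0.
by under eq_integral do rewrite UE; exact: tsq_mean.
Qed.

(** The threshold is random but depends on the upper block only, hence is frozen by the decoupling;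
    [fixed_tail] then applies with a = y - 2. *)
Lemma resid_tail (y : R) : 4 <= y ->
  (P [set w | (y * (fsq Sg * tsq M (U w)) < resid 0 (G w))%R] <= (expR (- (13 * y / 27)))%:E)%E.
Proof.
move=> y4; set E := [set w | _].
pose b (A : 'M[R]_(k + r, l)) := y * (fsq Sg * tsq M (usubmx A)) < resid 0 A.
have bE : borel_mx (fun A => if b A then 1 else 0 : R).
  move=> d' T' F mF; apply: measurable_fun_ifT => //.
  apply: measurable_fun_ltr; last exact: borel_resid.
  apply: measurable_funM => //; apply: measurable_funM => //.
  by apply: borel_tsq; exact: mx_measurable_usub.
have mE : measurable E.
  apply: measurable_lt_set; last exact: (borel_resid 0 mG).
  by apply: measurable_funM => //; apply: measurable_funM => //; exact: (borel_tsq M mU).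
have -> : P E = (\int[P]_w (if b (G w) then 1 else 0)%:E)%E.
  rewrite -[in LHS](setIT E) -integral_indic//; apply: eq_integral => w _.
  rewrite indicE; congr EFin.
  have -> : (w \in E) = b (G w) by apply/idP/idP; rewrite inE.
  by case: (b _).
rewrite -(integral_prob_cst P (expR (- (13 * y / 27)))%:E).
apply: (@gauss_array_decouple_le _ _ _ P _ X J (fun x => (if b
  (arr_mx x) then 1 else 0)%:E)) => //.
- by have := borel_mx_array bE.
- by move=> x; case: ifP; rewrite lee_fin.
move=> w; rewrite /b /resid /gsol; under eq_integral do rewrite mixU mixD.
rewrite /tsq; case: ifP => _; last first.
  rewrite !mulr0 ltxx integral0 lee_fin; exact: expR_ge0.
set Tm := _ *m M; under eq_integral do rewrite add0r.
have y2 : 2 <= y - 2 by lra.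
have := fixed_tail Sg Tm gXD y2; rewrite subrK; apply: le_trans.
set E' := [set w | _].
have mE' : measurable E'.
  apply: measurable_lt_set; first exact: measurable_cst.
  apply: measurable_fsq; apply: mx_measurable_mul; last exact: mx_measurable_cst.
  by apply: mx_measurable_mul; [exact: mx_measurable_cst|exact: (gauss_array_mx gXD)].
rewrite -[X in (_ <= P X)%E](setIT E') -integral_indic// le_eqVlt; apply/orP; left; apply/eqP.
apply: eq_integral => w' _; rewrite indicE; congr EFin.
have -> : (w' \in E') = (y * (fsq Sg * fsq Tm) < fsq (Sg *m arr_mx (XD ^~ w') *m Tm)).
  by apply/idP/idP; rewrite inE.
by case: ifP.
Qed.

Lemma gram_null : (k + 2 <= l)%N -> P [set w | gram (U w) \notin unitmx] = 0%E.
Proof.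
move=> kl; rewrite -(gram_singular_null gXU kl); congr (P _).
by apply/seteqP; split => w /=; rewrite UE.
Qed.

Let m_singular : measurable [set w | gram (U w) \notin unitmx].
Proof.
have := measurable_fun_unitmx (mx_measurable_gram mU) measurableT (I : measurable [set false]).
by rewrite setTI; congr measurable; apply/seteqP; split => w /=; [by move=> ->|by move=> /negbTE].
Qed.

(* AM-GM: err <= (err^2 + B^2) / (2 B), where B^2 is the bound on the mean of err^2. *)
Lemma mean_bound (err : T -> R) (Th : 'M[R]_(q, s)) (b : R) : (0 < k)%N -> (k + 2 <= l)%N ->
  measurable_fun [set: T] err -> (forall w, 0 <= err w) -> 0 < b ->
  (forall w, gram (U w) \in unitmx -> err w ^+ 2 <= b ^+ 2 + resid Th (G w)) ->
  (\int[P]_w (err w)%:E <=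
    (Num.sqrt (b ^+ 2 + (fsq Th + fsq Sg * (fsq M / (l%:R - k%:R - 1)))))%:E)%E.
Proof.
move=> k0 kl merr err0 b0 h; set B2 := _ + (_ + _); set B := Num.sqrt B2.
have lk0 : 0 < l%:R - k%:R - 1 :> R.
  have : (k + 2)%:R <= l%:R :> R by rewrite ler_nat.
  rewrite natrD; lra.
have B20 : 0 < B2.
  rewrite /B2 ltr_pwDl ?exprn_gt0// addr_ge0 ?fsq_ge0// mulr_ge0 ?fsq_ge0// divr_ge0 ?fsq_ge0//.
  exact: ltW.
have Bp : 0 < B by rewrite sqrtr_gt0.
have BB : B ^+ 2 = B2 by rewrite sqr_sqrtr// ltW.
have mr : measurable_fun [set: T] (fun w => resid Th (G w)) by exact: (borel_resid Th mG).
pose c := (2 * B)^-1; have c0 : 0 < c by rewrite invr_gt0 mulr_gt0.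
apply: (@le_trans _ _ (\int[P]_w ((c * (b ^+ 2 + B2))%:E + c%:E * (resid Th (G w))%:E))%E).
  apply: ae_ge0_le_integral => //.
  - by move=> w _; rewrite lee_fin.
  - exact/measurable_EFinP.
  - move=> w _; rewrite adde_ge0 ?mule_ge0 ?lee_fin ?resid_ge0 ?(ltW c0)//.
    by rewrite mulr_ge0 ?(ltW c0)// addr_ge0 ?(ltW B20) ?sqr_ge0.
  - by apply: emeasurable_funD => //; apply: measurable_funeM; exact/measurable_EFinP.
  - exists [set w | gram (U w) \notin unitmx]; split; [exact: m_singular|exact: gram_null kl|].
    move=> w /= hw; apply/negP => uw; apply: hw => _.
    rewrite -EFinM -EFinD lee_fin -mulrDr.
    have := h w uw; have := sqr_ge0 (err w - B); rewrite sqrrB BB => h1 h2.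
    have : err w * (2 * B) <= b ^+ 2 + B2 + resid Th (G w) by lra.
    by rewrite -ler_pdivlMr ?mulr_gt0// mulrC.
rewrite ge0_integralD//=; last 3 first.
- by move=> w _; rewrite lee_fin mulr_ge0 ?(ltW c0)// addr_ge0 ?(ltW B20) ?sqr_ge0.
- by move=> w _; rewrite mule_ge0 ?lee_fin ?resid_ge0 ?(ltW c0).
- by apply: measurable_funeM; exact/measurable_EFinP.
rewrite integral_prob_cst ge0_integralZl//=; last 3 first.
- exact/measurable_EFinP.
- by move=> w _; rewrite lee_fin resid_ge0.
- by rewrite lee_fin ltW.
apply: (@le_trans _ _ ((c * (b ^+ 2 + B2))%:E + c%:E * (fsq Th + fsq Sg * (fsq M /
  (l%:R - k%:R - 1)))%:E)%E).
  apply: leeD => //; apply: lee_wpmul2l; first by rewrite lee_fin ltW.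
  exact: resid_mean.
rewrite -EFinM -EFinD lee_fin -mulrDr addrAC -/B2 -BB /c.
by rewrite le_eqVlt; apply/orP; left; apply/eqP; field; rewrite gt_eqF.
Qed.

Lemma resid_deviation (u t : R) : (0 < k)%N -> (k + 4 <= l)%N -> 1 <= u -> 1 <= t ->
  (P [set w | (3 * u ^+ 2 * t ^+ 2 * (fsq Sg * fsq M) / (l%:R - k%:R + 1) < resid 0 (G w))%R] <=
   (expR (- (u ^+ 2 / 2)) + t ^- (l - k))%:E)%E.
Proof.
move=> k0 kl u1 t1.
have e : ((l - k).-1 + 2 = (l - k).+1)%N by lia.
have lk : (0 < l - k)%N by lia.
set x := u ^+ 2; set V := fsq Sg * fsq M.
have [p pl] : exists p : R, l%:R - k%:R = p by eexists.
rewrite pl.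
have V0 : 0 <= V by rewrite mulr_ge0 ?fsq_ge0.
have x1 : 1 <= x by rewrite exprn_ege1.
clearbody x.
have t2 : 1 <= t ^+ 2 by rewrite exprn_ege1.
have p4 : 4 <= p.
  have : (k + 4)%:R <= l%:R :> R by rewrite ler_nat.
  rewrite natrD -pl; lra.
have pE : p = (l - k)%:R by rewrite -pl natrB//; lia.
have tp0 : 0 <= t ^- (l - k) by rewrite invr_ge0 exprn_ge0//; lra.
set c := 3 * x * t ^+ 2 * V / (p + 1).
set E := [set w | _].
have mr : measurable_fun [set: T] (fun w => resid 0 (G w)) by exact: (borel_resid 0 mG).
have mt : measurable_fun [set: T] (fun w => tsq M (U w)) by exact: (borel_tsq M mU).
have mE : measurable E by apply: measurable_lt_set => //; exact: measurable_cst.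
have [Vz|Vz] := eqVneq V 0.
  rewrite (_ : E = set0) ?measure0 ?lee_fin ?addr_ge0 ?expR_ge0//.
  apply/seteqP; split => w //; rewrite /E /= /c Vz mulr0 mul0r /resid; case: ifP => _;
    rewrite ?ltxx//.
  by move/eqP: Vz; rewrite /gsol mulf_eq0 => /orP[]/eqP/fsq_eq0 ->;
    rewrite ?mul0mx ?mulmx0 addr0 fsq0 ltxx.
have Vp : 0 < V by rewrite lt_def Vz.
have [xl|xl] := leP x (104 / 27).
  have cp : 0 < c.
    apply: divr_gt0; last by lra.
    by apply: mulr_gt0 Vp; apply: mulr_gt0; lra.
  have kl2 : (k + 2 <= l)%N by lia.
  have := resid_mean (0 : 'M[R]_(q, s)) k0 kl2; rewrite fsq0 add0r mulrA -/V pl => hm.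
  apply: le_trans (markov_ge0 mr (fun w => resid_ge0 0 (G w)) cp hm) _.
  rewrite lee_fin; apply: (@le_trans _ _ (expR (- (x / 2)))); last by rewrite lerDl.
  have e1 := expR_chord x1 xl.
  have e2 : 5 / (9 * x) <= expR (- (x / 2)).
    rewrite expRN -[5 / _]invrK lef_pV2 ?posrE ?expR_gt0 ?invr_gt0 ?divr_gt0//; last by lra.
    by apply: le_trans e1 _; rewrite invf_div; lra.
  apply: le_trans e2.
  rewrite /c.
  have -> : V / (p - 1) / (3 * x * t ^+ 2 * V / (p + 1)) = (p + 1) / (3 * (p - 1) * x * t ^+ 2).
    by field; rewrite !gt_eqF//; lra.
  rewrite ler_pdivrMr ?mulr_gt0//; try lra.
  (* What remains is p + 1 <= (5/3)(p - 1), an equality at p = 4. *)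
  have -> : 5 / (9 * x) * (3 * (p - 1) * x * t ^+ 2) = 5 / 3 * (p - 1) * t ^+ 2.
    by field; rewrite gt_eqF//; lra.
  have : 5 / 3 * (p - 1) * 1 <= 5 / 3 * (p - 1) * t ^+ 2 by apply: ler_wpM2l => //; lra.
  lra.
(* Beyond x = 104/27 this is at least 4, and 13 y / 27 = x / 2. *)
pose y := 27 / 26 * x.
have y4 : 4 <= y by rewrite /y; lra.
pose E1 := [set w | (26 / 9 * t ^+ 2 * fsq M / (p + 1) < tsq M (U w))%R].
pose E2 := [set w | (y * (fsq Sg * tsq M (U w)) < resid 0 (G w))%R].
have mE1 : measurable E1 by apply: measurable_lt_set => //; exact: measurable_cst.
have mE2 : measurable E2.
  by apply: measurable_lt_set => //; do 2 apply: measurable_funM => //.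
have P2 : (P E2 <= (expR (- (x / 2)))%:E)%E.
  apply: le_trans (resid_tail y4) _; rewrite lee_fin ler_expR /y; lra.
have P1 : (P E1 <= (t ^- (l - k))%:E)%E.
  have [Mz|Mz] := eqVneq (fsq M) 0.
    by move: Vz; rewrite /V Mz mulr0 eqxx.
  have Mp : 0 < fsq M by rewrite lt_def Mz fsq_ge0.
  have fM : 0 < frob M by rewrite sqrtr_gt0.
  set wc := wconst R (l - k).-1.
  have wc2 : wc ^+ 2 = 26 / 9 / (p + 1).
    transitivity (26 / 9 / ((l - k).-1 + 2)%:R : R); first exact: wconst_sqr.
    by rewrite e pE natr1.
  have wc0 : 0 < wc.
    rewrite lt_def sqrtr_ge0 andbT; apply: contraTneq (lexx (0 : R)) => z.
    move: wc2; rewrite z expr0n/= => h.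
    have : 0 < 26 / 9 / (p + 1) by rewrite divr_gt0//; lra.
    by rewrite -h ltxx.
  have ms : measurable_fun [set: T] (fun w => Num.sqrt (tsq M (U w)) ^+ (l - k)).
    apply: measurable_funX.
    by apply: (measurableT_comp (continuous_measurable_fun (@sqrt_continuous R))).
  have cp : 0 < (frob M * wc * t) ^+ (l - k) by rewrite exprn_gt0// !mulr_gt0//; lra.
  have s0 w : 0 <= Num.sqrt (tsq M (U w)) ^+ (l - k) by rewrite exprn_ge0// sqrtr_ge0.
  have hp : (\int[P]_w (Num.sqrt (tsq M (U w)) ^+ (l - k))%:E <= ((frob M * wc) ^+ (l - k))%:E)%E.
    by under eq_integral do rewrite UE; exact: tsq_power.
  (* Markov's inequality for the p-th power of |T|: the level is the moment bound times t^p. *)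
  have := markov_ge0 ms s0 cp hp.
  have -> : (frob M * wc) ^+ (l - k) / (frob M * wc * t) ^+ (l - k) = t ^- (l - k).
    rewrite [in X in _ / X]exprMn invfM mulrA mulfV ?mul1r//.
    by rewrite expf_neq0// mulf_neq0// gt_eqF.
  apply: le_trans; apply: le_measure; rewrite ?inE//.
    by apply: measurable_lt_set => //; exact: measurable_cst.
  move=> w /= hw; have a0 : 0 <= frob M * wc * t.
    by rewrite !mulr_ge0 ?(ltW fM) ?(ltW wc0)//; lra.
  have lt : frob M * wc * t < Num.sqrt (tsq M (U w)).
    rewrite -(@ltr_pXn2r _ 2)// ?nnegrE ?sqrtr_ge0//.
    rewrite sqr_sqrtr ?tsq_ge0// !exprMn frob_sqr wc2; apply: le_lt_trans hw.
    by rewrite le_eqVlt; apply/orP; left; apply/eqP; ring.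
  by rewrite ltr_pXn2r ?nnegrE ?sqrtr_ge0.
apply: (@le_trans _ _ (P (E1 `|` E2))).
  apply: le_measure; rewrite ?inE//; first exact: measurableU.
  move=> w /= hw; have [h|h] := ltP (26 / 9 * t ^+ 2 * fsq M / (p + 1)) (tsq M (U w));
    first by left.
  right; apply: le_lt_trans hw; rewrite /E2 /= /y.
  (* Since (27/26)(26/9) = 3, the random threshold of [E2] is at most [c] outside [E1]. *)
  have -> : c = 27 / 26 * x * (fsq Sg * (26 / 9 * t ^+ 2 * fsq M / (p + 1))).
    by rewrite /c /V; field; rewrite gt_eqF//; lra.
  apply: ler_wpM2l; first by lra.
  by apply: ler_wpM2l => //; exact: fsq_ge0.
apply: (@le_trans _ _ (P E1 + P E2)%E); first exact: measureU2.
by rewrite EFinD addeC; apply: leeD.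
Qed.

Lemma deviation_bound (err : T -> R) (b u t : R) : (0 < k)%N -> (k + 4 <= l)%N ->
  1 <= u -> 1 <= t -> measurable_fun [set: T] err ->
  (forall w, gram (U w) \in unitmx -> err w <= b + Num.sqrt (resid 0 (G w))) ->
  ((1 - expR (- (u ^+ 2 / 2)) - t ^- (l - k))%:E <=
    P [set w | (err w <= b + Num.sqrt 3 * u * t * (frob Sg * frob M / Num.sqrt (l%:R - k%:R +
      1)))%R])%E.
Proof.
move=> k0 kl u1 t1 merr h; set c := b + _; set E := [set w | _].
have kl2 : (k + 2 <= l)%N by lia.
have p0 : 0 < l%:R - k%:R + 1 :> R.
  have : (k + 4)%:R <= l%:R :> R by rewrite ler_nat.
  rewrite natrD; lra.
have EC : E = ~` [set w | c < err w].
  by apply/seteqP; split => w; rewrite /E /= leNgt => /negP.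
have mB : measurable [set w | c < err w] by apply: measurable_lt_set => //; exact: measurable_cst.
rewrite EC probability_setC//.
pose E1 := [set w | gram (U w) \notin unitmx].
pose E2 := [set w | (3 * u ^+ 2 * t ^+ 2 * (fsq Sg * fsq M) / (l%:R - k%:R + 1) < resid 0
  (G w))%R].
have mE2 : measurable E2.
  by apply: measurable_lt_set; [exact: measurable_cst|exact: (borel_resid 0 mG)].
have le : (P [set w | (c < err w)%R] <= (expR (- (u ^+ 2 / 2)) + t ^- (l - k))%:E)%E.
  apply: (@le_trans _ _ (P (E1 `|` E2))).
    apply: le_measure; rewrite ?inE//; first exact: measurableU.
    move=> w /= hw; have [uw|uw] := boolP (gram (U w) \in unitmx); [right|by left].
    rewrite /E2 /=.
    have h1 : Num.sqrt 3 * u * t * (frob Sg * frob M / Num.sqrt (l%:R - k%:R + 1)) < Num.sqrt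
      (resid 0 (G w)).
      by have := lt_le_trans hw (h w uw); rewrite /c ltrD2l.
    have a0 : 0 <= Num.sqrt 3 * u * t * (frob Sg * frob M / Num.sqrt (l%:R - k%:R + 1)).
      by rewrite !mulr_ge0 ?invr_ge0 ?sqrtr_ge0//; lra.
    have : (Num.sqrt 3 * u * t * (frob Sg * frob M / Num.sqrt (l%:R - k%:R +
      1))) ^+ 2 < Num.sqrt (resid 0 (G w)) ^+ 2.
      by rewrite ltr_pXn2r// ?nnegrE ?sqrtr_ge0.
    rewrite sqr_sqrtr ?resid_ge0//; apply: le_lt_trans.
    rewrite !exprMn exprVn !frob_sqr !sqr_sqrtr ?(ltW p0)//.
    by rewrite le_eqVlt; apply/orP; left; apply/eqP; ring.
  apply: (@le_trans _ _ (P E1 + P E2)%E); first exact: measureU2.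
  by rewrite gram_null// add0e; exact: resid_deviation.
have fB : P [set w | (c < err w)%R] \is a fin_num by exact: fin_num_measure.
move: le; rewrite -(fineK fB) -EFinB !lee_fin; lra.
Qed.

End residual.

(** * From the Gaussian test matrix to the error bounds *)

Lemma std_gaussian_mx_array (R : realType) (d : measure_display) (T : measurableType d)
    (P : probability T R) (r l : nat) (G : T -> 'M[R]_(r, l)) :
  std_gaussian_mx P G -> gauss_array P (fun (ib : 'I_r * 'I_l) w => G w ib.1 ib.2).
Proof.
move=> [col ind].
have colE w j i : tnth (rv_col G j w) i = G w i j by rewrite tnth_mktuple.
have mG (ib : 'I_r * 'I_l) : measurable_fun [set: T] (fun w => G w ib.1 ib.2).
  have [mc _ _] := col ib.2; have := mc ib.1.
  by under eq_fun do rewrite colE.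
split => // B mB.
pose C j : set (r.-tuple R) := [set x | forall i, B (i, j) (tnth x i)].
have mC j : measurable (C j).
  apply: measurable_forall => i; have := @measurable_tnth _ R r i measurableT _ (mB (i, j)).
  by rewrite setTI.
(* Independence between columns is tested on the boxes [C j]; independence inside each column then
   factors every box. *)
have -> : [set w | forall ib : 'I_r * 'I_l, B ib (G w ib.1 ib.2)] =
    \bigcap_(j in [set` [set x : 'I_l | true]%SET]) (rv_col G j @^-1` C j).
  apply/seteqP; split => w /= h.
    by move=> j _ i; rewrite colE; exact: (h (i, j)).
  by move=> [i j] /=; have := h j; rewrite /= finset.inE => /(_ isT i); rewrite colE.
rewrite ind; last by move=> j _; exact: mC.
have -> : (\prod_(ib : 'I_r * 'I_l) normal_prob 0 1 (B ib) =
  \prod_j \prod_i normal_prob 0 1 (B (i, j)))%E.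
  by rewrite exchange_big/= pair_bigA; apply: eq_bigr => -[].
rewrite (eq_bigl xpredT); last by move=> j; rewrite finset.inE.
apply: eq_bigr => j _; have [_ law indj] := col j.
have -> : rv_col G j @^-1` C j =
    \bigcap_(i in [set` [set x : 'I_r | true]%SET]) ((fun w => tnth (rv_col G j w) i) @^-1` B
      (i, j)).
  apply/seteqP; split => w /= h.
    by move=> i _; exact: h.
  by move=> i; have := h i; rewrite /= finset.inE; apply.
rewrite indj; last by move=> i _; exact: mB.
rewrite (eq_bigl xpredT); last by move=> i; rewrite finset.inE.
by apply: eq_bigr => i _; exact: law.
Qed.

Lemma sqrt_sqrD_le (R : realType) (a b x : R) : 0 <= a -> 0 <= b -> 0 <= x ->
  x ^+ 2 <= a ^+ 2 + b ^+ 2 -> x <= a + b.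
Proof.
move=> a0 b0 x0 h; apply: ler_of_sqr => //; first exact: addr_ge0.
have : 0 <= a * b by exact: mulr_ge0.
by move: h; rewrite !expr2; lra.
Qed.

Theorem theorem3p1 (R : realType) (m n k r l : nat)
    (A : 'M[R]_(m, n)) (U : 'M[R]_m) (S : 'M[R]_(m, n)) (V : 'M[R]_n)
    (k_ge1 : (1 <= k)%N) (km : (k <= m)%N) (kn : (k <= n)%N)
    (svdA : is_svd A U S V)
    (D : 'M[R]_(m, r))
    (rankDU : \rank (D^T *m hd_cols km U) = k)
    (l_rank : (l <= minn (\rank A) (\rank D) <= r)%N)
    (d : measure_display) (T : measurableType d) (P : probability T R)
    (G : T -> 'M[R]_(r, l)) (gaussG : std_gaussian_mx P G) :
  let Uk := hd_cols km U in
  let Ubk := tl_cols km U in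
  let Sk := hd_block km kn S in
  let Sbk := tl_block km kn S in
  let Z := fun w : T => D *m G w in
  let tau := frob (mxtan Uk Ubk (D *m D^T *m Uk) *m Sk) / frob Sbk in
  let rho := frob ((1%:M - colproj (D^T *m Uk)) *m D^T)
             * frob (Sk *m invsqrtmx (Uk^T *m D *m D^T *m Uk)) / frob Sbk in
  let err := fun w : T => frob ((1%:M - colproj (Z w)) *m A) in
  ((k + 2 <= l)%N ->
    ('E_P[err] <=
      (Num.sqrt (1 + tau ^+ 2 + rho ^+ 2 / (l%:R - k%:R - 1)) * frob Sbk)%:E)%E)
  /\
  ((k + 4 <= l)%N -> forall u t : R, 1 <= u -> 1 <= t ->
    ((1 - expR (- (u ^+ 2 / 2)) - t ^- (l - k))%:E <=
      P [set w | (err w <=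
        (1 + tau + Num.sqrt 3 * u * t * (rho / Num.sqrt (l%:R - k%:R + 1)))
          * frob Sbk)%R])%E).
Proof.
move=> Uk Ubk Sk Sbk Z tau rho err.
have lA : (l <= \rank A)%N by move: l_rank => /andP[]; rewrite leq_min => /andP[].
have [r' [Q [N /= [CQ Xs Xu QQ [NN NQ QN]]]]] := orthonormal_factor rankDU.
move: CQ Xs Xu; set X := sqrtmx _ => CQ Xs Xu.
have gram_eq : Uk^T *m D *m D^T *m Uk = (D^T *m Uk)^T *m (D^T *m Uk).
  by rewrite trmx_mul trmxK !mulmxA.
have sqrtE : invsqrtmx (Uk^T *m D *m D^T *m Uk) = invmx X by rewrite gram_eq.
pose Th := mxtan Uk Ubk (D *m D^T *m Uk) *m Sk.
pose Sg := Ubk^T *m D *m N^T.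
pose M := invmx X *m Sk.
(* Both [X] and [Sk] are symmetric, so transposition exchanges the order of the factors. *)
have ME : frob M = frob (Sk *m invsqrtmx (Uk^T *m D *m D^T *m Uk)).
  by rewrite sqrtE -frob_tr trmx_mul trmx_inv Xs (hd_block_sym km kn svdA).
have SgE : frob Sg <= frob ((1%:M - colproj (D^T *m Uk)) *m D^T).
  apply: ler_of_sqr; rewrite ?frob_ge0// !frob_sqr.
  exact: (tail_coupling_le svdA CQ Xu QQ NN QN).
pose Om := col_mx Q^T N.
have OO : Om *m Om^T = 1%:M.
  have QNt : Q^T *m N^T = 0 by rewrite -trmx_mul NQ trmx0.
  by rewrite tr_col_mx mul_col_row trmxK QQ NN NQ QNt -scalar_mx_block.
have gG := std_gaussian_mx_array gaussG.
have gX := gauss_array_rows OO gG.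
set XX := (fun ib : 'I_(k + r') * 'I_l => _) in gX.
have arrE w : arr_mx (XX ^~ w) = Om *m G w.
  apply/matrixP => i j; rewrite /XX mxE /=; congr ((Om *m _) i j).
  by apply/matrixP => a b; rewrite mxE.
have uE w : usubmx (arr_mx (XX ^~ w)) = Q^T *m G w by rewrite arrE mul_col_mx col_mxKu.
have dE w : dsubmx (arr_mx (XX ^~ w)) = N *m G w by rewrite arrE mul_col_mx col_mxKd.
pose Y w := Sg *m dsubmx (arr_mx (XX ^~ w)) *m gsol M (arr_mx (XX ^~ w)).
have bound w : gram (usubmx (arr_mx (XX ^~ w))) \in unitmx ->
    err w ^+ 2 <= frob Sbk ^+ 2 + fsq (Th + Y w).
  move=> uw; rewrite !frob_sqr; rewrite uE in uw.
  have := residual_bound kn svdA CQ Xs Xu QQ QN (erefl (Q^T *m G w)) uw.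
  by rewrite /Y /gsol uE dE.
have err0 w : 0 <= err w by exact: frob_ge0.
have merr : measurable_fun [set: T] err.
  apply: measurable_frob; apply: mx_measurable_mul; last exact: mx_measurable_cst.
  apply: mx_measurable_sub; first exact: mx_measurable_cst.
  apply: mx_measurable_colproj; apply: mx_measurable_mul; first exact: mx_measurable_cst.
  by move=> i j; have [mg _] := gG; exact: (mg (i, j)).
(* The rank condition follows from k < l <= \rank A and makes the divisions in tau and rho
   genuine. *)
have b0 : (k < \rank A)%N -> 0 < frob Sbk.
  by move=> kA; rewrite sqrtr_gt0; exact: (tl_block_neq0 km kn svdA kA).
split => [kl|kl u t u1 t1].
  have bp : 0 < frob Sbk by apply: b0; lia.
  have bn : frob Sbk != 0 by rewrite gt_eqF.
  have lk0 : 0 < l%:R - k%:R - 1 :> R.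
    have : (k + 2)%:R <= l%:R :> R by rewrite ler_nat.
    rewrite natrD; lra.
  have hb w : gram (usubmx (arr_mx (XX ^~ w))) \in unitmx ->
      err w ^+ 2 <= frob Sbk ^+ 2 + resid Sg M Th (arr_mx (XX ^~ w)).
    by move=> uw; rewrite /resid uw; exact: bound.
  rewrite unlock; apply: le_trans (mean_bound gX k_ge1 kl merr err0 bp hb) _.
  rewrite lee_fin -[frob Sbk in leRHS]ger0_norm ?frob_ge0// -sqrtr_sqr -sqrtrM; last first.
    by rewrite !addr_ge0// ?sqr_ge0// divr_ge0 ?sqr_ge0// ltW.
  rewrite ler_sqrt; last first.
    by rewrite mulr_ge0 ?sqr_ge0// !addr_ge0// ?sqr_ge0// divr_ge0 ?sqr_ge0// ltW.
  have -> : (1 + tau ^+ 2 + rho ^+ 2 / (l%:R - k%:R - 1)) * frob Sbk ^+ 2 =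
      frob Sbk ^+ 2 + (frob Th ^+ 2 + frob ((1%:M - colproj (D^T *m Uk)) *m D^T) ^+ 2 *
       (frob (Sk *m invsqrtmx (Uk^T *m D *m D^T *m Uk)) ^+ 2 / (l%:R - k%:R - 1))).
    by rewrite /tau /rho -/Th; field; rewrite bn gt_eqF.
  rewrite -ME !frob_sqr lerD2l lerD2l; apply: ler_wpM2r.
    by rewrite divr_ge0 ?fsq_ge0// ltW.
  by rewrite -!frob_sqr; apply: lerXn2r; rewrite ?nnegrE ?frob_ge0.
have bp : 0 < frob Sbk by apply: b0; lia.
have p0 : 0 < l%:R - k%:R + 1 :> R.
  have : (k + 4)%:R <= l%:R :> R by rewrite ler_nat.
  rewrite natrD; lra.
(* The tangent term is deterministic, so separating it leaves the purely Gaussian part, with 0 in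
   place of [Th], to the tail bound. *)
have hb w : gram (usubmx (arr_mx (XX ^~ w))) \in unitmx ->
    err w <= frob Sbk + frob Th + Num.sqrt (resid Sg M 0 (arr_mx (XX ^~ w))).
  move=> uw; rewrite /resid uw add0r -/(Y w).
  have h : err w <= frob Sbk + frob (Th + Y w).
    by apply: sqrt_sqrD_le; rewrite ?frob_ge0// [frob (Th + _) ^+ 2]frob_sqr; exact: bound.
  by have := frob_triangle Th (Y w); rewrite /frob in h *; lra.
apply: le_trans (deviation_bound gX k_ge1 kl u1 t1 merr hb) _.
have mle (c : R) : measurable [set w | (err w <= c)%R].
  rewrite (_ : [set w | _] = ~` [set w | (c < err w)%R]).
    by apply: measurableC; apply: measurable_lt_set => //; exact: measurable_cst.
  by apply/seteqP; split => w; rewrite /= leNgt => /negP.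
apply: le_measure; rewrite ?inE//.
move=> w /= h; apply: le_trans h _.
have -> : (1 + tau + Num.sqrt 3 * u * t * (rho / Num.sqrt (l%:R - k%:R + 1))) * frob Sbk =
   frob Sbk + frob Th + Num.sqrt 3 * u * t * (frob ((1%:M - colproj
     (D^T *m Uk)) *m D^T) * frob M / Num.sqrt (l%:R - k%:R + 1)).
  rewrite /tau /rho -/Th -ME; field.
  by rewrite !gt_eqF// sqrtr_gt0.
rewrite lerD2l; apply: ler_wpM2l; first by rewrite !mulr_ge0 ?sqrtr_ge0//; lra.
apply: ler_wpM2r; first by rewrite invr_ge0 sqrtr_ge0.
by apply: ler_wpM2r => //; exact: frob_ge0.
Qed.
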